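(* Let $k$ and $r$ be fixed nonnegative integers. There is a polynomial-time algorithm which, given a $(P_5+rK_1)$-free graph $G$ and a weight function $\omega: V(G)\to\mathbb{N}$, finds a $k$-colourable induced subgraph $H$ of $G$ maximizing $\omega(H)=\sum_{v\in V(H)}\omega(v)$ over all $k$-colourable induced subgraphs of $G$. That is, the Weighted Maximum $k$-colourable Induced Subgraph problem can be solved in polynomial time on $(P_5+rK_1)$-free graphs.
   Context: $P_5$ denotes the path on $5$ vertices, $rK_1$ the edgeless graph on $r$ vertices, and $P_5+rK_1$ their disjoint union. A graph is $F$-free if it contains no induced subgraph isomorphic to $F$. For a subgraph $H$ of $G$, $\omega(H)=\sum_{v\in V(H)}\omega(v)$. *)

(* Defs.v *)
From HB Require Import structures.
From mathcomp Require Import all_boot all_order all_algebra.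

Set Implicit Arguments.
Unset Strict Implicit.
Unset Printing Implicit Defensive.

Record sgraph := SGraph {
  vert :> finType;
  adj : rel vert;
  adj_sym : symmetric adj;
  adj_irr : irreflexive adj
}.

Section Induced.
Variables (G : sgraph) (S : {set G}).

Definition induced_adj : rel {x : G | x \in S} :=
  fun x y => adj (val x) (val y).

Lemma induced_sym : symmetric induced_adj.
Proof. by move=> x y; apply: adj_sym. Qed.

Lemma induced_irr : irreflexive induced_adj.
Proof. by move=> x; apply: adj_irr. Qed.

Definition induced : sgraph := SGraph induced_sym induced_irr.

End Induced.

Definition graph_iso (F G : sgraph) : Prop :=
  exists2 f : F -> G, bijective f & forall x y, adj (f x) (f y) = adj x y.

Definition induced_free (F G : sgraph) : Prop :=
  forall S : {set G}, ~ graph_iso (induced S) F.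

Section Path.
Variable n : nat.

Definition path_adj : rel 'I_n := fun i j => (i.+1 == j) || (j.+1 == i).

Lemma path_sym : symmetric path_adj.
Proof. by move=> i j; rewrite /path_adj orbC. Qed.

Lemma path_irr : irreflexive path_adj.
Proof. by move=> i; rewrite /path_adj orbb gtn_eqF. Qed.

Definition path_graph : sgraph := SGraph path_sym path_irr.

End Path.

Section Edgeless.
Variable n : nat.

Definition edgeless_adj : rel 'I_n := fun _ _ => false.

Lemma edgeless_sym : symmetric edgeless_adj.
Proof. by []. Qed.

Lemma edgeless_irr : irreflexive edgeless_adj.
Proof. by []. Qed.

Definition edgeless_graph : sgraph := SGraph edgeless_sym edgeless_irr.

End Edgeless.

Section DisjointUnion.
Variables F G : sgraph.

Definition dunion_adj : rel (F + G)%type := fun x y =>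
  match x, y with
  | inl a, inl b => adj a b
  | inr a, inr b => adj a b
  | _, _ => false
  end.

Lemma dunion_sym : symmetric dunion_adj.
Proof. by move=> [a|a] [b|b] //=; apply: adj_sym. Qed.

Lemma dunion_irr : irreflexive dunion_adj.
Proof. by move=> [a|a] /=; apply: adj_irr. Qed.

Definition dunion : sgraph := SGraph dunion_sym dunion_irr.

End DisjointUnion.

Definition colourable (k : nat) (G : sgraph) : Prop :=
  exists c : G -> 'I_k, forall x y, adj x y -> c x != c y.

Definition set_weight (G : sgraph) (w : G -> nat) (S : {set G}) : nat :=
  \sum_(v in S) w v.

Definition max_weight_colourable (k : nat) (G : sgraph) (w : G -> nat)
    (S : {set G}) : Prop :=
  colourable k (induced S) /\
  forall S' : {set G}, colourable k (induced S') ->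
    set_weight w S' <= set_weight w S.

(* The model of computation is the language of while-programs over binary     *)
(* trees of N. D. Jones (Computability and Complexity from a Programming      *)
(* Perspective), with a cost that charges for the size of the data: an        *)
(* assignment costs one plus the size of the tree it writes. With unit cost,  *)
(* iterating x := cons x x would build exponentially large values in linear   *)
(* time; here the total size of the store never exceeds the size of the input *)
(* plus the cost spent so far (plus a constant), so that a run of cost t is   *)
(* simulated by a Turing machine in time polynomial in t and the input size,  *)
(* and conversely.                                                            *)

Inductive tree := Leaf | Node of tree & tree.

Fixpoint tree_size (x : tree) : nat :=
  if x is Node l r then (tree_size l + tree_size r).+1 else 1.

Inductive expr :=
  | EVar of nat
  | ENil
  | ECons of expr & expr
  | EHd of expr
  | ETl of expr.

Inductive cmd :=
  | CSkip
  | CAssign of nat & expr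
  | CSeq of cmd & cmd
  | CIf of expr & cmd & cmd
  | CWhile of expr & cmd.

Definition store := nat -> tree.

Definition update (s : store) (i : nat) (x : tree) : store :=
  fun j => if j == i then x else s j.

Fixpoint eval (s : store) (e : expr) : tree :=
  match e with
  | EVar i => s i
  | ENil => Leaf
  | ECons a b => Node (eval s a) (eval s b)
  | EHd a => if eval s a is Node l _ then l else Leaf
  | ETl a => if eval s a is Node _ r then r else Leaf
  end.

Definition truth (x : tree) : bool := if x is Leaf then false else true.

(* exec c s t s': started in s, the command c halts in s' at cost t. *)
Inductive exec : cmd -> store -> nat -> store -> Prop :=
  | exec_skip s : exec CSkip s 1 s
  | exec_assign s i e :
      exec (CAssign i e) s (tree_size (eval s e)).+1 (update s i (eval s e))
  | exec_seq c1 c2 s1 s2 s3 t1 t2 :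
      exec c1 s1 t1 s2 -> exec c2 s2 t2 s3 ->
      exec (CSeq c1 c2) s1 (t1 + t2).+1 s3
  | exec_if_true e c1 c2 s s' t :
      truth (eval s e) -> exec c1 s t s' -> exec (CIf e c1 c2) s t.+1 s'
  | exec_if_false e c1 c2 s s' t :
      ~~ truth (eval s e) -> exec c2 s t s' -> exec (CIf e c1 c2) s t.+1 s'
  | exec_while_true e c s1 s2 s3 t1 t2 :
      truth (eval s1 e) -> exec c s1 t1 s2 -> exec (CWhile e c) s2 t2 s3 ->
      exec (CWhile e c) s1 (t1 + t2).+1 s3
  | exec_while_false e c s :
      ~~ truth (eval s e) -> exec (CWhile e c) s 1 s.

(* Input and output are both in variable 0. *)
Definition init_store (x : tree) : store := update (fun _ => Leaf) 0 x.

Definition runs_within (c : cmd) (x y : tree) (b : nat) : Prop :=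
  exists t s, [/\ exec c (init_store x) t s, s 0 = y & t <= b].

Definition enc_bool (b : bool) : tree := if b then Node Leaf Leaf else Leaf.

Definition enc_seq (T : Type) (enc : T -> tree) (s : seq T) : tree :=
  foldr (fun a x => Node (enc a) x) Leaf s.

(* Binary digits, least significant first, without leading zeros. *)
Definition bits (m : nat) : seq bool :=
  mkseq (fun i => odd (m %/ 2 ^ i)) (up_log 2 m.+1).

Definition enc_nat (m : nat) : tree := enc_seq enc_bool (bits m).

(* Adjacency matrix, in the order of enum G. *)
Definition enc_graph (G : sgraph) : tree :=
  enc_seq (fun x => enc_seq (fun y => enc_bool (adj x y)) (enum G)) (enum G).

Definition enc_weights (G : sgraph) (w : G -> nat) : tree :=
  enc_seq (fun x => enc_nat (w x)) (enum G).

Definition enc_instance (G : sgraph) (w : G -> nat) : tree :=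
  Node (enc_graph G) (enc_weights w).

(* Characteristic vector, in the order of enum G. *)
Definition enc_set (G : sgraph) (S : {set G}) : tree :=
  enc_seq (fun x => enc_bool (x \in S)) (enum G).

(* Main.v *)
Require Import Defs.
From mathcomp Require Import all_boot all_order all_algebra.
From mathcomp Require Import zify.

Set Implicit Arguments.
Unset Strict Implicit.
Unset Printing Implicit Defensive.

(* Colourings are found as list colourings, by recursion on the number of colours whose list is not
   empty. A k-coloured connected P5-free set has a connected dominating set of size 1 + 2k^2. If an
   optimal solution H contains an induced P5, then that path and at most k r further vertices
   dominate H; if H has at most r components and no P5, dominate each component. Otherwise r + 1
   components of H are available, and representatives of r of them are an edgeless graph on r
   vertices that makes everything far from them P5-free: every component then has a bounded
   dominating set D such that the component has no neighbour outside N[D], and outside the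
   neighbourhood of r + 1 such sets the whole graph is P5-free. There the candidate pieces, with
   two pieces adjacent when they touch, again form a P5-free graph, so that the best union is an
   independent set of maximum weight in a P5-free graph.

   In the dominated case, guess a dominating set D0 with its colours and a bounded enlargement D.
   The (P5 + rK1)-freeness shows that the lists can be pruned so that vertices with a common colour
   and different neighbourhoods in D0 are not adjacent. The instance splits into one instance for
   each neighbourhood, and each of them lost the colour of a vertex of D0.

   Independent sets in P5-free graphs are found by dynamic programming over polynomially many
   pieces, the hulls: a piece splits along a set described by at most four vertices into components
   that are smaller pieces, all but at most three of which can be read off from that set.

   Polynomial running time is closed under composition, bounded iteration over lists and
   quantification over vertices, so that each definition of the algorithm is realised by a program
   that follows its syntax. *)

(** * Polynomial time for while-programs *)

(** Two obstacles shape the proof. The components of an optimal solution are unknown, so pieces are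
    guessed one by one and must not interfere. This is why the dominating set D of a component is
    enlarged until the component has no neighbour outside N[D]: its piece is then confined to
    [interior], and pieces obtained for different components of the solution cannot touch. Second,
    splitting by neighbourhoods in D0 is sound only if equally coloured vertices of different parts
    are nonadjacent; the pruning that enforces this may consult only the guess, yet must keep the
    unknown solution. Most bounds come from one configuration, [link5]: a connected set, two
    nonadjacent vertices attached to it, and for each of them a private neighbour away from the set.
    It limits minimal hitting sets to one vertex for each colour or pair of colours; hence the k^2
    in the constants, twice because two rounds of domination suffice. In the independent set part, a
    separator of minimum cardinality takes the place of the potential maximal cliques known from
    minimal triangulations. *)

Lemma tree_size_gt0 x : 0 < tree_size x.
Proof. by case: x. Qed.

Lemma update_same s i x : update s i x i = x.
Proof. by rewrite /update eqxx. Qed.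

Section PolynomialBounds.
Variables (E : Type) (a : E -> tree).

(** Every tree has positive size, so the base is at least 2 and a single exponent absorbs constants,
    sums, products and compositions. *)
Definition pbound (F : E -> nat) : Prop :=
  exists d, forall x, F x <= (tree_size (a x)).+1 ^ d.

Lemma pbound_le (F F' : E -> nat) :
  (forall x, F x <= F' x) -> pbound F' -> pbound F.
Proof. by move=> le_F [d Hd]; exists d => x; apply: leq_trans (le_F x) (Hd x). Qed.

Lemma pbound_const n : pbound (fun=> n).
Proof.
exists n => x; apply: leq_trans (ltnW (ltn_expl n (isT : 1 < 2))) _.
by case: n => // n; rewrite leq_exp2r // ltnS tree_size_gt0.
Qed.

Lemma pbound_size : pbound (fun x => tree_size (a x)).
Proof. by exists 1 => x; rewrite expn1. Qed.

Lemma pbound_mul F F' : pbound F -> pbound F' -> pbound (fun x => F x * F' x).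
Proof. by move=> [d Hd] [d' Hd']; exists (d + d') => x; rewrite expnD leq_mul. Qed.

Lemma pbound_add F F' : pbound F -> pbound F' -> pbound (fun x => F x + F' x).
Proof.
move=> [d Hd] [d' Hd']; apply: (@pbound_le _ (fun x => 2 * (tree_size (a x)).+1 ^ (d + d'))).
  move=> x; rewrite mul2n -addnn expnD; apply: leq_add.
    by apply: leq_trans (Hd x) (leq_pmulr _ _); rewrite expn_gt0.
  by apply: leq_trans (Hd' x) (leq_pmull _ _); rewrite expn_gt0.
by apply: pbound_mul; [apply: pbound_const | exists (d + d')].
Qed.

Lemma pbound_exp F d : pbound F -> pbound (fun x => F x ^ d).
Proof. by move=> [d' Hd]; exists (d' * d) => x; rewrite expnM; case: d => // d; rewrite leq_exp2r. Qed.

Lemma pbound_comp (g : E -> tree) F :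
  pbound (fun x => tree_size (g x)) ->
  (exists d, forall x, F x <= (tree_size (g x)).+1 ^ d) -> pbound F.
Proof.
move=> Hg [d Hd]; apply: (pbound_le Hd); apply: pbound_exp.
by apply: (@pbound_le _ (fun x => tree_size (g x) + 1)); [move=> x; lia |
  apply: pbound_add => //; apply: pbound_const].
Qed.

End PolynomialBounds.

(** An assignment pays for the tree that it writes, so no variable outgrows the time spent. *)
Lemma exec_size c s t s' : exec c s t s' ->
  forall v, tree_size (s' v) <= maxn (tree_size (s v)) t.
Proof.
elim=> {c s t s'} //.
- by move=> s v; rewrite leq_maxl.
- by move=> s i ex v; rewrite /update; case: eqP => _; lia.
- by move=> c1 c2 s1 s2 s3 t1 t2 _ H1 _ H2 v; have := H1 v; have := H2 v; lia.
- by move=> ex c1 c2 s s' t _ _ H v; have := H v; lia.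
- by move=> ex c1 c2 s s' t _ _ H v; have := H v; lia.
- by move=> ex c s1 s2 s3 t1 t2 _ _ H1 _ H2 v; have := H1 v; have := H2 v; lia.
- by move=> ex c s _ v; rewrite leq_maxl.
Qed.

(* The program is relocatable: it runs at any base register b, finding its input and leaving its
   output there, and does not change the registers below b. The index type E carries the
   mathematical objects that a x and g x encode. *)
Definition ptime (E : Type) (a g : E -> tree) : Prop :=
  exists (c : nat -> cmd) (F : E -> nat), pbound a F /\
  forall x b s, s b = a x -> exists t s', [/\ exec (c b) s t s', s' b = g x,
    forall j, j < b -> s' j = s j & t <= F x].

Section Basics.
Variables (E : Type).
Implicit Types a g h : E -> tree.

(** Composition rests on this: the time of a second program is measured against the output of the
    first. *)
Lemma ptime_size a g : ptime a g -> pbound a (fun x => tree_size (g x)).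
Proof.
move=> [c [F [HF Hc]]].
apply: (@pbound_le _ _ _ (fun x => tree_size (a x) + F x)); last first.
  by apply: pbound_add => //; apply: pbound_size.
move=> x; have [t [s' [He <- _ Ht]]] := Hc x 0 (fun=> a x) erefl.
by have := exec_size He 0; lia.
Qed.

Lemma ptime_ext a g h : g =1 h -> ptime a g -> ptime a h.
Proof.
move=> gh [c [F [HF Hc]]]; exists c, F; split=> // x b s Hs.
by have [t [s' [? ? ? ?]]] := Hc x b s Hs; exists t, s'; rewrite -gh.
Qed.

Lemma ptime_id a : ptime a a.
Proof.
exists (fun=> CSkip), (fun=> 1); split; first exact: pbound_const.
by move=> x b s Hs; exists 1, s; split=> //; constructor.
Qed.

Lemma ptime_comp a g h : ptime a g -> ptime g h -> ptime a h.
Proof.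
move=> Hg [c' [F' [HF' Hc']]]; have Sg := ptime_size Hg.
move: Hg => [c [F [HF Hc]]].
exists (fun b => CSeq (c b) (c' b)), (fun x => F x + F' x + 1); split.
  apply: pbound_add (pbound_const _ _); apply: pbound_add => //.
  exact: pbound_comp Sg HF'.
move=> x b s Hs; have [t [s1 [H1 H2 H3 H4]]] := Hc x b s Hs.
have [t' [s2 [H5 H6 H7 H8]]] := Hc' x b s1 H2.
exists (t + t').+1, s2; split=> //; [exact: exec_seq H1 H5 | | lia].
by move=> j Hj; rewrite H7 // H3.
Qed.

Lemma ptime_pair a g h : ptime a g -> ptime a h ->
  ptime a (fun x => Node (g x) (h x)).
Proof.
move=> Hg Hh; have Sg := ptime_size Hg; have Sh := ptime_size Hh.
move: Hg Hh => [c [F [HF Hc]]] [c' [F' [HF' Hc']]].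
(* Each program runs on a copy of the input above [b], the second one above the result of the first,
   so neither destroys what is still to be read. *)
exists (fun b => CSeq (CAssign b.+1 (EVar b)) (CSeq (c b.+1)
  (CSeq (CAssign b.+2 (EVar b)) (CSeq (c' b.+2)
     (CAssign b (ECons (EVar b.+1) (EVar b.+2))))))).
exists (fun x => (tree_size (a x) + tree_size (a x)) +
  ((F x + F' x) + ((tree_size (g x) + tree_size (h x)) + 8))); split.
  by do !apply: pbound_add => //; try exact: pbound_size; apply: pbound_const.
move=> x b s Hs; set s1 := update s b.+1 (s b).
have [t1 [s2 [X2 V2 P2 T2]]] := Hc x b.+1 s1 (etrans (update_same _ _ _) Hs).
set s3 := update s2 b.+2 (s2 b).
have Hb : s2 b = a x by rewrite P2 // /s1 /update ltn_eqF.
have [t2 [s4 [X4 V4 P4 T4]]] := Hc' x b.+2 s3 (etrans (update_same _ _ _) Hb).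
have H41 : s4 b.+1 = g x by rewrite P4 // /s3 /update ltn_eqF.
eexists _, (update s4 b (Node (g x) (h x))); split.
- refine (exec_seq (exec_assign s b.+1 (EVar b)) (exec_seq X2
    (exec_seq (exec_assign s2 b.+2 (EVar b)) (exec_seq X4 _)))).
  have -> : Node (g x) (h x) = eval s4 (ECons (EVar b.+1) (EVar b.+2)).
    by rewrite /= H41 V4.
  exact: exec_assign.
- by rewrite /update eqxx.
- move=> j Hj; rewrite /update ltn_eqF // P4; last by lia.
  rewrite /s3 /update ltn_eqF; last by lia.
  by rewrite P2; [rewrite /s1 /update ltn_eqF //; lia | lia].
- by rewrite /= H41 V4 Hs Hb; lia.
Qed.

Lemma ptime_expr a g (ex : nat -> expr) :
  (forall x b s, s b = a x -> eval s (ex b) = g x) ->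
  pbound a (fun x => tree_size (g x)) -> ptime a g.
Proof.
move=> Hex Hg; exists (fun b => CAssign b (ex b)), (fun x => tree_size (g x) + 1).
split; first by apply: pbound_add => //; apply: pbound_const.
move=> x b s Hs; eexists _, _; split; first exact: exec_assign.
- by rewrite /update eqxx; apply: Hex Hs.
- by move=> j Hj; rewrite /update ltn_eqF.
- by rewrite (Hex _ _ _ Hs) addn1.
Qed.

Definition hd (x : tree) : tree := if x is Node l _ then l else Leaf.
Definition tl (x : tree) : tree := if x is Node _ r then r else Leaf.

Lemma size_hd x : tree_size (hd x) <= tree_size x.
Proof. by case: x => //= l r; lia. Qed.

Lemma size_tl x : tree_size (tl x) <= tree_size x.
Proof. by case: x => //= l r; lia. Qed.

Lemma ptime_hd a g : ptime a g -> ptime a (fun x => hd (g x)).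
Proof.
move=> Hg; apply: ptime_comp Hg _; apply: (ptime_expr (ex := fun b => EHd (EVar b))).
  by move=> x b s /= ->.
exact: pbound_le (fun x => size_hd _) (pbound_size _).
Qed.

Lemma ptime_tl a g : ptime a g -> ptime a (fun x => tl (g x)).
Proof.
move=> Hg; apply: ptime_comp Hg _; apply: (ptime_expr (ex := fun b => ETl (EVar b))).
  by move=> x b s /= ->.
exact: pbound_le (fun x => size_tl _) (pbound_size _).
Qed.

Fixpoint const_expr (t : tree) : expr :=
  if t is Node l r then ECons (const_expr l) (const_expr r) else ENil.

Lemma ptime_const a (t : tree) : ptime a (fun=> t).
Proof.
apply: (ptime_expr (ex := fun=> const_expr t)); last exact: pbound_const.
by move=> _ _ s _; elim: t => //= l -> r ->.
Qed.

Lemma ptime_if a (p : E -> bool) g h :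
  ptime a (fun x => enc_bool (p x)) -> ptime a g -> ptime a h ->
  ptime a (fun x => if p x then g x else h x).
Proof.
move=> [cp [Fp [HFp Hcp]]] [c [F [HF Hc]]] [c' [F' [HF' Hc']]].
exists (fun b => CSeq (CAssign b.+1 (EVar b)) (CSeq (cp b.+1)
  (CIf (EVar b.+1) (c b) (c' b)))).
exists (fun x => tree_size (a x) + (Fp x + (F x + (F' x + 6)))); split.
  by do !apply: pbound_add => //; try exact: pbound_size; apply: pbound_const.
move=> x b s Hs; set s1 := update s b.+1 (s b).
have [t1 [s2 [X2 V2 P2 T2]]] := Hcp x b.+1 s1 (etrans (update_same _ _ _) Hs).
have Hb : s2 b = a x by rewrite P2 // /s1 /update ltn_eqF.
have P : forall j, j < b -> s2 j = s j.
  by move=> j Hj; rewrite P2; [rewrite /s1 /update ltn_eqF //; lia | lia].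
case Ep: (p x) in V2 *.
  have [t2 [s3 [X3 V3 P3 T3]]] := Hc x b s2 Hb.
  have Tr : truth (eval s2 (EVar b.+1)) by rewrite /= V2.
  eexists _, s3; split; [exact (exec_seq (exec_assign s b.+1 (EVar b))
    (exec_seq X2 (exec_if_true _ Tr X3))) | by [] | | by rewrite /= Hs; lia].
  by move=> j Hj; rewrite P3 // P.
have [t2 [s3 [X3 V3 P3 T3]]] := Hc' x b s2 Hb.
have Tr : ~~ truth (eval s2 (EVar b.+1)) by rewrite /= V2.
eexists _, s3; split; [exact (exec_seq (exec_assign s b.+1 (EVar b))
  (exec_seq X2 (exec_if_false _ Tr X3))) | by [] | | by rewrite /= Hs; lia].
by move=> j Hj; rewrite P3 // P.
Qed.

End Basics.

Lemma ptime_reindex E E' (f : E' -> E) (a g : E -> tree) :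
  ptime a g -> ptime (fun x => a (f x)) (fun x => g (f x)).
Proof.
move=> [c [F [[d Hd] Hc]]]; exists c, (fun x => F (f x)).
by split=> [|x b s Hs]; [exists d => x; apply: Hd | apply: Hc].
Qed.

(* Passing from a to env a enc adds one bound variable to the context of a program. *)
Definition env (E : Type) (B : E -> Type) (a : E -> tree)
    (enc : forall x, B x -> tree) (s : {x : E & B x}) : tree :=
  Node (a (tag s)) (enc (tag s) (tagged s)).

Section Env.
Variables (E : Type) (B : E -> Type) (a : E -> tree) (enc : forall x, B x -> tree).

Lemma ptime_lift g : ptime a g ->
  ptime (env a enc) (fun s => g (tag s)).
Proof.
move=> Hg; apply: (@ptime_comp _ _ (fun s => a (tag s))).
  exact: (@ptime_hd _ _ _ (ptime_id (env a enc))).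
exact: (ptime_reindex (fun s : {x : E & B x} => tag s) Hg).
Qed.

Lemma ptime_var : ptime (env a enc) (fun s => enc (tagged s)).
Proof. exact: (@ptime_tl _ _ _ (ptime_id (env a enc))). Qed.

End Env.

Section Fold.
Variables (E : Type) (A B : E -> Type) (a : E -> tree).
Variables (encA : forall x, A x -> tree) (encB : forall x, B x -> tree).
Variables (step : forall x, A x -> B x -> A x) (z : forall x, A x) (l : forall x, seq (B x)).

Variable S : E -> nat.

Let encAB x (p : A x * B x) : tree := Node (encA p.1) (encB p.2).

Hypothesis Hl : ptime a (fun x => enc_seq (@encB x) (l x)).
Hypothesis Hz : ptime a (fun x => encA (z x)).
Hypothesis Hstep : ptime (env a encAB)
  (fun s => encA (step (tagged s).1 (tagged s).2)).
Hypothesis HS : pbound a S.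
Hypothesis S_bound : forall x i,
  tree_size (encA (foldl (@step x) (z x) (take i (l x)))) <= S x.

Lemma size_enc_seq (C : Type) (enc : C -> tree) (s : seq C) :
  tree_size (enc_seq enc s) = (size s + \sum_(y <- s) tree_size (enc y)).+1.
Proof. by elim: s => [|y s IH] /=; rewrite ?big_nil ?big_cons //; lia. Qed.

(** Iterating a polynomial-time step may square the accumulator in every round. The bound [S] on all
    intermediate accumulators is what keeps the total time polynomial. *)
Lemma ptime_foldl : ptime a (fun x => encA (foldl (@step x) (z x) (l x))).
Proof.
have Sl := ptime_size Hl; have Sz := ptime_size Hz.
case: Hl => [cl [Fl [HFl Hcl]]]; case: Hz => [cz [Fz [HFz Hcz]]].
case: Hstep => [cs [Fs [[d Hd] Hcs]]].
(* [b] keeps the input, [b.+1] the unread list and [b.+2] the accumulator; the step is called in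
   [b.+3] on a tree holding all its data. *)
pose body b := CSeq (CAssign b.+3 (ECons (EVar b) (ECons (EVar b.+2) (EHd (EVar b.+1)))))
  (CSeq (cs b.+3) (CSeq (CAssign b.+2 (EVar b.+3)) (CAssign b.+1 (ETl (EVar b.+1))))).
pose L x := tree_size (enc_seq (@encB x) (l x)).
(* [R] exceeds the size of the tree handed to the step, so [R x ^ d] bounds its time; the other
   terms of [K] pay for the three assignments of the body and the control flow. *)
pose R x := tree_size (a x) + (S x + (L x + 4)).
have HR : pbound a R by do !apply: pbound_add => //; try exact: pbound_size; apply: pbound_const.
pose K x := R x ^ d + (R x + (R x + (R x + 6))).
have HK : pbound a K.
  by do !apply: pbound_add => //; try exact: pbound_const; apply: pbound_exp.
exists (fun b => CSeq (CAssign b.+1 (EVar b)) (CSeq (cl b.+1)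
  (CSeq (CAssign b.+2 (EVar b)) (CSeq (cz b.+2) (CSeq (CWhile (EVar b.+1) (body b))
     (CAssign b (EVar b.+2))))))).
exists (fun x => (tree_size (a x) + tree_size (a x)) +
  ((Fl x + Fz x) + (L x * K x + (S x + 12)))); split.
  do !apply: pbound_add => //; try exact: pbound_size; try exact: pbound_const.
  exact: pbound_mul.
have loop x b : forall i s, i <= size (l x) -> s b = a x ->
    s b.+1 = enc_seq (@encB x) (drop i (l x)) ->
    s b.+2 = encA (foldl (@step x) (z x) (take i (l x))) ->
    exists t s', [/\ exec (CWhile (EVar b.+1) (body b)) s t s',
      s' b.+2 = encA (foldl (@step x) (z x) (l x)),
      forall j, j <= b -> s' j = s j & t <= (size (l x) - i) * K x + 1].
  move=> i; have [m] := ubnP (size (l x) - i); elim: m i => // m IH i Hm s Hi Hb H1 H2.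
  have [Ei|lt_i] := leqP (size (l x)) i.
    rewrite drop_oversize // in H1; rewrite take_oversize // in H2.
    by exists 1, s; split=> //; [apply: exec_while_false; rewrite /= H1 | lia].
  have y : B x by case: (l x) lt_i.
  set yi := nth y (l x) i.
  set acc := foldl (@step x) (z x) (take i (l x)) in H2 *.
  have Ed : drop i (l x) = yi :: drop i.+1 (l x) by apply: drop_nth.
  have Et : take i.+1 (l x) = rcons (take i (l x)) yi by apply: take_nth.
  rewrite Ed /= in H1.
  set s1 := update s b.+3 (Node (a x) (encAB (acc, yi))).
  have [t [s2 [X2 V2 P2 T2]]] :=
    Hcs (existT _ x (acc, yi)) b.+3 s1 (update_same _ _ _).
  have {}V2 : s2 b.+3 = encA (foldl (@step x) (z x) (take i.+1 (l x))).
    by rewrite V2 Et -cats1 foldl_cat.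
  set s3 := update s2 b.+2 (s2 b.+3).
  set s4 := update s3 b.+1 (enc_seq (@encB x) (drop i.+1 (l x))).
  have B2 : s2 b.+1 = Node (encB yi) (enc_seq (@encB x) (drop i.+1 (l x))).
    by rewrite P2 // /s1 /update ltn_eqF.
  have P4 j : j <= b -> s4 j = s j.
    move=> Hj; rewrite /s4 /s3 /update !ltn_eqF; try lia.
    by rewrite P2 ?/s1 ?/update; [rewrite ltn_eqF //; lia | lia].
  have [|||||t' [s5 [X5 V5 P5 T5]]] := IH i.+1 _ s4.
  - by lia.
  - by [].
  - by rewrite P4.
  - by rewrite /s4 /update eqxx.
  - by rewrite /s4 /s3 /update gtn_eqF // eqxx.
  have X1 : exec (CAssign b.+3 (ECons (EVar b) (ECons (EVar b.+2) (EHd (EVar b.+1)))))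
      s (tree_size (Node (a x) (encAB (acc, yi)))).+1 s1.
    have := exec_assign s b.+3 (ECons (EVar b) (ECons (EVar b.+2) (EHd (EVar b.+1)))).
    by rewrite /= Hb H2 H1.
  have X3 : exec (CAssign b.+1 (ETl (EVar b.+1))) s3
      (tree_size (enc_seq (@encB x) (drop i.+1 (l x)))).+1 s4.
    have := exec_assign s3 b.+1 (ETl (EVar b.+1)).
    have -> // : eval s3 (ETl (EVar b.+1)) = enc_seq (@encB x) (drop i.+1 (l x)).
    by rewrite /= /s3 /update ltn_eqF // B2.
  have Tr : truth (eval s (EVar b.+1)) by rewrite /= H1.
  eexists _, s5; split.
  - exact (exec_while_true Tr (exec_seq X1 (exec_seq X2
      (exec_seq (exec_assign s2 b.+2 (EVar b.+3)) X3))) X5).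
  - by [].
  - by move=> j Hj; rewrite P5 // P4.
  rewrite /= V2.
  have LL : tree_size (enc_seq (@encB x) (drop i (l x))) <= L x.
    rewrite /L -{2}(cat_take_drop i (l x)) !size_enc_seq size_cat big_cat /=; lia.
  rewrite Ed /= in LL.
  have Sa := S_bound x i; rewrite -/acc in Sa; have Sb := S_bound x i.+1.
  have {}T2 : t <= R x ^ d.
    apply: leq_trans T2 _; apply: leq_trans (Hd _) _; rewrite /env /=.
    by case: (d) => // d'; rewrite leq_exp2r // /R; lia.
  have -> : (size (l x) - i) * K x = K x + (size (l x) - i.+1) * K x.
    by rewrite -mulSn; congr (_ * _); lia.
  by move: T2 T5; rewrite /K /R /=; lia.
move=> x b s Hs; pose s1 := update s b.+1 (s b).
have [t1 [s2 [X2 V2 P2 T2]]] := Hcl x b.+1 s1 (etrans (update_same _ _ _) Hs).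
set s3 := update s2 b.+2 (s2 b).
have Hb : s2 b = a x by rewrite P2 // /s1 /update ltn_eqF.
have [t2 [s4 [X4 V4 P4 T4]]] := Hcz x b.+2 s3 (etrans (update_same _ _ _) Hb).
have H4 j : j < b.+1 -> s4 j = s j.
  move=> Hj; rewrite P4; last by lia.
  rewrite /s3 /update ltn_eqF; last by lia.
  by rewrite P2 // /s1 /update ltn_eqF //; lia.
have H41 : s4 b.+1 = enc_seq (@encB x) (l x) by rewrite P4 // /s3 /update ltn_eqF.
have [||||t5 [s5 [X5 V5 P5 T5]]] := loop x b 0 s4; rewrite ?drop0 ?take0 ?H41 ?V4 ?H4 //.
eexists _, (update s5 b (eval s5 (EVar b.+2))); split.
- exact (exec_seq (exec_assign s b.+1 (EVar b)) (exec_seq X2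
    (exec_seq (exec_assign s2 b.+2 (EVar b)) (exec_seq X4 (exec_seq X5
    (exec_assign _ _ _)))))).
- by rewrite /update eqxx.
- by move=> j Hj; rewrite /update ltn_eqF // P5 ?H4 //; lia.
- rewrite /= V5 Hs Hb; have := S_bound x (size (l x)); rewrite take_size.
  have : size (l x) * K x <= L x * K x.
    by rewrite leq_mul2r /L size_enc_seq; apply/orP; right; lia.
  by rewrite subn0 in T5; lia.
Qed.

End Fold.

Section Booleans.
Variables (E : Type) (a : E -> tree).
Implicit Types p q : E -> bool.

Lemma ptime_ifb p q q' : ptime a (fun x => enc_bool (p x)) ->
  ptime a (fun x => enc_bool (q x)) -> ptime a (fun x => enc_bool (q' x)) ->
  ptime a (fun x => enc_bool (if p x then q x else q' x)).
Proof. by move=> Hp Hq Hq'; apply: ptime_ext (ptime_if Hp Hq Hq') => x; case: ifP. Qed.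

Lemma ptime_negb p : ptime a (fun x => enc_bool (p x)) ->
  ptime a (fun x => enc_bool (~~ p x)).
Proof. by move=> Hp; apply: (ptime_ifb Hp (q := fun=> false) (q' := fun=> true)); apply: ptime_const. Qed.

Lemma ptime_andb p q : ptime a (fun x => enc_bool (p x)) ->
  ptime a (fun x => enc_bool (q x)) -> ptime a (fun x => enc_bool (p x && q x)).
Proof. by move=> Hp Hq; apply: (ptime_ifb Hp Hq (q' := fun=> false)); apply: ptime_const. Qed.

Lemma ptime_orb p q : ptime a (fun x => enc_bool (p x)) ->
  ptime a (fun x => enc_bool (q x)) -> ptime a (fun x => enc_bool (p x || q x)).
Proof. by move=> Hp Hq; apply: (ptime_ifb Hp (q := fun=> true)) => //; apply: ptime_const. Qed.

Lemma ptime_implyb p q : ptime a (fun x => enc_bool (p x)) ->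
  ptime a (fun x => enc_bool (q x)) -> ptime a (fun x => enc_bool (p x ==> q x)).
Proof. by move=> Hp Hq; apply: (ptime_ifb Hp Hq (q' := fun=> true)); apply: ptime_const. Qed.

Lemma ptime_eqb p q : ptime a (fun x => enc_bool (p x)) ->
  ptime a (fun x => enc_bool (q x)) -> ptime a (fun x => enc_bool (p x == q x)).
Proof.
move=> Hp Hq; apply: ptime_ext (ptime_ifb Hp Hq (ptime_negb Hq)) => x.
by case: (p x); case: (q x).
Qed.

End Booleans.

Definition enc_pair (A B : Type) (encA : A -> tree) (encB : B -> tree) (p : A * B) : tree :=
  Node (encA p.1) (encB p.2).

Lemma ptime_fst E (A B : E -> Type) (a : E -> tree) (encA : forall x, A x -> tree)
    (encB : forall x, B x -> tree) (p : forall x, A x * B x) :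
  ptime a (fun x => enc_pair (encA x) (encB x) (p x)) -> ptime a (fun x => encA x (p x).1).
Proof. exact: ptime_hd. Qed.

Lemma ptime_snd E (A B : E -> Type) (a : E -> tree) (encA : forall x, A x -> tree)
    (encB : forall x, B x -> tree) (p : forall x, A x * B x) :
  ptime a (fun x => enc_pair (encA x) (encB x) (p x)) -> ptime a (fun x => encB x (p x).2).
Proof. exact: ptime_tl. Qed.

Lemma enc_seq_map (A B : Type) (enc : B -> tree) (f : A -> B) s :
  enc_seq enc [seq f y | y <- s] = enc_seq (fun y => enc (f y)) s.
Proof. by elim: s => //= y s ->. Qed.

Lemma eq_enc_seq (A : eqType) (f g : A -> tree) s :
  {in s, f =1 g} -> enc_seq f s = enc_seq g s.
Proof.
elim: s => //= y s IH fg; rewrite fg ?mem_head // IH // => z zs.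
by apply: fg; rewrite inE zs orbT.
Qed.

Lemma size_enc_seq_cat (A : Type) (enc : A -> tree) s s' :
  tree_size (enc_seq enc s) + tree_size (enc_seq enc s') = (tree_size (enc_seq enc (s ++ s'))).+1.
Proof. by rewrite !size_enc_seq size_cat big_cat /=; lia. Qed.

Lemma size_enc_seq_rev (A : Type) (enc : A -> tree) s :
  tree_size (enc_seq enc (rev s)) = tree_size (enc_seq enc s).
Proof. by elim: s => // y s IH; have := size_enc_seq_cat enc (rev s) [:: y]; rewrite rev_cons -cats1 /= IH; lia. Qed.

Lemma size_enc_seq_take (A : Type) (enc : A -> tree) s i :
  tree_size (enc_seq enc (take i s)) <= tree_size (enc_seq enc s).
Proof. by have := size_enc_seq_cat enc (take i s) (drop i s); rewrite cat_take_drop; have := tree_size_gt0 (enc_seq enc (drop i s)); lia. Qed.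

Lemma foldl_cons_rev (A B : Type) (f : A -> B) s z :
  foldl (fun acc y => f y :: acc) z s = rev (map f s) ++ z.
Proof. by elim: s z => //= y s IH z; rewrite IH rev_cons cat_rcons. Qed.

Lemma foldl_orb (A : Type) (p : pred A) s b : foldl (fun c y => c || p y) b s = b || has p s.
Proof. by elim: s b => [|y s IH] b /=; rewrite ?orbF // IH orbA. Qed.

Section Lists.
Variables (E : Type) (B : E -> Type) (a : E -> tree) (enc : forall x, B x -> tree).
Variable l : forall x, seq (B x).
Hypothesis Hl : ptime a (fun x => enc_seq (@enc x) (l x)).

Lemma ptime_has (p : forall x, B x -> bool) :
  ptime (env a enc) (fun s => enc_bool (p _ (tagged s))) ->
  ptime a (fun x => enc_bool (has (p x) (l x))).
Proof.
move=> Hp.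
apply: (ptime_ext (g := fun x => enc_bool (foldl (fun c y => c || p x y) false (l x)))).
  by move=> x; rewrite foldl_orb.
apply: (ptime_foldl (A := fun=> bool) (encA := fun=> enc_bool) Hl (S := fun=> 3)).
- exact: ptime_const.
- apply: ptime_orb.
    exact: (@ptime_hd _ _ _ (ptime_tl (ptime_id _))).
  pose f (s : {x : E & (bool * B x)%type}) := existT B (tag s) (tagged s).2.
  refine (@ptime_comp _ _ (fun s => env a enc (f s)) _ _ (ptime_reindex f Hp)).
  exact: (ptime_pair (ptime_hd (ptime_id _)) (ptime_tl (ptime_tl (ptime_id _)))).
- exact: pbound_const.
- by move=> x i; case: (foldl _ _ _).
Qed.

Lemma ptime_all (p : forall x, B x -> bool) :
  ptime (env a enc) (fun s => enc_bool (p _ (tagged s))) ->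
  ptime a (fun x => enc_bool (all (p x) (l x))).
Proof.
move=> Hp; have := ptime_negb (ptime_has (p := fun x y => ~~ p x y) (ptime_negb Hp)).
by apply: ptime_ext => x; rewrite -all_predC; congr enc_bool; apply: eq_all => y /=; rewrite negbK.
Qed.

(** A left fold can only push in front, hence the reversed order; a second pass in [ptime_map]
    restores it. *)
Lemma ptime_revmap (g : forall x, B x -> tree) :
  ptime (env a enc) (fun s => g _ (tagged s)) ->
  ptime a (fun x => enc_seq (fun t : tree => t) (rev (map (g x) (l x)))).
Proof.
move=> Hg; have [d Hd] := ptime_size Hg; have Sl := ptime_size Hl.
pose L x := tree_size (enc_seq (@enc x) (l x)).
pose S x := L x * ((tree_size (a x) + (L x + 2)) ^ d + 1) + 1.
apply: (ptime_ext (g := fun x => enc_seq id (foldl (fun acc y => g x y :: acc) [::] (l x)))).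
  by move=> x; rewrite foldl_cons_rev cats0.
apply: (ptime_foldl (A := fun=> seq tree) (encA := fun=> enc_seq (fun t : tree => t)) Hl (S := S)).
- exact: ptime_const.
- apply: ptime_pair (ptime_hd (ptime_tl (ptime_id _))).
  pose f (s : {x : E & (seq tree * B x)%type}) := existT B (tag s) (tagged s).2.
  refine (@ptime_comp _ _ (fun s => env a enc (f s)) _ _ (ptime_reindex f Hg)).
  exact: (ptime_pair (ptime_hd (ptime_id _)) (ptime_tl (ptime_tl (ptime_id _)))).
- apply: pbound_add; last exact: pbound_const.
  apply: pbound_mul => //; apply: pbound_add; last exact: pbound_const.
  apply: pbound_exp; apply: pbound_add; first exact: pbound_size.
  by apply: pbound_add => //; apply: pbound_const.
- move=> x i; rewrite foldl_cons_rev cats0 size_enc_seq_rev map_take.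
  apply: leq_trans (size_enc_seq_take _ _ _) _.
  rewrite size_enc_seq size_map big_map /S addn1 ltnS.
  set K := (_ ^ d).
  have HK : forall s t, l x = s ++ t -> \sum_(y <- t) tree_size (g x y) <= size t * K.
    move=> s t; elim: t s => [|y t IH] s Es; rewrite ?big_nil ?big_cons //=.
    rewrite mulSn leq_add // ?(IH (rcons s y)) ?cat_rcons //.
    apply: leq_trans (Hd (existT _ x y)) _; rewrite /K /env /=.
    case: (d) => // d'; rewrite leq_exp2r //.
    have := size_enc_seq_cat (@enc x) s (y :: t); rewrite -Es /= -/(L x).
    have := tree_size_gt0 (enc_seq (@enc x) s); lia.
  have := HK [::] _ erefl; have : size (l x) <= L x by rewrite /L size_enc_seq; lia.
  by rewrite mulnDr muln1; nia.
Qed.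

End Lists.

Section MoreLists.
Variables (E : Type) (a : E -> tree).

Lemma ptime_rev (l : E -> seq tree) : ptime a (fun x => enc_seq id (l x)) ->
  ptime a (fun x => enc_seq id (rev (l x))).
Proof.
move=> Hl; have := ptime_revmap (B := fun=> tree) (enc := fun=> id) Hl (g := fun=> id).
by move=> /(_ (@ptime_var _ _ _ _)); apply: ptime_ext => x; rewrite map_id.
Qed.

Variables (B : E -> Type) (enc : forall x, B x -> tree).

Lemma ptime_map (l : forall x, seq (B x)) (g : forall x, B x -> tree) :
  ptime a (fun x => enc_seq (@enc x) (l x)) ->
  ptime (env a enc) (fun s => g _ (tagged s)) ->
  ptime a (fun x => enc_seq (g x) (l x)).
Proof.
move=> Hl Hg; have := ptime_rev (ptime_revmap Hl Hg).
by apply: ptime_ext => x; rewrite revK enc_seq_map.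
Qed.

Lemma ptime_cat (l l' : forall x, seq (B x)) :
  ptime a (fun x => enc_seq (@enc x) (l x)) ->
  ptime a (fun x => enc_seq (@enc x) (l' x)) ->
  ptime a (fun x => enc_seq (@enc x) (l x ++ l' x)).
Proof.
move=> Hl Hl'.
have Hr := ptime_revmap Hl (ptime_var a enc).
have Sl := ptime_size Hl; have Sl' := ptime_size Hl'.
apply: (ptime_ext (g := fun x => enc_seq id (foldl (fun acc y => y :: acc)
  (map (@enc x) (l' x)) (rev (map (@enc x) (l x)))))).
  by move=> x; rewrite foldl_cons_rev map_id revK -map_cat enc_seq_map.
apply: (ptime_foldl (A := fun=> seq tree) (encA := fun=> enc_seq (fun t : tree => t)) Hr
  (S := fun x => tree_size (enc_seq (@enc x) (l x)) + tree_size (enc_seq (@enc x) (l' x)))).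
- by apply: ptime_ext Hl' => x; rewrite enc_seq_map.
- exact: (ptime_pair (ptime_tl (ptime_tl (ptime_id _))) (ptime_hd (ptime_tl (ptime_id _)))).
- exact: pbound_add.
- move=> x i; rewrite foldl_cons_rev map_id.
  have := size_enc_seq_cat id (rev (take i (rev (map (@enc x) (l x))))) (map (@enc x) (l' x)).
  have := size_enc_seq_take id (rev (map (@enc x) (l x))) i.
  rewrite !size_enc_seq_rev !enc_seq_map /=.
  by move=> H1 H2; apply: leq_trans (leq_add H1 (leqnn _)); rewrite H2.
Qed.

End MoreLists.

Lemma foldl_cat (A : Type) (s : seq (seq A)) z :
  foldl cat z s = z ++ flatten s.
Proof. by elim: s z => [|y s IH] z /=; rewrite ?cats0 // IH catA. Qed.

Section Flatten.
Variables (E : Type) (a : E -> tree) (B : E -> Type) (enc : forall x, B x -> tree).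

Lemma ptime_flatten (l : forall x, seq (seq (B x))) :
  ptime a (fun x => enc_seq (enc_seq (@enc x)) (l x)) ->
  ptime a (fun x => enc_seq (@enc x) (flatten (l x))).
Proof.
move=> Hl; have Sl := ptime_size Hl.
apply: (ptime_ext (g := fun x => enc_seq (@enc x) (foldl cat [::] (l x)))).
  by move=> x; rewrite foldl_cat.
apply: (ptime_foldl (A := fun x => seq (B x)) (encA := fun x => enc_seq (@enc x)) Hl
  (S := fun x => tree_size (enc_seq (enc_seq (@enc x)) (l x)))) => //.
- exact: ptime_const.
- apply: ptime_cat.
    exact: (@ptime_hd _ _ _ (ptime_tl (ptime_id _))).
  exact: (@ptime_tl _ _ _ (ptime_tl (ptime_id _))).
- move=> x i; rewrite foldl_cat /=.
  apply: leq_trans (size_enc_seq_take _ _ i).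
  elim: (take i (l x)) => //= s ss IH.
  by have := size_enc_seq_cat (@enc x) s (flatten ss); lia.
Qed.

Lemma ptime_filter (l : forall x, seq (B x)) (p : forall x, B x -> bool) :
  ptime a (fun x => enc_seq (@enc x) (l x)) ->
  ptime (env a enc) (fun s => enc_bool (p _ (tagged s))) ->
  ptime a (fun x => enc_seq (@enc x) (filter (p x) (l x))).
Proof.
move=> Hl Hp.
apply: (ptime_ext (g := fun x => enc_seq (@enc x)
    (flatten [seq if p x y then [:: y] else [::] | y <- l x]))).
  by move=> x; congr enc_seq; elim: (l x) => //= y s ->; case: (p x y).
apply: ptime_flatten.
have : ptime (env a enc) (fun s => enc_seq (@enc (tag s))
    (if p _ (tagged s) then [:: tagged s] else [::])).
  apply: ptime_ext (ptime_if Hp (ptime_pair (ptime_var a enc) (ptime_const _ Leaf))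
    (ptime_const _ Leaf)) => s; by case: ifP.
move=> /(ptime_map (g := fun x y => enc_seq (@enc x) (if p x y then [:: y] else [::])) Hl).
by apply: ptime_ext => x; rewrite enc_seq_map.
Qed.

End Flatten.

(** Unary on purpose: a number is a list, and a fold can count along it. Vertices and colours are
    encoded this way; only weights are binary. *)
Definition encn (n : nat) : tree := enc_seq (fun=> Leaf) (nseq n tt).

Lemma size_encn n : tree_size (encn n) = n.*2.+1.
Proof. by rewrite size_enc_seq size_nseq big_nseq iter_addn /=; lia. Qed.

Section Naturals.
Variables (E : Type) (a : E -> tree).

Lemma ptime_nth (l : E -> seq tree) (i : E -> nat) :
  ptime a (fun x => enc_seq id (l x)) -> ptime a (fun x => encn (i x)) ->
  ptime a (fun x => nth Leaf (l x) (i x)).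
Proof.
move=> Hl Hi; have Sl := ptime_size Hl.
have E1 (s : seq tree) n : foldl (fun acc (_ : unit) => behead acc) s (nseq n tt) = drop n s.
  by elim: n s => [|n IH] [|y s] //=; rewrite IH ?drop0.
suff : ptime a (fun x => enc_seq id (foldl (fun acc (_ : unit) => behead acc) (l x) (nseq (i x) tt))).
  move=> /ptime_hd; apply: ptime_ext => x; rewrite E1 -[in RHS](addn0 (i x)) -nth_drop.
  by case: (drop _ _).
apply: (ptime_foldl (A := fun=> seq tree) (B := fun=> unit) (encA := fun=> enc_seq id)
  (encB := fun=> fun=> Leaf) (step := fun=> fun acc _ => behead acc)
  (l := fun x => nseq (i x) tt) Hi (S := fun x => tree_size (enc_seq id (l x)))) => //.
- have := @ptime_tl _ _ _ (ptime_hd (ptime_tl (ptime_id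
    (env a (fun=> (fun p : seq tree * unit => Node (enc_seq id p.1) Leaf)))))).
  by apply: ptime_ext => s; case: s => x [[|y s] []].
- move=> x j; have -> : take j (nseq (i x) tt) = nseq (minn j (i x)) tt.
    by case: (leqP j (i x)) => H; [rewrite take_nseq // | rewrite take_oversize // size_nseq ltnW].
  rewrite E1; have := size_enc_seq_cat id (take (minn j (i x)) (l x)) (drop (minn j (i x)) (l x)).
  by rewrite cat_take_drop; have := tree_size_gt0 (enc_seq id (take (minn j (i x)) (l x))); lia.
Qed.

(** Comparison by lookup: entry [m] of a list of [n.+1] truth values is true exactly if [m <= n],
    because reading past the end returns [Leaf], the code of false. *)
Lemma ptime_leq (m n : E -> nat) : ptime a (fun x => encn (m x)) ->
  ptime a (fun x => encn (n x)) -> ptime a (fun x => enc_bool (m x <= n x)).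
Proof.
move=> Hm Hn.
have Hl : ptime a (fun x => enc_seq id (rcons (nseq (n x) (Node Leaf Leaf)) (Node Leaf Leaf))).
  have := ptime_pair (ptime_const a (Node Leaf Leaf))
    (ptime_map (B := fun=> unit) (enc := fun=> fun=> Leaf)
       (g := fun=> fun=> Node Leaf Leaf) Hn (ptime_const _ _)).
  apply: ptime_ext => x; set t := Node Leaf Leaf.
  by elim: (n x) => //= k [->].
have := ptime_nth Hl Hm; apply: ptime_ext => x.
rewrite nth_rcons nth_nseq size_nseq.
by case: (ltngtP (m x) (n x)).
Qed.

Lemma ptime_eqn (m n : E -> nat) : ptime a (fun x => encn (m x)) ->
  ptime a (fun x => encn (n x)) -> ptime a (fun x => enc_bool (m x == n x)).
Proof.
move=> Hm Hn; have := ptime_andb (ptime_leq Hm Hn) (ptime_leq Hn Hm).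
by apply: ptime_ext => x; rewrite eqn_leq.
Qed.

Lemma ptime_size_seq (B : E -> Type) (enc : forall x, B x -> tree) (l : forall x, seq (B x)) :
  ptime a (fun x => enc_seq (@enc x) (l x)) -> ptime a (fun x => encn (size (l x))).
Proof.
move=> Hl; have := ptime_map (g := fun=> fun=> Leaf) Hl (ptime_const _ _).
by apply: ptime_ext => x; rewrite /encn; elim: (l x) => //= y s ->.
Qed.

Lemma size_enc_iota m n : tree_size (enc_seq encn (iota m n)) <= n * (m + n + 1).*2 + 1.
Proof.
by elim: n m => //= n IH m; rewrite size_encn; have := IH m.+1; nia.
Qed.

Lemma ptime_iota (n : E -> nat) : ptime a (fun x => encn (n x)) ->
  ptime a (fun x => enc_seq encn (iota 0 (n x))).
Proof.
move=> Hn; have Sn := ptime_size Hn.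
have E1 k : foldl (fun acc (_ : unit) => 0 :: map succn acc) [::] (nseq k tt) = iota 0 k.
  suff H j : foldl (fun acc (_ : unit) => 0 :: map succn acc) (iota 0 j) (nseq k tt) = iota 0 (j + k).
    exact: (H 0).
  elim: k j => [|k IH] j /=; first by rewrite addn0.
  by rewrite addnS -addSn -IH /= (iotaDl 1 0).
apply: (ptime_ext (g := fun x => enc_seq encn (foldl (fun acc (_ : unit) => 0 :: map succn acc)
  [::] (nseq (n x) tt)))); first by move=> x; rewrite E1.
apply: (ptime_foldl (A := fun=> seq nat) (B := fun=> unit) (encA := fun=> enc_seq encn)
  (encB := fun=> fun=> Leaf) (step := fun=> fun acc _ => 0 :: map succn acc)
  (l := fun x => nseq (n x) tt) Hn
  (S := fun x => tree_size (encn (n x)) * (tree_size (encn (n x)) * 4) + 1)) => //.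
- exact: ptime_const.
- apply: ptime_pair; first exact: ptime_const.
  set a' := env _ _.
  have H1 : ptime a' (fun s => enc_seq encn (tagged s).1).
    exact: (@ptime_hd _ _ _ (ptime_tl (ptime_id _))).
  have := ptime_map (g := fun=> fun k => encn k.+1) H1.
  move=> /(_ (ptime_pair (ptime_const _ Leaf) (@ptime_var _ _ _ _))).
  by apply: ptime_ext => s; rewrite -[RHS]/(enc_seq encn (map succn (tagged s).1)) enc_seq_map.
- apply: pbound_add (pbound_const _ _); apply: pbound_mul => //.
  by apply: pbound_mul => //; apply: pbound_const.
- move=> x j; have -> : take j (nseq (n x) tt) = nseq (minn j (n x)) tt.
    by case: (leqP j (n x)) => H; [rewrite take_nseq // | rewrite take_oversize // size_nseq ltnW].
  by rewrite E1; apply: leq_trans (size_enc_iota _ _) _; rewrite size_encn; nia.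
Qed.

End Naturals.

Definition encv (T : finType) (v : T) : tree := encn (index v (enum T)).
Definition encS (T : finType) (S : {set T}) : tree :=
  enc_seq (fun v => enc_bool (v \in S)) (enum T).
Definition encG (T : finType) (e : rel T) : tree :=
  enc_seq (fun u => enc_seq (fun v => enc_bool (e u v)) (enum T)) (enum T).

Lemma map_index_enum (T : finType) : [seq index v (enum T) | v <- enum T] = iota 0 (size (enum T)).
Proof.
apply: (@eq_from_nth _ 0); rewrite size_map ?size_iota // => i Hi.
case: (enum T) (enum_uniq T) Hi => // v s Us Hi.
by rewrite (nth_map v) // nth_iota // index_uniq.
Qed.

(** The encoded vertex list depends only on the number of vertices, so a program can rebuild it from
    the number of rows of the adjacency matrix. *)
Lemma enc_enum (T : finType) : enc_seq (@encv T) (enum T) = enc_seq encn (iota 0 (size (enum T))).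
Proof. by rewrite -map_index_enum enc_seq_map. Qed.

Section FinTypes.
Variables (E : Type) (a : E -> tree) (T : E -> finType).

Lemma ptime_enum (e : forall x, rel (T x)) : ptime a (fun x => encG (e x)) ->
  ptime a (fun x => enc_seq (@encv (T x)) (enum (T x))).
Proof.
move=> He; have := ptime_iota (ptime_size_seq He).
by apply: ptime_ext => x; rewrite enc_enum.
Qed.

Lemma nth_enum_index (C : finType) (f : C -> tree) (v : C) :
  nth Leaf (map f (enum C)) (index v (enum C)) = f v.
Proof. by rewrite (nth_map v) ?nth_index // ?index_mem mem_enum. Qed.

Lemma ptime_adj (e : forall x, rel (T x)) (u v : forall x, T x) :
  ptime a (fun x => encG (e x)) -> ptime a (fun x => encv (u x)) ->
  ptime a (fun x => encv (v x)) -> ptime a (fun x => enc_bool (e x (u x) (v x))).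
Proof.
move=> He Hu Hv.
have Hr : ptime a (fun x => enc_seq (fun w => enc_bool (e x (u x) w)) (enum (T x))).
  have He' : ptime a (fun x => enc_seq id [seq enc_seq (fun w => enc_bool (e x t w)) (enum (T x)) | t <- enum (T x)]).
    by apply: ptime_ext He => x; rewrite enc_seq_map.
  by have := ptime_nth He' Hu; apply: ptime_ext => x; rewrite nth_enum_index.
have Hr' : ptime a (fun x => enc_seq id [seq enc_bool (e x (u x) w) | w <- enum (T x)]).
  by apply: ptime_ext Hr => x; rewrite enc_seq_map.
by have := ptime_nth Hr' Hv; apply: ptime_ext => x; rewrite nth_enum_index.
Qed.

Lemma ptime_mem (S : forall x, {set T x}) (v : forall x, T x) :
  ptime a (fun x => encS (S x)) -> ptime a (fun x => encv (v x)) ->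
  ptime a (fun x => enc_bool (v x \in S x)).
Proof.
move=> HS Hv.
have HS' : ptime a (fun x => enc_seq id [seq enc_bool (w \in S x) | w <- enum (T x)]).
  by apply: ptime_ext HS => x; rewrite enc_seq_map.
by have := ptime_nth HS' Hv; apply: ptime_ext => x; rewrite nth_enum_index.
Qed.

Lemma ptime_eqv (u v : forall x, T x) :
  ptime a (fun x => encv (u x)) -> ptime a (fun x => encv (v x)) ->
  ptime a (fun x => enc_bool (u x == v x)).
Proof.
move=> Hu Hv; have := ptime_eqn Hu Hv; apply: ptime_ext => x; congr enc_bool.
apply/eqP/eqP => [|-> //]; move=> /(congr1 (nth (u x) (enum (T x)))).
by rewrite !nth_index // mem_enum.
Qed.

End FinTypes.

Section Quantifiers.
Variables (E : Type) (a : E -> tree) (T : E -> finType).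
Hypothesis HV : ptime a (fun x => enc_seq (@encv (T x)) (enum (T x))).

Lemma ptime_exists (p : forall x, T x -> bool) :
  ptime (env a (fun x => @encv (T x))) (fun s => enc_bool (p _ (tagged s))) ->
  ptime a (fun x => enc_bool [exists v, p x v]).
Proof.
move=> Hp; have := ptime_has HV Hp; apply: ptime_ext => x; congr enc_bool.
by apply/hasP/existsP => [[v _ ?]|[v ?]]; exists v; rewrite ?mem_enum.
Qed.

Lemma ptime_forall (p : forall x, T x -> bool) :
  ptime (env a (fun x => @encv (T x))) (fun s => enc_bool (p _ (tagged s))) ->
  ptime a (fun x => enc_bool [forall v, p x v]).
Proof.
move=> Hp; have := ptime_all HV Hp; apply: ptime_ext => x; congr enc_bool.
by apply/allP/forallP => H v; [apply: H; rewrite mem_enum | move=> _; apply: H].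
Qed.

Lemma ptime_set (p : forall x, T x -> bool) :
  ptime (env a (fun x => @encv (T x))) (fun s => enc_bool (p _ (tagged s))) ->
  ptime a (fun x => encS [set v | p x v]).
Proof.
move=> Hp; have := ptime_map (g := fun x v => enc_bool (p x v)) HV Hp.
by apply: ptime_ext => x; apply: eq_enc_seq => v _; rewrite inE.
Qed.

Lemma ptime_card (S : forall x, {set T x}) : ptime a (fun x => encS (S x)) ->
  ptime a (fun x => encn #|S x|).
Proof.
move=> HS; set a' := env a (fun x => @encv (T x)).
have Hp : ptime a' (fun s => enc_bool (tagged s \in S (tag s))).
  exact: (ptime_mem (T := fun s => T (tag s)) (S := fun s => S (tag s))
    (v := fun s => tagged s) (ptime_lift _ HS) (ptime_var _ _)).
have := ptime_size_seq (ptime_filter (p := fun x v => v \in S x) HV Hp).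
by apply: ptime_ext => x; rewrite cardE [in RHS]/enum_mem -enumT.
Qed.

End Quantifiers.

Lemma size_encS (T : finType) (S : {set T}) : tree_size (encS S) <= (size (enum T)) * 4 + 1.
Proof.
rewrite /encS size_enc_seq; elim: (enum T) => [|v s IH]; rewrite ?big_nil ?big_cons //=.
by case: (v \in S) => /=; lia.
Qed.

(** * Connected sets and induced five-vertex paths *)

Lemma card_le_inj (T : finType) (P : {set T}) (f : T -> nat) m :
  {in P, forall x, f x < m} -> {in P &, injective f} -> #|P| <= m.
Proof.
move=> lt_f inj_f; rewrite cardE -(size_map f) -(size_iota 0 m).
apply: uniq_leq_size; first by rewrite map_inj_in_uniq ?enum_uniq // => x y; rewrite !mem_enum; apply: inj_f.
by move=> _ /mapP[x + ->]; rewrite mem_enum mem_iota => /lt_f.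
Qed.

Lemma eq_pair_code k a b a' b' : b < k -> b' < k -> a * k + b = a' * k + b' -> a = a' /\ b = b'.
Proof.
move=> bk bk' Eab; have k0 : 0 < k by lia.
have Ea : a = a'.
  by have := congr1 (divn^~ k) Eab; rewrite !divnMDl // !divn_small // !addn0.
by split=> //; move: Eab; rewrite Ea => /addnI.
Qed.

(** In a hitting set of minimum cardinality, removing [p] leaves some [b] unhit, and this [b] is
    private to [p]. The private elements become ends of five-vertex paths, and excluding these paths
    bounds the size of the set. *)
Lemma hitting_set (T : finType) (A B : {set T}) (R : rel T) :
  (forall b, b \in B -> exists2 p, p \in A & R p b) ->
  exists (P : {set T}) (priv : T -> T),
    [/\ P \subset A, forall b, b \in B -> exists2 p, p \in P & R p b &
      forall p, p \in P -> [/\ priv p \in B, R p (priv p) &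
        forall p', p' \in P -> p' != p -> ~~ R p' (priv p)]].
Proof.
move=> HA; pose ok (P : {set T}) := (P \subset A) && [forall b in B, exists p in P, R p b].
have okA : ok A.
  rewrite /ok subxx; apply/forall_inP => b /HA[p pA Rpb].
  by apply/exists_inP; exists p.
case: (arg_minnP (fun P : {set T} => #|P|) okA) => P /andP[PA /forall_inP HP] minP.
have priv p : exists b, p \in P -> [/\ b \in B, R p b &
    forall p', p' \in P -> p' != p -> ~~ R p' b].
  case pP: (p \in P); last by exists p.
  have : ~~ ok (P :\ p).
    by apply: contraL (isT : true) => /minP; rewrite (cardsD1 p P) pP; lia.
  rewrite /ok (subset_trans (subsetDl _ _) PA) /= negb_forall_in => /exists_inP[b bB].
  rewrite negb_exists_in => /forall_inP Hb; exists b => _.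
  have Hb' p' : p' \in P -> p' != p -> ~~ R p' b.
    by move=> p'P np; apply: Hb; rewrite !inE np.
  split=> //; have /exists_inP[q qP Rq] := HP b bB.
  by case: (eqVneq q p) => [<- //|nq]; have := Hb' q qP nq; rewrite Rq.
have [f Hf] := fin_all_exists priv.
exists P, f; split=> // b bB.
by have /exists_inP[q qP Rq] := HP b bB; exists q.
Qed.

Section Graph.
Variables (T : finType) (e : rel T).
Hypotheses (esym : symmetric e) (eirr : irreflexive e).
Implicit Types (A B S X D C H W P K F J : {set T}).

(** For a symmetric [e] the five vertices are automatically distinct: any two of them are told apart
    by their adjacency to a third. *)
Definition p5 a b c d f := [&& e a b, e b c, e c d, e d f, ~~ e a c, ~~ e a d,
  ~~ e a f, ~~ e b d, ~~ e b f & ~~ e c f].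

Definition p5in X := exists a b c d f,
  [&& a \in X, b \in X, c \in X, d \in X & f \in X] /\ p5 a b c d f.

Lemma p5inS X X' : X \subset X' -> p5in X -> p5in X'.
Proof.
move=> /subsetP sX [a [b [c [d [f [/and5P[? ? ? ? ?] Hp]]]]]].
by exists a, b, c, d, f; rewrite !sX.
Qed.

(** Connectivity by cuts, because the path arguments look for a crossing edge, which this form hands
    over directly. The empty set is connected in this sense. *)
Definition conn S := forall A, A \subset S -> A != set0 -> A != S ->
  exists x y, [/\ x \in A, y \in S, y \notin A & e x y].

(** The closed neighbourhood N[D]. Accordingly [touch] holds for two sets that meet or are joined by
    an edge. *)
Definition nb D := [set v | (v \in D) || [exists d, (d \in D) && e v d]].

Definition compF W u (S : {set T}) := [set y in W | (y == u) || [exists x, (x \in S) && e x y]].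
Definition component W u := fixset (compF W u).

Definition touch A B := [exists x, (x \in A) && (x \in nb B)].

Lemma nbP D v : reflect (v \in D \/ exists2 d, d \in D & e v d) (v \in nb D).
Proof.
rewrite inE; apply: (iffP orP) => -[Hv|Hv]; [by left | right | by left | right].
  by case/existsP: Hv => d /andP[]; exists d.
by case: Hv => d dD vd; apply/existsP; exists d; rewrite dD.
Qed.

Lemma nb_sub D : D \subset nb D.
Proof. by apply/subsetP => v vD; rewrite inE vD. Qed.

Lemma nbS D D' : D \subset D' -> nb D \subset nb D'.
Proof.
move=> /subsetP sD; apply/subsetP => v /nbP[/sD vD|[d /sD dD vd]].
  by rewrite inE vD.
by apply/nbP; right; exists d.
Qed.

Lemma notin_nb D v : v \notin nb D -> v \notin D /\ forall d, d \in D -> ~~ e v d.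
Proof.
move=> nv; split=> [|d dD]; first by apply: contra nv => vD; rewrite inE vD.
by apply: contra nv => vd; apply/nbP; right; exists d.
Qed.

Lemma nb_sym A B : touch A B = touch B A.
Proof.
have H A' B' : touch A' B' -> touch B' A'.
  move=> /existsP[x /andP[xA /nbP[xB|[d dB xd]]]]; apply/existsP.
    by exists x; rewrite xB inE xA.
  by exists d; rewrite dB; apply/nbP; right; exists x; rewrite // esym.
by apply/idP/idP; apply: H.
Qed.

Lemma touchPn A B : reflect
  (forall x y, x \in A -> y \in B -> (x != y) && ~~ e x y) (~~ touch A B).
Proof.
apply: (iffP idP) => [nt x y xA yB|nt].
  apply/andP; split; apply: contra nt => Hxy; apply/existsP; exists x; rewrite xA.
    by rewrite inE (eqP Hxy) yB.
  by apply/nbP; right; exists y.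
apply/existsP => -[x /andP[xA /nbP[xB|[d dB xd]]]].
  by have := nt x x xA xB; rewrite eqxx.
by have := nt x d xA dB; rewrite xd andbF.
Qed.

Lemma touchS A B A' B' : A \subset A' -> B \subset B' -> touch A B -> touch A' B'.
Proof.
move=> sA sB; apply: contraLR => /touchPn nt; apply/touchPn => x y xA yB.
by apply: nt; [apply: (subsetP sA) | apply: (subsetP sB)].
Qed.

Lemma compF_mono W u : {homo compF W u : A B / A \subset B}.
Proof.
move=> A B /subsetP sAB; apply/subsetP => y; rewrite !inE => /andP[-> /orP[->//|]].
case/existsP=> x /andP[/sAB xB xy]; apply/orP; right.
by apply/existsP; exists x; rewrite xB.
Qed.

Lemma mem_comp W u y :
  (y \in component W u) = (y \in W) && ((y == u) || [exists x, (x \in component W u) && e x y]).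
Proof. by rewrite {1}/component -fixsetK ?inE //; apply: compF_mono. Qed.

Lemma comp_sub W u : component W u \subset W.
Proof. by apply/subsetP => y; rewrite mem_comp => /andP[]. Qed.

Lemma comp_self W u : u \in W -> u \in component W u.
Proof. by move=> uW; rewrite mem_comp uW eqxx. Qed.

Lemma comp_closed W u x y : x \in component W u -> y \in W -> e x y -> y \in component W u.
Proof.
move=> xC yW xy; rewrite mem_comp yW /=; apply/orP; right.
by apply/existsP; exists x; rewrite xC.
Qed.

Lemma comp_min W u S : (u \in W -> u \in S) ->
  (forall x y, x \in S -> y \in W -> e x y -> y \in S) -> component W u \subset S.
Proof.
move=> uS clS; rewrite /component /fixset; elim: #|T| => [|n IH] /=; first exact: sub0set.
apply/subsetP => y; rewrite inE => /andP[yW /orP[/eqP yu|/existsP[x /andP[xI xy]]]].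
  by rewrite yu uS // -yu.
exact: clS (subsetP IH _ xI) yW xy.
Qed.

Lemma comp_root W u j : j \in component W u -> u \in W.
Proof.
move=> jC; apply: contraT => uW.
have /subsetP/(_ j jC) : component W u \subset set0; last by rewrite inE.
by apply: comp_min => [uW'|x y]; [rewrite uW' in uW | rewrite inE].
Qed.

Lemma comp_no_exit W u S : u \in S -> S \subset component W u ->
  (forall x y, x \in S -> y \in component W u -> e x y -> y \in S) -> S = component W u.
Proof.
move=> uS sS clS; apply/eqP; rewrite eqEsubset sS; apply: comp_min => // x y xS yW xy.
by apply: (clS x) => //; apply: comp_closed xy => //; apply: (subsetP sS).
Qed.

Lemma conn_comp W u : conn (component W u).
Proof.
move=> A sA A0 nA.
have [/existsP[x /existsP[y /and4P[xA yC yA xy]]]|nex] :=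
  boolP [exists x, exists y, [&& x \in A, y \in component W u, y \notin A & e x y]].
  by exists x, y.
have {}nex x y : x \in A -> y \in component W u -> y \notin A -> e x y -> False.
  move=> xA yC yA xy; case/negP: nex; apply/existsP; exists x; apply/existsP; exists y.
  by rewrite xA yC yA.
have [uA|uA] := boolP (u \in A).
  case/eqP: nA; apply: comp_no_exit => // x y xA yC xy.
  by apply: contraT => yA; case: (nex x y xA yC yA xy).
have [z zA] := set0Pn _ A0; have zC := subsetP sA _ zA.
have uC : u \in component W u := comp_self (comp_root zC).
have EA : component W u :\: A = component W u.
  apply: comp_no_exit; rewrite ?inE ?uA ?uC ?subsetDl // => x y; rewrite !inE.
  move=> /andP[xA xC] yC xy; rewrite yC andbT; apply/negP => yA.
  by apply: (nex y x); rewrite // esym.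
by move: zC; rewrite -EA inE zA.
Qed.

Lemma conn_closed C D : conn C -> C :&: D != set0 ->
  (forall x y, x \in C -> x \in D -> y \in C -> e x y -> y \in D) -> C \subset D.
Proof.
move=> cC CD clD; apply/setIidPl/eqP; apply: contraT => nCD.
have [x [y [xCD yC yD xy]]] := cC _ (subsetIl C D) CD nCD.
move: xCD yD; rewrite !inE yC /= => /andP[xC xD] /negP[].
exact: clD xC xD yC xy.
Qed.

Lemma comp_eq W u D : conn D -> u \in D -> D \subset W ->
  (forall x y, x \in D -> y \in W -> e x y -> y \in D) -> component W u = D.
Proof.
move=> cD uD sD clD; apply/eqP; rewrite eqEsubset comp_min //=.
apply: conn_closed => // [|x y xD xC yD xy].
  by apply/set0Pn; exists u; rewrite inE uD comp_self // (subsetP sD).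
by apply: comp_closed xC _ xy; apply: (subsetP sD).
Qed.

Lemma comp_mem W u v : v \in component W u -> component W v = component W u.
Proof.
by move=> vC; apply: comp_eq => //; [exact: conn_comp | exact: comp_sub | exact: comp_closed].
Qed.

Lemma comp_conn_sub W C u : conn C -> C \subset W -> u \in C -> C \subset component W u.
Proof.
move=> cC sC uC; apply: conn_closed => // [|x y _ xC yC xy].
  by apply/set0Pn; exists u; rewrite inE uC comp_self // (subsetP sC).
by apply: comp_closed xC _ xy; apply: (subsetP sC).
Qed.

Lemma comp_untouch W u v : component W u != component W v -> ~~ touch (component W u) (component W v).
Proof.
move=> ne; apply/touchPn => x y xC yC; apply/andP; split; apply: contra ne.
  by move=> /eqP Exy; rewrite -(comp_mem xC) Exy (comp_mem yC).
move=> xy; have yW := subsetP (comp_sub W v) _ yC.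
by rewrite -(comp_mem yC) (comp_mem (comp_closed xC yW xy)).
Qed.

Lemma conn1 v : conn [set v].
Proof.
move=> A sA A0 nA; case/negP: nA; rewrite eqEsubset sA sub1set.
by have [z zA] := set0Pn _ A0; rewrite -(set1P (subsetP sA _ zA)).
Qed.

Lemma conn_ext D S : conn D -> D != set0 -> D \subset S ->
  (forall x, x \in S -> x \notin D -> exists2 d, d \in D & e x d) -> conn S.
Proof.
move=> cD D0 sD HS A sA A0 nA.
have [DA|/subsetPn[d dD dA]] := boolP (D \subset A).
  have /subsetPn[y yS yA] : ~~ (S \subset A) by apply: contra nA => SA; rewrite eqEsubset sA.
  have [|d dD yd] := HS y yS; first by apply: contra yA => /(subsetP DA).
  by exists d, y; rewrite esym (subsetP DA).
have [AD|AD] := eqVneq (A :&: D) set0.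
  have [x xA] := set0Pn _ A0.
  have xD : x \notin D by apply/negP => xD; have := in_set0 x; rewrite -AD inE xA xD.
  have [d' d'D xd] := HS x (subsetP sA _ xA) xD.
  exists x, d'; split=> //; first exact: (subsetP sD).
  by apply/negP => d'A; have := in_set0 d'; rewrite -AD inE d'A d'D.
have [|x [y [xAD yD yA xy]]] := cD (A :&: D) (subsetIr _ _) AD.
  by apply: contra dA => /eqP EAD; move: dD; rewrite -{1}EAD inE => /andP[].
move: xAD yA; rewrite !inE yD andbT => /andP[xA _] yA.
by exists x, y; split=> //; apply: (subsetP sD).
Qed.

(** The cut between neighbours and nonneighbours of [s] in [S] is crossed by an edge, which forms an
    induced three-vertex path with [s]. *)
Lemma conn_mixed S s x y : conn S -> x \in S -> y \in S -> e s x -> ~~ e s y ->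
  exists x' y', [/\ x' \in S, y' \in S, e x' y', e s x' & ~~ e s y'].
Proof.
move=> cS xS yS sx sy.
have [|||x' [y' [+ y'S + xy]]] := cS [set z in S | e s z].
- by apply/subsetP => z; rewrite inE => /andP[].
- by apply/set0Pn; exists x; rewrite inE xS.
- by apply: contra sy => /eqP ES; move: yS; rewrite -ES inE => /andP[].
by rewrite !inE y'S => /andP[x'S sx'] sy'; exists x', y'.
Qed.

(** A common neighbour [d] of [x] and [y] in [D] gives the path b x d y b'. Otherwise walk from [x]
    into [D]: either some [q] in [D] is first reached after three steps, and b x a p q is induced,
    or two steps reach everything, in particular a neighbour [dy] of [y], and b x a dy y is
    induced. *)
Lemma link5 D x y b b' : conn D ->
  (exists2 d, d \in D & e x d) -> (exists2 d, d \in D & e y d) -> ~~ e x y ->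
  e b x -> e b' y -> (forall d, d \in D -> ~~ e b d) -> (forall d, d \in D -> ~~ e b' d) ->
  ~~ e b y -> ~~ e b' x -> ~~ e b b' -> p5in (D :|: [set x; y; b; b']).
Proof.
move=> cD [dx dxD xdx] [dy dyD ydy] xy bx b'y bD b'D by_ b'x bb'.
have inX z : z \in D -> z \in D :|: [set x; y; b; b'] by move=> zD; rewrite inE zD.
have xX : x \in D :|: [set x; y; b; b'] by rewrite !inE eqxx orbT.
have yX : y \in D :|: [set x; y; b; b'] by rewrite !inE eqxx !orbT.
have bX : b \in D :|: [set x; y; b; b'] by rewrite !inE eqxx !orbT.
have b'X : b' \in D :|: [set x; y; b; b'] by rewrite !inE eqxx !orbT.
have [/existsP[d /and3P[dD xd yd]]|no] := boolP [exists d, [&& d \in D, e x d & e y d]].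
  exists b, x, d, y, b'; rewrite bX xX yX b'X inX //; split=> //.
  by rewrite /p5 bx xd (esym d y) yd (esym y b') b'y (bD d) // by_ bb' xy (esym x b') b'x
       (esym d b') (b'D d).
have {}no d : d \in D -> e x d -> ~~ e y d.
  by move=> dD xd; apply: contra no => yd; apply/existsP; exists d; rewrite dD xd.
pose A := [set d in D | e x d].
pose A2 := [set d in D | [exists a, (a \in A) && e a d]].
have far q p : q \in D -> q \notin A -> p \in A2 -> p \notin A -> e p q ->
    q \notin A2 -> p5in (D :|: [set x; y; b; b']).
  rewrite !inE => qD; rewrite qD /= => xq /andP[pD /existsP[a]].
  rewrite inE => /andP[/andP[aD xa] ap]; rewrite pD /= => xp pq nex.
  have aq : ~~ e a q by apply: contra nex => aq; apply/existsP; exists a; rewrite inE aD xa.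
  exists b, x, a, p, q; rewrite bX xX !inX //; split=> //.
  by rewrite /p5 bx xa ap pq !bD // xp xq aq.
have [EA|nA] := eqVneq (A :|: A2) D.
  have : dy \in A :|: A2 by rewrite EA.
  have xdy : ~~ e x dy by apply/negP => /(no _ dyD); rewrite ydy.
  rewrite !inE dyD (negPf xdy) /= => /existsP[a]; rewrite inE => /andP[/andP[aD xa] ady].
  exists b, x, a, dy, y; rewrite bX xX yX !inX //; split=> //.
  by rewrite /p5 bx xa ady (esym dy) ydy (bD a) // (bD dy) // by_ xdy xy (esym a) (no a).
have [|||p [q [+ qD + pq]]] := cD (A :|: A2).
- by apply/subsetP => z; rewrite !inE => /orP[] /andP[].
- by apply/set0Pn; exists dx; rewrite !inE dxD xdx.
- by [].
rewrite !in_setU negb_or => /orP pA /andP[qA qA2].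
have pnA : p \notin A.
  apply: contra qA2 => pA'; rewrite inE qD; apply/existsP; exists p; by rewrite pA'.
case: pA => [pA|pA2]; first by rewrite pA in pnA.
exact: far qD qA pA2 pnA pq qA2.
Qed.

Definition kcol (col : T -> nat) k H := (forall x, x \in H -> col x < k) /\
  (forall x y, x \in H -> y \in H -> e x y -> col x != col y).

Lemma kcolS col k H C : C \subset H -> kcol col k H -> kcol col k C.
Proof.
move=> /subsetP sC [lt_col pr]; split=> [x /sC|x y /sC xH /sC yH]; first exact: lt_col.
exact: pr.
Qed.

Lemma kcol_nadj col k H x y : kcol col k H -> x \in H -> y \in H ->
  col x = col y -> ~~ e x y.
Proof. by move=> [_ pr] xH yH Exy; apply/negP => /(pr _ _ xH yH); rewrite Exy eqxx. Qed.

(** [P] is a minimal set of neighbours of [D] that sees the second neighbourhood of [D]. Two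
    elements of the same colour whose private neighbours also share a colour would form a [link5],
    so there is at most one element for each pair of colours. *)
Lemma dominate_step col k C D : kcol col k C -> ~ p5in C -> conn D -> D \subset C ->
  exists P, [/\ P \subset C, #|P| <= k * k,
    forall p, p \in P -> exists2 d, d \in D & e p d &
    forall w x, w \in C -> w \notin nb D -> x \in C -> x \in nb D -> e w x ->
      exists2 p, p \in P & e p w].
Proof.
move=> pr no5 cD sD.
pose A := [set p in C | (p \notin D) && (p \in nb D)].
pose B := [set w in C | (w \notin nb D) && [exists x, (x \in A) && e x w]].
have [|P [priv [PA hit Hpriv]]] := @hitting_set T A B e.
  by move=> b; rewrite !inE => /and3P[_ _ /existsP[x /andP[]]]; exists x.
have AD p : p \in A -> [/\ p \in C & exists2 d, d \in D & e p d].
  by rewrite !inE => /and3P[pC pD /orP[|/existsP[d /andP[]]]]; [rewrite (negPf pD) | split=> //; exists d].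
have BC p : p \in P -> [/\ priv p \in C, e p (priv p) & forall d, d \in D -> ~~ e (priv p) d].
  move=> /Hpriv[]; rewrite inE => /and3P[pC /notin_nb[_ nbp] _] ep _.
  by split.
exists P; split.
- by apply: subset_trans PA _; apply/subsetP => x; rewrite inE => /andP[].
- apply: (card_le_inj (f := fun p => col p * k + col (priv p))) => [p pP|p p' pP p'P].
    have [/(proj1 pr) ? /(proj1 pr) ?] : p \in C /\ priv p \in C.
      by split; [case: (AD _ (subsetP PA _ pP)) | case: (BC _ pP)].
    nia.
  have [qC pq qD] := BC _ pP; have [q'C pq' q'D] := BC _ p'P.
  have [pC dp] := AD _ (subsetP PA _ pP); have [p'C dp'] := AD _ (subsetP PA _ p'P).
  move=> /eq_pair_code[|| Ec Ec']; try exact: (proj1 pr).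
  case: (eqVneq p p') => // ne; case: no5; apply: p5inS (link5 cD dp dp' _ _ _ qD q'D _ _ _).
  + by rewrite !subUset sD !sub1set pC p'C qC q'C.
  + exact: kcol_nadj pr _ _ Ec.
  + by rewrite esym.
  + by rewrite esym.
  + by have [_ _ /(_ p' p'P)] := Hpriv _ pP; rewrite eq_sym esym; apply.
  + by have [_ _ /(_ p pP ne)] := Hpriv _ p'P; rewrite esym.
  + exact: kcol_nadj pr _ _ Ec'.
- by move=> p /(subsetP PA)/AD[].
move=> w x wC wD xC xD wx.
have xA : x \in A.
  rewrite inE xC xD andbT /=; apply: contra wD => xD'.
  by apply/nbP; right; exists x.
by apply: hit; rewrite inE wC wD; apply/existsP; exists x; rewrite xA esym.
Qed.

Lemma nbU D P v : v \in nb D -> v \in nb (D :|: P).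
Proof. exact: (subsetP (nbS (subsetUl _ _))). Qed.

(** Two rounds of [dominate_step] from [v] suffice: an undominated [w] next to a dominated [x] would
    end an induced path v p y x w with [p] in [P1] and [y] in [P2]. The bound counts [v] and two
    sets of size k^2. *)
Lemma conn_dominating col k C v : conn C -> v \in C -> kcol col k C -> ~ p5in C ->
  exists D, [/\ D \subset C, conn D, v \in D, C \subset nb D & #|D| <= 1 + 2 * (k * k)].
Proof.
move=> cC vC pr no5.
have sv : [set v] \subset C by rewrite sub1set.
have [P1 [sP1 cP1 aP1 hit1]] := dominate_step pr no5 (@conn1 v) sv.
pose D1 := [set v] :|: P1.
have sD1 : D1 \subset C by rewrite subUset sv.
have c1 : conn D1.
  apply: (conn_ext (@conn1 v)) => [||x]; [by apply/set0Pn; exists v; rewrite inE | exact: subsetUl |].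
  by rewrite in_setU => /orP[->//|/aP1].
have [P2 [sP2 cP2 aP2 hit2]] := dominate_step pr no5 c1 sD1.
pose D2 := D1 :|: P2.
have v1 : v \in D1 by rewrite !inE eqxx.
have c2 : conn D2.
  apply: (conn_ext c1) => [||x]; [by apply/set0Pn; exists v | exact: subsetUl |].
  by rewrite in_setU => /orP[->//|/aP2].
exists D2; split=> //; first by rewrite subUset sD1.
- by rewrite inE v1.
- apply: conn_closed => // [|x w xC xD2 wC xw].
    by apply/set0Pn; exists v; rewrite inE vC nbU // inE v1.
  apply: contraT => wD2; case: no5.
  have wD1 : w \notin nb D1 by apply: contra wD2; apply: nbU.
  have wx : e w x by rewrite esym.
  (* If [y] were adjacent to [v], the first round would have put a neighbour of [w'] into [P1]. *)
  have far2 y w' : w' \in C -> w' \notin nb D1 -> e w' y -> y \in C -> ~~ e y v.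
    move=> w'C w'D1 w'y yC; apply/negP => yv.
    have yv1 : y \in nb [set v] by apply/nbP; right; exists v; rewrite ?inE.
    have w'v : w' \notin nb [set v] by apply: contra w'D1; apply: nbU.
    have [p pP pw] := hit1 w' y w'C w'v yC yv1 w'y.
    by case/negP: w'D1; apply/nbP; right; exists p; rewrite ?inE ?pP ?orbT // esym.
  have xD1 : x \notin nb D1.
    apply: contra wD2 => xD1; have [p pP pw] := hit2 w x wC wD1 xC xD1 wx.
    by apply/nbP; right; exists p; rewrite ?inE ?pP ?orbT // esym.
  have [y yP2 xy] : exists2 y, y \in P2 & e x y.
    have [x1 nx1] := notin_nb xD1.
    case/nbP: xD2 => [|[d]]; rewrite in_setU => /orP[].
    - by rewrite (negPf x1).
    - move=> xP2; have [d dD xd] := aP2 _ xP2.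
      by have := nx1 _ dD; rewrite xd.
    - by move=> /nx1 /negPf->.
    by move=> dP2 xd; exists d.
  have yC := subsetP sP2 _ yP2.
  have yv := far2 y x xC xD1 xy yC.
  have [p pD1 yp] := aP2 _ yP2.
  have pP1 : p \in P1 by move: pD1 yp; rewrite !inE => /orP[/eqP->|//]; rewrite (negPf yv).
  have [d] := aP1 _ pP1; rewrite inE => /eqP-> pv.
  have [x1 nx1] := notin_nb xD1; have [w2 nw2] := notin_nb wD2.
  exists v, p, y, x, w; rewrite vC (subsetP sP1 _ pP1) yC xC wC; split=> //.
  rewrite /p5 (esym v p) pv (esym p y) yp (esym y x) xy xw (esym v y) yv.
  rewrite (esym v x) nx1 // (esym v w) nw2 ?inE ?eqxx // (esym p x) nx1 //.
  by rewrite (esym p w) nw2 ?inE ?pP1 ?orbT // (esym y w) nw2 // inE yP2 orbT.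
have := leq_of_leqif (leq_card_setU D1 P2); have := leq_of_leqif (leq_card_setU [set v] P1); rewrite cards1 /D2 -/D1.
lia.
Qed.

(** The dominating set is enlarged twice. A maximal clique [K] complete to [D0] leaves no vertex of
    [C] complete to [D1], so a vertex of [C] with a neighbour outside N[D1] is mixed on [D1] and
    cannot tell adjacent outside vertices apart. Hence private outside neighbours of equally
    coloured vertices are nonadjacent, and [link5] bounds a minimal set [P] seeing all outside
    neighbours by k. *)
Lemma isolate col k F C v : conn C -> v \in C -> C \subset F -> kcol col k C -> ~ p5in F ->
  exists D, [/\ D \subset C, conn D /\ v \in D, C \subset nb D,
    #|D| <= 1 + 2 * (k * k) + k + k &
    forall x y, x \in C -> y \in F -> y \notin nb D -> ~~ e x y].
Proof.
move=> cC vC sCF pr no5.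
have [D0 [sD0 c0 v0 dom0 card0]] := conn_dominating cC vC pr (fun h5 => no5 (p5inS sCF h5)).
pose ok (K : {set T}) := [&& K \subset C,
  [forall x, forall d, (x \in K) && (d \in D0) ==> e x d] &
  [forall x, forall y, [&& x \in K, y \in K & x != y] ==> e x y]].
have ok0 : ok set0.
  by rewrite /ok sub0set /=; apply/andP; split; apply/forallP => x; apply/forallP => y; rewrite inE.
case: (arg_maxnP (fun K : {set T} => #|K|) ok0) => K /and3P[sK Kd Kc] maxK.
have {}Kd x d : x \in K -> d \in D0 -> e x d.
  by move=> xK dD; have /forallP/(_ d) := forallP Kd x; rewrite xK dD.
have {}Kc x y : x \in K -> y \in K -> x != y -> e x y.
  by move=> xK yK ne; have /forallP/(_ y) := forallP Kc x; rewrite xK yK ne.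
have cardK : #|K| <= k.
  apply: (card_le_inj (f := col)) => [x /(subsetP sK)/(proj1 pr)//|x y xK yK Exy].
  apply/eqP; apply: contraT => /(Kc _ _ xK yK); apply/contraLR => _.
  by apply: kcol_nadj pr _ _ Exy; apply: (subsetP sK).
pose D1 := D0 :|: K.
have incompl x : x \in C -> exists2 d, d \in D1 & ~~ e x d.
  move=> xC; have [/existsP[d /andP[]]|no] := boolP [exists d, (d \in D1) && ~~ e x d].
    by exists d.
  have {}no d : d \in D1 -> e x d.
    by move=> dD; apply: contraT => xd; case/negP: no; apply/existsP; exists d; rewrite dD.
  have xK : x \notin K.
    by apply/negP => xK; have := no x; rewrite inE xK orbT eirr => /(_ isT).
  suff /maxK : ok (x |: K) by rewrite /= cardsU1 xK add1n ltnn.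
  apply/and3P; split.
  - by rewrite subUset sub1set xC.
  - apply/forallP => y; apply/forallP => d; apply/implyP.
    case/andP=> /setU1P[->|yK] dD; last exact: Kd.
    by apply: no; rewrite inE dD.
  - apply/forallP => y; apply/forallP => z; apply/implyP.
    case/and3P=> /setU1P[->|yK] /setU1P[->|zK]; rewrite ?eqxx // => ne.
    + by apply: no; rewrite inE zK orbT.
    + by rewrite esym; apply: no; rewrite inE yK orbT.
    + exact: Kc.
have sD1 : D1 \subset C by rewrite subUset sD0.
have v1 : v \in D1 by rewrite inE v0.
have c1 : conn D1.
  apply: (conn_ext c0) => [||x]; [by apply/set0Pn; exists v | exact: subsetUl |].
  by rewrite in_setU => /orP[->//|xK] _; exists v => //; apply: Kd.
have dom1 x : x \in C -> x \in nb D1 by move=> /(subsetP dom0); apply: nbU.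
have sF x : x \in C -> x \in F := fun xC => subsetP sCF x xC.
(* Otherwise [x] is mixed on an edge d d' of [D1] and on the edge b b', and b' b x d d' is
   induced. *)
have unmixed x b b' : x \in C -> b \in F -> b \notin nb D1 -> b' \in F -> b' \notin nb D1 ->
    e b b' -> e x b -> e x b'.
  move=> xC bF bD b'F b'D bb' xb; apply: contraT => xb'; case: no5.
  have [_ nbb] := notin_nb bD; have [_ nbb'] := notin_nb b'D.
  have [d1 d1D xd1] := incompl x xC.
  have [d0 d0D xd0] : exists2 d, d \in D1 & e x d.
    case/nbP: (dom1 x xC) => // xD; by have := nbb _ xD; rewrite esym xb.
  have [d [d' [dD d'D dd' xd xd']]] := conn_mixed c1 d0D d1D xd0 xd1.
  have dC := subsetP sD1 _ dD; have d'C := subsetP sD1 _ d'D.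
  exists b', b, x, d, d'; rewrite b'F bF !sF //; split=> //.
  by rewrite /p5 (esym b' b) bb' (esym b x) xb xd dd' (esym b' x) xb' !nbb // !nbb' // xd'.
pose B := [set b in F | (b \notin nb D1) && [exists x, (x \in C) && e x b]].
have [|P [priv [PC hit Hpriv]]] := @hitting_set T C B e.
  by move=> b; rewrite inE => /and3P[_ _ /existsP[x /andP[]]]; exists x.
have cardP : #|P| <= k.
  apply: (card_le_inj (f := col)) => [x /(subsetP PC)/(proj1 pr)//|p p' pP p'P Ec].
  case: (eqVneq p p') => // ne; case: no5.
  have [+ pq npq] := Hpriv _ pP; rewrite inE => /and3P[qF qD _].
  have [+ pq' npq'] := Hpriv _ p'P; rewrite inE => /and3P[q'F q'D _].
  have [_ nq] := notin_nb qD; have [_ nq'] := notin_nb q'D.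
  have pC := subsetP PC _ pP; have p'C := subsetP PC _ p'P.
  have see x q : x \in C -> q \notin nb D1 -> e x q -> exists2 d, d \in D1 & e x d.
    move=> xC /notin_nb[_ nqd] xq; case/nbP: (dom1 x xC) => // /nqd.
    by rewrite esym xq.
  apply: p5inS (link5 c1 (see _ _ pC qD pq) (see _ _ p'C q'D pq') _ _ _ nq nq' _ _ _).
  - by rewrite subUset (subset_trans sD1 sCF) !subUset !sub1set (sF p) // (sF p') // qF.
  - exact: kcol_nadj pr _ _ Ec.
  - by rewrite esym.
  - by rewrite esym.
  - by rewrite esym; apply: npq => //; rewrite eq_sym.
  - by rewrite esym; apply: npq'.
  - apply/negP => qq'; have := npq' p pP ne.
    by rewrite (unmixed p (priv p) (priv p')).
exists (D1 :|: P); split.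
- by rewrite subUset sD1.
- split; last by rewrite inE v1.
  apply: (conn_ext c1) => [||x]; [by apply/set0Pn; exists v | exact: subsetUl |].
  rewrite in_setU => /orP[->//|xP] xD; case/nbP: (dom1 x (subsetP PC _ xP)) => //.
  by rewrite (negPf xD).
- by apply/subsetP => x /dom1; apply: nbU.
- have := leq_of_leqif (leq_card_setU D1 P); have := leq_of_leqif (leq_card_setU D0 K); rewrite -/D1; lia.
move=> x y xC yF yD; apply/negP => xy.
have [|p pP py] := hit y.
  rewrite inE yF (contra (@nbU D1 P y)) //=.
  by apply/existsP; exists x; rewrite xC.
by case/negP: yD; apply/nbP; right; exists p; rewrite ?inE ?pP ?orbT // esym.
Qed.

End Graph.

Lemma card_bigcup_le (T I : finType) (A : {set I}) (F : I -> {set T}) m :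
  (forall i, i \in A -> #|F i| <= m) -> #|\bigcup_(i in A) F i| <= #|A| * m.
Proof.
move=> HF; apply: (@leq_trans (\sum_(i in A) #|F i|)).
  elim/big_ind2: _ => [|m1 n1 m2 n2 H1 H2|//]; first by rewrite cards0.
  exact: leq_trans (leq_of_leqif (leq_card_setU _ _)) (leq_add H1 H2).
by apply: leq_trans (leq_sum _ HF) _; rewrite sum_nat_const.
Qed.

Definition firstn (T : finType) n (S : {set T}) : {set T} := [set x in take n (enum S)].

Lemma firstn_sub (T : finType) n (S : {set T}) : firstn n S \subset S.
Proof. by apply/subsetP => x; rewrite inE => /mem_take; rewrite mem_enum. Qed.

Lemma card_firstn (T : finType) n (S : {set T}) : #|firstn n S| = minn n #|S|.
Proof.
have /card_uniqP : uniq (take n (enum S)) by apply: take_uniq; apply: enum_uniq.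
by rewrite cardsE => ->; rewrite size_take_min -cardE.
Qed.

(** * Pruning the lists around a dominating set *)

Section Decouple.
Variables (T : finType) (e : rel T) (r : nat).
Hypotheses (esym : symmetric e) (eirr : irreflexive e).
Implicit Types (A B S X D C H W P K F J : {set T}) (L : seq {set T}) (Dc : nat -> {set T}).

(** [far J] may contain [J], but an induced path inside [far J] avoids [J], because each of its
    vertices has a neighbour on the path. So [p5r_free] speaks of disjoint unions of a P5 and [r]
    isolated vertices. *)
Definition far J := [set y | [forall j, (j \in J) ==> ~~ e j y]].

Lemma farP J y : reflect (forall j, j \in J -> ~~ e j y) (y \in far J).
Proof. by rewrite inE; apply: (iffP forallP) => Hy j; [exact/implyP | apply/implyP/Hy]. Qed.

Definition p5r_free := forall J, #|J| = r ->
  (forall i j, i \in J -> j \in J -> ~~ e i j) -> ~ p5in e (far J).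

Definition trace D0 v := [set d | (d \in D0) && e v d].
Definition present Dc d c := [exists x, (x \in Dc c) && e d x].
Definition large Dc d c := r <= #|[set x | (x \in Dc c) && ~~ e d x]|.

(* Candidates of colour c for a vertex outside D; the lists carry no adjacency between vertices of
   different traces on D0 once list1 is pruned to list2. *)
Definition list1 L D0 Dc D c := [set v | [&& v \in nth set0 L c, v \notin D,
  [forall x, (x \in Dc c) ==> ~~ e v x] &
  [forall d, (d \in D0) ==> if e v d then present Dc d c else large Dc d c]]].

Definition list2 L D0 Dc D c := [set z | (z \in list1 L D0 Dc D c) &&
  [forall v, (v \in list1 L D0 Dc D c) && e z v ==> (trace D0 z \subset trace D0 v)]].

Definition lcol L (col : T -> nat) H := (forall x, x \in H -> x \in nth set0 L (col x)) /\
  (forall x y, x \in H -> y \in H -> e x y -> col x != col y).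

Lemma lcol_kcol L col H : lcol L col H -> kcol e col (size L) H.
Proof.
move=> [HL pr]; split=> // x /HL; apply: contraTT; rewrite -leqNgt => le_L.
by rewrite nth_default // inE.
Qed.

Definition colclass (col : T -> nat) H c := [set x in H | col x == c].

Hypothesis Hfree : p5r_free.

Definition dec_bound k n := n + n * (k * (1 + r)) + 2 ^ n * (2 ^ n * k).

(** The enlargement takes, for each [d] in [D0] and each colour, one vertex of that colour adjacent
    to [d] and up to [r] nonadjacent ones, and for each colour and each pair of traces at most one
    vertex that blocks the unwanted adjacencies. [dec_bound] adds these numbers up. *)
Lemma decouple L col H D0 : lcol L col H -> D0 \subset H -> H \subset nb e D0 ->
  exists D, [/\ D0 \subset D, D \subset H, #|D| <= dec_bound (size L) #|D0| &
    forall h, h \in H -> h \notin D -> h \in list2 L D0 (colclass col D) D (col h)].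
Proof.
move=> lc sD0 dom; have pr := lcol_kcol lc; set k := size L in pr *.
pose W d c := firstn 1 [set x | (x \in colclass col H c) && e d x].
pose Jt d c := firstn r [set x | (x \in colclass col H c) && ~~ e d x].
have clH x c : x \in colclass col H c -> x \in H /\ col x = c.
  by rewrite inE => /andP[? /eqP].
have WH d c x : x \in W d c -> [/\ x \in H, col x = c & e d x].
  by move=> /(subsetP (firstn_sub _ _)); rewrite !inE => /andP[/andP[? /eqP ?] ?].
have JH d c x : x \in Jt d c -> [/\ x \in H, col x = c & ~~ e d x].
  by move=> /(subsetP (firstn_sub _ _)); rewrite !inE => /andP[/andP[? /eqP ?] ?].
pose D1 := D0 :|: \bigcup_(d in D0) \bigcup_(c in [set: 'I_k]) (W d c :|: Jt d c).
have sD1 : D1 \subset H.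
  rewrite subUset sD0; apply/bigcupsP => d _; apply/bigcupsP => c _.
  by rewrite subUset; apply/andP; split; apply/subsetP => x; [case/WH | case/JH].
have inD1 d c x : d \in D0 -> c < k -> x \in W d c :|: Jt d c -> x \in D1.
  move=> dD ck xWJ; rewrite inE; apply/orP; right; apply/bigcupP; exists d => //.
  by apply/bigcupP; exists (Ordinal ck); rewrite ?in_setT.
have [Hk _] := pr.
have presentD D d c h : D1 \subset D -> d \in D0 -> h \in H -> col h = c -> e d h ->
    present (colclass col D) d c.
  move=> sD dD hH hc dh; have : 0 < #|W d c|.
    rewrite card_firstn leq_min; apply/card_gt0P; exists h.
    by rewrite !inE hH hc eqxx dh.
  case/card_gt0P=> x xW; have [xH xc dx] := WH _ _ _ xW.
  apply/existsP; exists x; rewrite inE xc eqxx dx !andbT; apply: (subsetP sD).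
  by apply: (inD1 d c) => //; [rewrite -hc; apply: Hk | rewrite inE xW].
have largeD D d h : D1 \subset D -> d \in D0 -> h \in H -> h \notin D -> ~~ e d h ->
    large (colclass col D) d (col h).
  move=> sD dD hH hD dh; set c := col h.
  have ck : c < k by apply: Hk.
  have sJ : Jt d c \subset [set x | (x \in colclass col D c) && ~~ e d x].
    apply/subsetP => x xJ; have [xH xc dx] := JH _ _ _ xJ.
    rewrite !inE xc eqxx dx !andbT; apply: (subsetP sD).
    by apply: (inD1 d c) => //; rewrite inE xJ orbT.
  apply: leq_trans (subset_leq_card sJ); rewrite card_firstn leq_min leqnn /=.
  rewrite leqNgt; apply/negP => lt_r; case/negP: hD; apply: (subsetP sD).
  apply: (inD1 d c) => //; rewrite inE; apply/orP; right.
  have /eqP-> : Jt d c == [set x | (x \in colclass col H c) && ~~ e d x].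
    by rewrite eqEcard firstn_sub card_firstn; lia.
  by rewrite !inE hH eqxx.
have largeH D d c : D \subset H -> large (colclass col D) d c ->
    r <= #|[set x | (x \in colclass col H c) && ~~ e d x]|.
  move=> sD lg; apply: leq_trans lg (subset_leq_card _); apply/subsetP => x.
  by rewrite !inE => /andP[/andP[/(subsetP sD)-> ->] ->].
(* Let [d] lie in A but not in A'. A single solution vertex sees all candidates of trace A' that are
   adjacent to solution vertices of colour [c] and trace A: two vertices with private candidates
   would create an induced P5 far from [r] vertices of colour [c]. *)
have hit (t : {set T} * {set T} * 'I_k) : exists P, [/\ P \subset colclass col H t.2, #|P| <= 1 &
    t.1.1 \subset t.1.2 \/ forall h v, h \in H -> col h = t.2 -> trace D0 h = t.1.1 ->
      v \in list1 L D0 (colclass col D1) D1 t.2 -> trace D0 v = t.1.2 -> e h v ->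
      exists2 p, p \in P & e p v].
  case: t => [[A A'] c] /=.
  have [sAA'|/subsetPn[d dA dA']] := boolP (A \subset A').
    by exists set0; rewrite sub0set cards0; split=> //; left.
  pose Q := [set q in colclass col H c | trace D0 q == A].
  pose B := [set v in list1 L D0 (colclass col D1) D1 c | (trace D0 v == A') &&
    [exists q, (q \in Q) && e q v]].
  have [|P [priv [PQ hits Hpriv]]] := @hitting_set T Q B e.
    by move=> b; rewrite inE => /and3P[_ _ /existsP[q /andP[]]]; exists q.
  have QH q : q \in Q -> [/\ q \in H, col q = c & e d q /\ d \in D0].
    rewrite inE => /andP[/clH[qH qc] /eqP tq]; split=> //.
    by move: dA; rewrite -tq inE esym => /andP[].
  have L1 v : v \in list1 L D0 (colclass col D1) D1 c -> trace D0 v = A' -> d \in D0 ->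
      [/\ forall x, x \in D1 -> col x = c -> ~~ e v x, ~~ e d v &
        r <= #|[set x | (x \in colclass col H c) && ~~ e d x]|].
    rewrite inE => /and4P[_ _ /forallP nx /forallP pl] tv dD.
    have dv : ~~ e d v by move: dA'; rewrite -tv inE dD esym.
    split=> // [x xD xc|]; first by have := nx x; rewrite inE xD xc eqxx.
    by have := pl d; rewrite dD esym (negPf dv) => /largeH; apply.
  exists P; split.
  - by apply: subset_trans PQ _; apply/subsetP => q; rewrite inE => /andP[].
  - apply: (card_le_inj (f := fun=> 0)) => // p p' pP p'P _.
    case: (eqVneq p p') => // ne; exfalso.
    have [+ pv npv] := Hpriv _ pP; have [+ pv' npv'] := Hpriv _ p'P.
    set v := priv p in pv npv *; set v' := priv p' in pv' npv' *.
    rewrite [v' \in _]inE [v \in _]inE => /and3P[v'L /eqP tv' _] /and3P[vL /eqP tv _].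
    have [pH pc [dp dD]] := QH _ (subsetP PQ _ pP).
    have [p'H p'c [dp' _]] := QH _ (subsetP PQ _ p'P).
    have [nv dv le_r] := L1 v vL tv dD; have [nv' dv' _] := L1 v' v'L tv' dD.
    have p'v : ~~ e p' v by apply: npv => //; rewrite eq_sym.
    have pv'n : ~~ e p v' by apply: npv'.
    have sameH y : y \in H -> col y = c -> forall x, x \in colclass col H c -> ~~ e y x.
      by move=> yH yc x /clH[xH xc]; apply: kcol_nadj pr yH xH _; rewrite yc xc.
    have [x0 [x0D x0c dx0]] : exists x, [/\ x \in D1, col x = c & e d x].
      have /existsP[x] := presentD D1 d c p (subxx _) dD pH pc dp.
      by rewrite inE => /andP[/andP[xD /eqP xc] dx]; exists x.
    (* [S] is far from the whole path: [p], [p'] and [x0] have its colour, [d] misses it by choice,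
       and the candidates [v], [v'] have no neighbour of colour [c] in [D1]. *)
    pose S := firstn r [set x | (x \in colclass col H c) && ~~ e d x].
    have cS : #|S| = r by rewrite card_firstn; apply/minn_idPl.
    have inS x : x \in S -> [/\ x \in H, col x = c, ~~ e d x & x \in D1].
      move=> xS; have [xH xc dx] := JH _ _ _ xS; split=> //.
      by apply: (inD1 d c) => //; rewrite inE xS orbT.
    case: (Hfree cS) => [i j /inS[iH ic _ _] /inS[jH jc _ _]|].
      by apply: kcol_nadj pr iH jH _; rewrite ic jc.
    have inF y : (forall x, x \in S -> ~~ e y x) -> y \in far S.
      by move=> ny; apply/farP => j /ny; rewrite esym.
    have vF : v \in far S by apply: inF => x /inS[_ xc _ xD]; apply: nv.
    have v'F : v' \in far S by apply: inF => x /inS[_ xc _ xD]; apply: nv'.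
    have dF : d \in far S by apply: inF => x /inS[].
    have cF y : y \in H -> col y = c -> y \in far S.
      by move=> yH yc; apply: inF => x /inS[xH xc _ _]; apply: sameH => //; rewrite inE xH xc eqxx.
    (* If v v' is an edge, v p d p' v' is not induced, and v' v p d x0 replaces it. Here [x0] is the
       neighbour of [d] stored in [D1], invisible to both candidates. *)
    have [vv'|vv'] := boolP (e v v').
      have x0H := subsetP sD1 _ x0D.
      exists v', v, p, d, x0; rewrite v'F vF dF !cF //; split=> //.
      rewrite /p5 (esym v' v) vv' (esym v p) pv (esym p d) dp dx0 (esym v' p) pv'n.
      rewrite (esym v' d) dv' nv' // (esym v d) dv nv //=.
      by apply: sameH => //; rewrite inE x0H x0c eqxx.
    exists v, p, d, p', v'; rewrite v'F vF dF !cF //; split=> //.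
    rewrite /p5 (esym v p) pv (esym p d) dp dp' pv' (esym v d) dv (esym v p') p'v vv' pv'n dv' /= andbT.
    by apply: sameH => //; rewrite inE p'H p'c eqxx.
  right=> h v hH hc th vL tv hv; apply: hits; rewrite inE vL tv eqxx.
  by apply/existsP; exists h; rewrite inE th eqxx andbT inE hH hc eqxx hv.
have [Q HQ] := fin_all_exists hit.
pose D2 := \bigcup_(A in powerset D0) \bigcup_(A' in powerset D0) \bigcup_(c in [set: 'I_k]) Q (A, A', c).
exists (D1 :|: D2).
have sD2 : D2 \subset H.
  apply/bigcupsP => A _; apply/bigcupsP => A' _; apply/bigcupsP => c _.
  have [+ _ _] := HQ (A, A', c); move=> /subset_trans; apply.
  by apply/subsetP => x /clH[].
have sD : D1 :|: D2 \subset H by rewrite subUset sD1.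
split=> //.
- exact: subset_trans (subsetUl _ _) (subsetUl _ _).
- apply: leq_trans (leq_of_leqif (leq_card_setU _ _)) _; apply: leq_add.
    apply: leq_trans (leq_of_leqif (leq_card_setU _ _)) _; rewrite leq_add2l.
    apply: card_bigcup_le => d _; apply: leq_trans (card_bigcup_le (m := 1 + r) _) _.
      move=> c _; apply: leq_trans (leq_of_leqif (leq_card_setU _ _)) _.
      by rewrite !card_firstn leq_add // geq_minl.
    by rewrite cardsT card_ord.
  rewrite -card_powerset; apply: card_bigcup_le => A _; apply: card_bigcup_le => A' _.
  apply: leq_trans (card_bigcup_le (m := 1) _) _; last by rewrite cardsT card_ord muln1.
  by move=> c _; have [] := HQ (A, A', c).
move=> h hH hD; set D := D1 :|: D2 in sD hD *; set c := col h.
have ck : c < k by apply: Hk.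
have sDD : D1 \subset D := subsetUl _ _.
have hL1 : h \in list1 L D0 (colclass col D) D c.
  rewrite inE (proj1 lc) // hD /=; apply/andP; split; apply/forallP.
    move=> x; apply/implyP; rewrite inE => /andP[/(subsetP sD) xH /eqP xc].
    by apply: kcol_nadj pr hH xH _; rewrite xc.
  move=> d; apply/implyP => dD; case: ifP => hd.
    by apply: (presentD D d c h); rewrite // esym.
  by apply: largeD; rewrite // esym hd.
rewrite inE hL1; apply/forallP => v; apply/implyP => /andP[vL hv].
(* Candidates for [D] are candidates for [D1]: if [d] has [r] nonneighbours of colour [c] in [D],
   then [Jt d c] already provides [r] of them in [D1]. So the blocking vertices chosen for [D1] also
   apply here. *)
have vL1 : v \in list1 L D0 (colclass col D1) D1 c.
  move: vL; rewrite inE => /and4P[vL vD /forallP nx /forallP pl].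
  rewrite inE vL (contra (subsetP sDD v) vD) /=.
  apply/andP; split; [apply/forallP => x | apply/forallP => d]; apply/implyP.
    rewrite inE => /andP[xD xc]; have := nx x; rewrite inE xc andbT.
    by rewrite (subsetP sDD).
  move=> dD; have := pl d; rewrite dD /=; case: ifP => _.
    case/existsP=> x; rewrite inE => /andP[/andP[/(subsetP sD) xH /eqP xc] dx].
    exact: (presentD D1 d c x).
  move=> /(largeH _ _ _ sD) le_r.
  suff sJ : Jt d c \subset [set x | (x \in colclass col D1 c) && ~~ e d x].
    by apply: leq_trans (subset_leq_card sJ); rewrite card_firstn (minn_idPl le_r).
  apply/subsetP => x xJ; have [xH xc dx] := JH _ _ _ xJ.
  rewrite inE dx andbT inE xc eqxx andbT.
  by apply: (inD1 d c) => //; rewrite inE xJ orbT.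
have [_ _ /= [//|hits]] := HQ (trace D0 h, trace D0 v, Ordinal ck).
have [p pQ pv] := hits h v hH erefl erefl vL1 erefl hv.
have pD : p \in D2.
  have tr w : trace D0 w \in powerset D0.
    by rewrite inE; apply/subsetP => x; rewrite inE => /andP[].
  apply/bigcupP; exists (trace D0 h) => //; apply/bigcupP; exists (trace D0 v) => //.
  by apply/bigcupP; exists (Ordinal ck); rewrite ?in_setT.
have [/subsetP/(_ p pQ)/clH[pH pc] _ _] := HQ (trace D0 h, trace D0 v, Ordinal ck).
move: vL; rewrite inE => /and4P[_ _ /forallP/(_ p) + _].
by rewrite inE pc eqxx /D in_setU pD orbT /= esym pv.
Qed.

End Decouple.

Section Separation.
Variables (T : finType) (e : rel T).
Hypotheses (esym : symmetric e) (no5 : ~ p5in e setT).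
Implicit Types (A B S X D C W P K F J M Om V : {set T}) (ds : seq T).

Notation conn := (conn e).
Notation component := (component e).
Notation touch := (touch e).
Notation nb := (nb e).

(** * Splitting a piece of a P5-free graph *)

(** A mixed edge on either side would give the induced path a' a s b b'. *)
Lemma mixed_once A B s x y x' y' : conn A -> conn B -> ~~ touch A B ->
  x \in A -> y \in A -> e s x -> ~~ e s y ->
  x' \in B -> y' \in B -> e s x' -> ~~ e s y' -> False.
Proof.
move=> cA cB /touchPn AB xA yA sx sy xB yB sx' sy'.
have [a [a' [aA a'A aa' sa sa']]] := conn_mixed cA xA yA sx sy.
have [b [b' [bB b'B bb' sb sb']]] := conn_mixed cB xB yB sx' sy'.
have nab u v : u \in A -> v \in B -> ~~ e u v by move=> uA vB; case/andP: (AB u v uA vB).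
case: no5; exists a', a, s, b, b'; rewrite !in_setT; split=> //.
by rewrite /p5 (esym a' a) aa' (esym a s) sa sb bb' (esym a' s) sa' (nab a' b) // (nab a' b') // (nab a b) // (nab a b') // sb'.
Qed.

Lemma mixed_complete A B s x y x' : conn A -> conn B -> ~~ touch A B ->
  x \in A -> y \in A -> e s x -> ~~ e s y -> x' \in B -> e s x' ->
  forall y', y' \in B -> e s y'.
Proof.
move=> cA cB AB xA yA sx sy x'B sx' y' y'B; apply: contraT => sy'.
by case: (mixed_once cA cB AB xA yA sx sy x'B y'B sx' sy').
Qed.

Definition inS := (in_setD1, in_setD, in_setU1, in_setU, in_setI, in_set1, in_set0).

(** A piece, its anchor and their common neighbours. All other neighbours of an attached piece are
    complete to it and can be left out of the separation. *)
Definition ext c M := [set v | [|| v \in M, v == c | (v \in nb M) && e c v]].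
Definition nbs (s : seq T) := [set v | (v \in s) || has (e v) s].
(** Computable from [x] and [ds], this is to contain the boundary of all but a few components of a
    minimal separator and to avoid these components. The second clause catches the boundary of
    components that [x] and [ds] do not see; the count of two is for components complete to [x]. *)
Definition barrier V x ds := [set y | (1 < count (e y) ds) ||
  [&& y \in V, y \in nbs (x :: ds) &
    [exists z, [&& z \in V, z \notin nbs (x :: ds) & e y z]]]].

Variables (I : {set T}).
Hypotheses (indI : forall i j, i \in I -> j \in I -> ~~ e i j)
  (maxI : forall v, v \notin I -> exists2 i, i \in I & e v i).

(** An outside vertex that is mixed on [B] must see [c']. So growing a seed in [B] by mixed vertices
    that miss [c'] never leaves [B], and this is how [hull] reaches enough of [B] from three
    vertices. *)
Definition attached B c' := [/\ c' \in I, c' \notin nb B &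
  forall s, s \notin B -> s \in nb B -> ~~ e c' s -> forall x, x \in B -> e s x].

Variables (c : T) (M : {set T}).
Hypotheses (cI : c \in I) (cM : conn M) (attM : attached M c) (M2 : 1 < #|M|)
  (MI : M :&: I != set0).

Let V := ext c M.
Let Sc := V :\: M :\ c.

Let cnM : c \notin M /\ forall m, m \in M -> ~~ e c m.
Proof. by have [_ + _] := attM => /notin_nb. Qed.

Let cV : c \in V. Proof. by rewrite inE eqxx orbT. Qed.
Let sMV : M \subset V. Proof. by apply/subsetP => m mM; rewrite inE mM. Qed.

Let ScP s : s \in V -> s \notin M -> s != c -> e c s /\ exists2 m, m \in M & e s m.
Proof.
rewrite inE => /or3P[->//|->//|/andP[/nbP[->//|sm] cs]] _ _.
by split.
Qed.

(** Attachment to some anchor is tested inside [V] only; [goodP] recovers it for the whole graph,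
    because a neighbour of [B] outside [V] misses [c] and is therefore complete to [M]. *)
Definition goodb B := [&& B \subset M, B != M, B :&: I != set0 &
  [exists c', [&& c' \in I, c' \in V, c' \notin nb B &
    [forall s, [&& s \in V, s \in nb B, s \notin B & ~~ e c' s] ==>
      [forall x, (x \in B) ==> e s x]]]]].

Lemma goodP B : goodb B -> [/\ B \subset M, B != M, B :&: I != set0 &
  exists2 c', c' \in V & attached B c'].
Proof.
case/and4P=> sB nB IB /existsP[c' /and4P[c'I c'V c'B /forallP Hs]]; split=> //.
exists c' => //; split=> // s sB' sNB c's x xB.
have [sV|sV] := boolP (s \in V).
  by have := Hs s; rewrite sV sNB sB' c's => /forallP/(_ x); rewrite xB.
have [_ _] := attM; apply.
- by apply: contra sV => sM; rewrite inE sM.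
- exact: (subsetP (nbS e sB)).
- apply: contra sV => cs; rewrite inE cs andbT; apply/or3P; apply: Or33.
  exact: (subsetP (nbS e sB)).
- exact: (subsetP sB).
Qed.

Lemma goodI B c' : B \subset M -> B != M -> B :&: I != set0 -> c' \in V -> c' \in I ->
  c' \notin nb B ->
  (forall s, s \in V -> s \in nb B -> s \notin B -> ~~ e c' s -> forall x, x \in B -> e s x) ->
  goodb B.
Proof.
move=> sB nB IB c'V c'I c'B Hs; apply/and4P; split=> //; apply/existsP; exists c'.
rewrite c'I c'V c'B; apply/forallP => s; apply/implyP => /and4P[sV sN sB' cs].
by apply/forallP => x; apply/implyP => xB; apply: Hs sV sN sB' cs x xB.
Qed.

(** Separators whose components in [M] are again good pieces. The complement of [I] in [V] is one,
    as it leaves single vertices; one of minimum cardinality plays the part of a potential maximal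
    clique. *)
Definition adm Om := [&& Om \subset V, Om :&: I == set0, c \notin Om, Sc \subset Om &
  [forall u, (u \in M :\: Om) ==> goodb (component (V :\: Om) u)]].

Lemma adm0 : adm (V :\: I).
Proof.
apply/and5P; split; first exact: subsetDl.
- by apply/eqP/setP => x; rewrite !inS; case: (x \in I); rewrite ?andbF.
- by rewrite inE cI.
- apply/subsetP => s; rewrite !inS => /and3P[sc sM sV]; rewrite sV andbT.
  have [cs _] := ScP sV sM sc; apply/negP => sI.
  by have := indI cI sI; rewrite cs.
apply/forallP => u; apply/implyP; rewrite !inS => /andP[+ uM].
rewrite (subsetP sMV) // andbT negbK => uI.
have -> : component (V :\: (V :\: I)) u = [set u].
  apply: comp_eq; [exact: conn1 | by rewrite inE | |].
    by rewrite sub1set !inS uI (subsetP sMV).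
  move=> x y /set1P-> ; rewrite !inS => /andP[yI yV] uy.
  by move: yI; rewrite yV andbT negbK => yI; have := indI uI yI; rewrite uy.
apply: (goodI (c' := c)) => //.
- by rewrite sub1set.
- by apply: contraTneq M2 => <-; rewrite cards1.
- by apply/set0Pn; exists u; rewrite !inE eqxx.
- apply/nbP => -[/set1P cu|[d /set1P-> cu]].
    by case: cnM; rewrite cu uM.
  by case: cnM => _ /(_ u uM); rewrite cu.
move=> s sV /nbP[->//|[d /set1P-> su]] _ _ x /set1P->; exact: su.
Qed.

Section Minimal.
Variable Om : {set T}.
Hypotheses (admOm : adm Om) (minOm : forall Om', adm Om' -> #|Om| <= #|Om'|).

Let sOV : Om \subset V. Proof. by case/and5P: admOm. Qed.
Let OI x : x \in Om -> x \in I -> False.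
Proof. by case/and5P: admOm => _ /eqP OI _ _ _ xO xI; have := in_set0 x; rewrite -OI inE xO xI. Qed.
Let cO : c \notin Om. Proof. by case/and5P: admOm. Qed.
Let ScO s : s \in V -> s \notin M -> s != c -> s \in Om.
Proof. by case/and5P: admOm => _ _ _ /subsetP sS _ sV sM sc; apply: sS; rewrite !inS sc sM. Qed.

Let Dm u := component (V :\: Om) u.

Let DmG u : u \in M -> u \notin Om -> goodb (Dm u).
Proof. by case/and5P: admOm => _ _ _ _ /forallP/(_ u) + uM uO; rewrite in_setD uM uO. Qed.

Let Dm_c : Dm c = [set c].
Proof.
apply: comp_eq; [exact: conn1 | by rewrite inE | by rewrite sub1set inE cO cV |].
move=> x y /set1P->; rewrite in_setD => /andP[yO yV] cy; rewrite in_set1.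
apply: contraT => yc; have [yM|yM] := boolP (y \in M).
  by case: cnM => _ /(_ y yM); rewrite cy.
by rewrite ScO in yO.
Qed.

Let Cs := [set Dm u | u in V :\: Om].

Let CsP D : D \in Cs -> exists u, [/\ u \in V, u \notin Om, u \in D & D = Dm u].
Proof.
case/imsetP=> u; rewrite in_setD => /andP[uO uV] ->; exists u; split=> //.
by apply: comp_self; rewrite in_setD uO.
Qed.

Let CsM D : D \in Cs -> D != [set c] -> goodb D.
Proof.
case/CsP=> u [uV uO _ ->] ne; apply: DmG => //; apply: contraNT uO => uM.
by apply: ScO => //; apply: contraNneq ne => ->; rewrite Dm_c.
Qed.

Let Cs_mem u : u \in V -> u \notin Om -> Dm u \in Cs.
Proof. by move=> uV uO; apply: imset_f; rewrite in_setD uO. Qed.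

Let Cs_conn D : D \in Cs -> conn D.
Proof. by case/CsP=> u [_ _ _ ->]; apply: conn_comp. Qed.

Let Cs_sub D x : D \in Cs -> x \in D -> x \in V /\ x \notin Om.
Proof. by case/CsP=> u [_ _ _ ->] /(subsetP (comp_sub e _ _)); rewrite in_setD => /andP[]. Qed.

Let Cs_eq D x : D \in Cs -> x \in D -> D = Dm x.
Proof. by case/CsP=> u [_ _ _ ->] xD; rewrite /Dm (comp_mem esym xD). Qed.

Let Cs_bd D x y : D \in Cs -> x \in D -> y \in V -> e x y -> y \notin D -> y \in Om.
Proof.
case/CsP=> u [_ _ _ ->] xD yV xy; apply: contraNT => yO.
by apply: comp_closed xD _ xy; rewrite in_setD yO.
Qed.

Let Cs_dis D D' : D \in Cs -> D' \in Cs -> D != D' -> ~~ touch D D'.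
Proof. by case/CsP=> u [_ _ _ ->] /CsP[v [_ _ _ ->]]; apply: comp_untouch. Qed.

Let Cs_nadj D D' x y : D \in Cs -> D' \in Cs -> D != D' -> x \in D -> y \in D' -> ~~ e x y.
Proof. by move=> DC D'C ne xD yD; have /touchPn/(_ x y xD yD)/andP[] := Cs_dis DC D'C ne. Qed.

Let Cs_I D : D \in Cs -> exists2 i, i \in D & i \in I.
Proof.
move=> DC; have [->|/(CsM DC)/goodP[_ _ /set0Pn[i] + _]] := eqVneq D [set c].
  by exists c; rewrite ?inE.
by rewrite inE => /andP[]; exists i.
Qed.

Let sees q D := [exists x, (x \in D) && e q x].
Let Ds q := [set D in Cs | sees q D].

Let DsP q D : reflect (D \in Cs /\ exists2 x, x \in D & e q x) (D \in Ds q).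
Proof.
rewrite inE; apply: (iffP andP) => -[DC]; first by case/existsP=> x /andP[]; split=> //; exists x.
by case=> x xD qx; split=> //; apply/existsP; exists x; rewrite xD.
Qed.

(** Here the maximality of [I] enters. Outside [M], a separator vertex sees [c]; inside [M], it has
    a neighbour in [I], which [attached] forces into [M]. *)
Let Ds_neq0 q : q \in Om -> exists D, D \in Ds q.
Proof.
move=> qO; have qV := subsetP sOV _ qO.
have [qM|qM] := boolP (q \in M); last first.
  have [|cq _] := ScP qV qM; first by apply: contraTneq qO => ->.
  exists (Dm c); apply/DsP; split; first exact: Cs_mem.
  by exists c; rewrite ?Dm_c ?inE // esym.
have [|i iI qi] := maxI (v := q); first by apply/negP; apply: OI.
have iM : i \in M.
  apply: contraT => iM; have inb : i \in nb M by apply/nbP; right; exists q; rewrite // esym.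
  have [j] := set0Pn _ MI; rewrite inE => /andP[jM jI].
  have ci : ~~ e c i by apply: indI.
  have [_ _ /(_ i iM inb ci j jM)] := attM.
  by rewrite (negPf (indI iI jI)).
have iV := subsetP sMV _ iM; have iO : i \notin Om by apply/negP => /OI; apply.
exists (Dm i); apply/DsP; split; first exact: Cs_mem.
by exists i => //; apply: comp_self; rewrite in_setD iO.
Qed.

(** The use of minimality: a good connected set that meets [Om] and is bounded by [Om] could be
    released from it, leaving a smaller admissible set. *)
Let grow D z : conn D -> goodb D -> z \in D -> z \in Om ->
  (forall x y, x \in D -> y \in V -> e x y -> y \notin D -> y \in Om) -> False.
Proof.
move=> cD gD zD zO bdD; have [sDM _ _ _] := goodP gD.
suff /minOm : adm (Om :\: D).
  rewrite leqNgt => /negP; apply; apply: proper_card; rewrite properE subsetDl.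
  by apply/subsetPn; exists z; rewrite // inE zD.
apply/and5P; split.
- exact: subset_trans (subsetDl _ _) sOV.
- apply/eqP/setP => x; rewrite !inS; apply/negP => /andP[/andP[_ xO] xI].
  exact: OI xO xI.
- by rewrite inE (negPf cO) andbF.
- apply/subsetP => s; rewrite !inS => /and3P[sc sM sV]; rewrite ScO // andbT.
  by apply: contra sM; apply: (subsetP sDM).
apply/forallP => u; apply/implyP; rewrite !inS negb_and negbK => /andP[uDO uM].
have uV := subsetP sMV _ uM; have [uD|uD] := boolP (u \in D).
  suff -> : component (V :\: (Om :\: D)) u = D by [].
  apply: comp_eq => // [|x y xD].
    by apply/subsetP => x xD; rewrite !inS xD (subsetP sMV) // (subsetP sDM).
  rewrite !inS negb_and negbK => /andP[yDO yV] xy.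
  by apply: contraT => yD; move: yDO; rewrite (negPf yD) /= (bdD x y).
rewrite (negPf uD) /= in uDO.
suff -> : component (V :\: (Om :\: D)) u = Dm u by apply: DmG.
have uDm : u \in Dm u by apply: comp_self; rewrite in_setD uDO.
have DmC := Cs_mem uV uDO.
apply: comp_eq => //; first exact: Cs_conn.
  by apply/subsetP => x /(Cs_sub DmC)[xV xO]; rewrite !inS (negPf xO) andbF.
move=> x y xDm; rewrite !inS negb_and negbK => /andP[yDO yV] xy.
have [xV xO] := Cs_sub DmC xDm.
have [yO|yO] := boolP (y \in Om); last by apply: comp_closed xDm _ xy; rewrite in_setD yO.
rewrite yO orbF in yDO.
have xD : x \in D.
  by apply: contraT => xD; case/negP: xO; apply: (bdD y x) => //; rewrite esym.
case/negP: uD; suff /subsetP/(_ u uDm) : Dm u \subset D by [].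
apply: conn_closed => // [||p q pDm pD qDm pq]; first exact: Cs_conn.
  by apply/set0Pn; exists x; rewrite inE xDm.
have [qV qO] := Cs_sub DmC qDm.
by apply: contraT => qD; case/negP: qO; apply: (bdD p q).
Qed.

(** The counterpart of the fact that nonadjacent vertices of a potential maximal clique see a common
    component. If there is none, [grow] releases a part around [x], anchored in a component seen by
    [y], or a part around [y], anchored at [c]. A boundary vertex that misses the anchor is mixed on
    the side of the anchor, hence complete to the released part by [mixed_once]. *)
Let share x y : x \in Om -> y \in Om -> x != y -> ~~ e x y ->
  exists2 D, D \in Ds x & D \in Ds y.
Proof.
move=> xO yO ne nxy; have [/existsP[D /andP[]]|no] := boolP [exists D, (D \in Ds x) && (D \in Ds y)].
  by exists D.
exfalso; have {}no D : D \in Ds x -> D \in Ds y -> False.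
  by move=> Dx Dy; case/negP: no; apply/existsP; exists D; rewrite Dx.
have xV := subsetP sOV _ xO; have yV := subsetP sOV _ yO.
(* [Wy] is connected and does not touch [x], so the component [C1] of [x] beyond N[Wy] is the
   opposite side. *)
pose Wy := y |: \bigcup_(D in Ds y) D.
have WyP z : z \in Wy -> z = y \/ exists2 D, D \in Ds y & z \in D.
  by case/setU1P=> [->|/bigcupP[D Dy zD]]; [left | right; exists D].
have yWy : y \in Wy by rewrite setU11.
have DWy D : D \in Ds y -> D \subset Wy by move=> Dy; apply: subset_trans (bigcup_sup _ Dy) (subsetUr _ _).
have sWy : Wy \subset V.
  by apply/subsetP => z /WyP[->//|[D /DsP[DC _] zD]]; case: (Cs_sub DC zD).
have cWy : conn Wy.
  suff -> : Wy = component Wy y by apply: conn_comp.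
  apply/eqP; rewrite eqEsubset comp_sub andbT; apply/subsetP => z.
  case/WyP=> [->|[D Dy zD]]; first exact: comp_self.
  have /DsP[DC [d dD yd]] := Dy; have dW := subsetP (DWy _ Dy) _ dD.
  have dCy : d \in component Wy y by apply: comp_closed (comp_self e yWy) dW yd.
  rewrite -(comp_mem esym dCy); apply: (subsetP (comp_conn_sub (Cs_conn DC) (DWy _ Dy) dD)).
  exact: zD.
have bdW z : z \in V -> z \notin Wy -> z \in nb Wy -> z \in Om.
  move=> zV zW /nbP[zW'|[w wW zw]]; first by rewrite zW' in zW.
  case/WyP: wW zw => [->|[D Dy wD]] zw.
    apply: contraT => zO; case/negP: zW; apply: (subsetP (DWy (Dm z) _)).
      apply/DsP; split; first exact: Cs_mem.
      by exists z; [apply: comp_self; rewrite in_setD zO | rewrite esym].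
    by apply: comp_self; rewrite in_setD zO.
  have /DsP[DC _] := Dy; apply: (Cs_bd DC wD zV); first by rewrite esym.
  by apply: contra zW; apply: (subsetP (DWy _ Dy)).
have xW : x \notin nb Wy.
  apply/nbP => -[/WyP[xy|[D /DsP[DC _] xD]]|[w /WyP[->|[D Dy wD]] xw]].
  - by rewrite xy eqxx in ne.
  - by have [_] := Cs_sub DC xD; rewrite xO.
  - by rewrite xw in nxy.
  - have /DsP[DC _] := Dy; apply: (no D) => //; apply/DsP; split=> //.
    by exists w.
pose C1 := component (V :\: nb Wy) x.
have xC1 : x \in C1 by apply: comp_self; rewrite in_setD xW.
have C1W z : z \in C1 -> z \in V /\ z \notin nb Wy.
  by move=> /(subsetP (comp_sub e _ _)); rewrite in_setD => /andP[].
have C1Wt : ~~ touch Wy C1.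
  rewrite nb_sym //; apply/existsP => -[z /andP[/C1W[_ zW]]].
  by rewrite (negPf zW).
have bdC1 z u : z \in C1 -> u \in V -> e z u -> u \notin C1 -> u \in nb Wy /\ u \in Om.
  move=> zC uV zu uC; have uW : u \in nb Wy.
    by apply: contraNT uC => uW; apply: comp_closed zC _ zu; rewrite in_setD uW.
  split=> //; apply: bdW => //; apply: contraTN zu => uW'.
  by rewrite esym; have /touchPn/(_ u z uW' zC)/andP[] := C1Wt.
(* The side to be released is the one that does not contain [c]. *)
have [cC1|cC1] := boolP (c \in C1); last first.
- have C1M : C1 \subset M.
    apply/subsetP => z zC; have [zV _] := C1W _ zC; apply: contraT => zM.
    have zc : z != c by apply: contraNneq cC1 => <-.
    have [cz _] := ScP zV zM zc.
    by have [|_] := bdC1 z c zC cV _ cC1; rewrite ?(negPf cO) // esym.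
  apply: (@grow C1 x) => //; first exact: conn_comp; last first.
    by move=> z u zC uV zu uC; case: (bdC1 z u).
  have [D' D'y] := Ds_neq0 yO; have /DsP[D'C _] := D'y; have [i iD' iI] := Cs_I D'C.
  have iW := subsetP (DWy _ D'y) _ iD'.
  apply: (goodI (c' := i)) => //.
  + apply: contraTneq yWy => EM; have [yM|yM] := boolP (y \in M).
      rewrite -EM in yM; have [_] := C1W _ yM.
      by apply: contra => yW; apply: (subsetP (nb_sub _ _)).
    have [|_ [m mM ym]] := ScP yV yM; first by apply: contraTneq yO => ->.
    rewrite -EM in mM; have [_] := C1W _ mM; apply: contra => yW.
    by apply/nbP; right; exists y; rewrite // esym.
  + have [D Dx] := Ds_neq0 xO; have /DsP[DC [d dD xd]] := Dx.
    have DnW : D \subset V :\: nb Wy.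
      apply/subsetP => z zD; have [zV zO] := Cs_sub DC zD; rewrite in_setD zV andbT.
      apply: contra zO => zW; apply: bdW => //.
      apply/negP => /WyP[zy|[D2 D2y zD2]].
        by have [_] := Cs_sub DC zD; rewrite zy yO.
      have /DsP[D2C _] := D2y; apply: (no D) => //.
      by rewrite (Cs_eq DC zD) -(Cs_eq D2C zD2).
    have dC1 : d \in C1 by apply: comp_closed xC1 (subsetP DnW _ dD) xd.
    have [j jD jI] := Cs_I DC; apply/set0Pn; exists j; rewrite inE jI andbT.
    rewrite /C1 -(comp_mem esym dC1).
    exact: (subsetP (comp_conn_sub (Cs_conn DC) DnW dD)).
  + exact: (subsetP sWy).
  + apply/nbP => -[iC|[z zC iz]].
      by have [_ /negP[]] := C1W _ iC; apply: (subsetP (nb_sub _ _)).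
    by have /touchPn/(_ i z iW zC) := C1Wt; rewrite iz andbF.
  move=> s sV /nbP[->//|[z zC sz]] sC1 is_ z' z'C; apply: contraT => sz'.
  have zs : e z s by rewrite esym.
  have [/nbP[sW|[w wW sw]] sO] := bdC1 z s zC sV zs sC1.
    by have /touchPn/(_ s z sW zC) := C1Wt; rewrite sz andbF.
  have si : ~~ e s i by rewrite esym.
  by case: (mixed_once cWy (@conn_comp _ _ esym _ _) C1Wt wW iW sw si zC z'C sz sz').
pose bd := [set z in V | (z \notin C1) && (z \in nb C1)].
have bdO z : z \in bd -> z \in Om.
  rewrite inE => /and3P[zV zC1 /nbP[zC|[u uC zu]]]; first by rewrite zC in zC1.
  by have [|_ //] := bdC1 u z uC zV _ zC1; rewrite esym.
pose D := component (V :\: bd) y.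
have C1nb z u : z \in C1 -> u \in V -> e z u -> u \in C1 \/ u \in bd.
  move=> zC uV zu; have [|uC] := boolP (u \in C1); [by left | right].
  by rewrite inE uV uC; apply/nbP; right; exists z; rewrite // esym.
have WyC1 z : z \in Wy -> z \notin C1 /\ z \notin nb C1.
  move=> zW; split; apply: contra C1Wt => zC; apply/existsP; exists z; rewrite zW //.
  exact: (subsetP (nb_sub _ _)).
have Wybd : Wy \subset V :\: bd.
  apply/subsetP => z zW; rewrite inS inE (subsetP sWy) // andbT /=.
  by have [_ zC] := WyC1 _ zW; move: zC; rewrite inE => /negPf->; rewrite andbF.
have yD : y \in D by apply: comp_self; apply: (subsetP Wybd).
have WyD : Wy \subset D by apply: comp_conn_sub.
have cD : conn D by apply: conn_comp.
have DV z : z \in D -> z \in V /\ z \notin bd.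
  by move=> /(subsetP (comp_sub e _ _)); rewrite in_setD => /andP[].
have DC1 z : z \in D -> z \notin C1.
  move=> zD; apply/negP => zC.
  have [+ _] := WyC1 _ yWy; move/negP; apply.
  suff /subsetP/(_ y yD) : D \subset C1 by [].
  apply: (conn_closed cD) => [|p q pD pC qD pq].
    by apply/set0Pn; exists z; rewrite inE zD.
  have [qV qbd] := DV _ qD; case: (C1nb p q pC qV pq) => // qbd'.
  by rewrite qbd' in qbd.
have cD' z : z \in D -> ~~ e c z.
  move=> zD; have [zV zbd] := DV _ zD; apply/negP => cz.
  by case: (C1nb c z cC1 zV cz) => [/(negP (DC1 _ zD))|/(negP zbd)].
have bdD z u : z \in D -> u \in V -> e z u -> u \notin D -> u \in bd.
  move=> zD uV zu; apply: contraNT => ubd; apply: comp_closed zD _ zu.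
  by rewrite in_setD ubd.
apply: (@grow D y) => //; last by move=> z u zD uV zu uD; apply/bdO/(bdD z).
apply: (goodI (c' := c)) => //.
- apply/subsetP => z zD; have [zV zbd] := DV _ zD; apply: contraT => zM.
  have [|cz _] := ScP zV zM; first by apply: contraTneq zD => ->; apply: contraL cC1 => /DC1.
  by have := cD' z zD; rewrite cz.
- apply: contraTneq cC1 => EM; have [xM|xM] := boolP (x \in M).
    by rewrite -EM in xM; have := DC1 _ xM; rewrite xC1.
  have [|_ [m mM xm]] := ScP xV xM; first by apply: contraTneq xO => ->.
  rewrite -EM in mM; have [mV mbd] := DV _ mM.
  by case: (C1nb x m xC1 mV xm) => [/(negP (DC1 _ mM))|/(negP mbd)].
- have [D' D'y] := Ds_neq0 yO; have /DsP[D'C _] := D'y; have [i iD' iI] := Cs_I D'C.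
  by apply/set0Pn; exists i; rewrite inE iI andbT (subsetP WyD) // (subsetP (DWy _ D'y)).
- apply/nbP => -[cD1|[z zD cz]]; first by have := DC1 _ cD1; rewrite cC1.
  by have := cD' z zD; rewrite cz.
move=> s sV /nbP[->//|[z zD sz]] sD cs z' z'D; apply: contraT => sz'.
have sbd : s \in bd by apply: (bdD z) => //; rewrite esym.
have [sC1 [u uC su]] : s \notin C1 /\ exists2 u, u \in C1 & e s u.
  move: sbd; rewrite inE => /and3P[_ sC1 /nbP[sC|[u uC su]]]; first by rewrite sC in sC1.
  by split=> //; exists u.
have tDC : ~~ touch D C1.
  apply/touchPn => p q pD qC; have [pV pbd] := DV _ pD; apply/andP; split.
    by apply: contraTneq qC => <-; apply: DC1.
  apply/negP => pq; have qp : e q p by rewrite esym.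
  by case: (C1nb q p qC pV qp) => [/(negP (DC1 _ pD))|/(negP pbd)].
have sc : ~~ e s c by rewrite esym.
by case: (mixed_once cD (@conn_comp _ _ esym _ _) tDC zD z'D sz sz' uC cC1 su sc).
Qed.

(** Components [D1] seen only by [x] and [D2] seen only by [y] would complete a [link5] over the
    shared component. *)
Let nested x y : x \in Om -> y \in Om -> ~~ e x y -> (exists2 D, D \in Ds x & D \in Ds y) ->
  (Ds x \subset Ds y) || (Ds y \subset Ds x).
Proof.
move=> xO yO xy [D /DsP[DC xD] /DsP[_ yD]]; apply: contraT; rewrite negb_or.
case/andP=> /subsetPn[D1 D1x D1y] /subsetPn[D2 D2y D2x].
have /DsP[D1C [b bD1 xb]] := D1x; have /DsP[D2C [b' b'D2 yb']] := D2y.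
have n1 : D1 != D by apply: contraNneq D1y => ->; apply/DsP.
have n2 : D2 != D by apply: contraNneq D2x => ->; apply/DsP.
have n12 : D1 != D2 by apply: contraNneq D1y => ->.
case: no5; apply: p5inS (subsetT _) (link5 esym (Cs_conn DC) xD yD xy _ _ _ _ _ _ _).
- by rewrite esym; apply: xb.
- by rewrite esym; apply: yb'.
- by move=> d dD; apply: Cs_nadj D1C DC n1 bD1 dD.
- by move=> d dD; apply: Cs_nadj D2C DC n2 b'D2 dD.
- by apply: contra D1y => by_; apply/DsP; split=> //; exists b; rewrite // esym.
- by apply: contra D2x => b'x; apply/DsP; split=> //; exists b'; rewrite // esym.
- exact: Cs_nadj D1C D2C n12 bD1 b'D2.
Qed.

Let one_mixed q D D' d : D \in Ds q -> D' \in Ds q -> D != D' -> d \in D -> ~~ e q d ->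
  forall d', d' \in D' -> e q d'.
Proof.
move=> /DsP[DC [x xD qx]] /DsP[D'C [x' x'D qx']] ne dD qd.
exact: mixed_complete (Cs_conn DC) (Cs_conn D'C) (Cs_dis DC D'C ne) xD dD qx qd x'D qx'.
Qed.

(** Choose [x] in the separator seeing as few components as possible: every other separator vertex
    then sees [x] or all components that [x] sees. At most three vertices of suitable components
    together with [x] dominate the separator. These components are listed in [Bs]; every other one
    is a component of [M] minus the barrier. *)
Lemma split_minimal : exists x ds (Bs : seq {set T}), [/\ size ds <= 3, size Bs <= 3,
  forall B, B \in Bs -> conn B /\ goodb B,
  forall B B', B \in Bs -> B' \in Bs -> B != B' -> ~~ touch B B' &
  forall v, v \in I -> v \in M -> (exists2 B, B \in Bs & v \in B) \/
    (goodb (component (M :\: barrier V x ds) v) /\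
     forall B, B \in Bs -> ~~ touch (component (M :\: barrier V x ds) v) B)].
Proof.
have [x0 x0O] : exists x, x \in Om.
  have [i] := set0Pn _ MI; rewrite inE => /andP[iM iI].
  have iO : i \notin Om by apply/negP => /OI; apply.
  have iV := subsetP sMV _ iM; have DC := Cs_mem iV iO.
  have [sD nD /set0Pn[j]] := goodP (DmG iM iO); rewrite inE => /andP[jD _] _.
  have [|y [z [yD zM zD yz]]] := cM sD _ nD; first by apply/set0Pn; exists j.
  by exists z; apply: Cs_bd DC yD (subsetP sMV _ zM) yz zD.
case: (arg_minnP (fun x => #|Ds x|) x0O) => x xO0 minx.
have {xO0} xO : x \in Om := xO0.
have Dsx y : y \in Om -> Ds y \subset Ds x -> Ds y = Ds x.
  by move=> yO sy; apply/eqP; rewrite eqEcard sy; apply: minx.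
have nadj y : y \in Om -> y != x -> ~~ e x y -> Ds x \subset Ds y.
  move=> yO ne xy; rewrite eq_sym in ne; have sh := share xO yO ne xy.
  by case/orP: (nested xO yO xy sh) => // /(Dsx y yO) ->.
have nbsP ds y : reflect (y = x \/ e y x \/ exists2 d, d \in ds & (y == d) || e y d)
    (y \in nbs (x :: ds)).
  rewrite !inE /=; apply: (iffP idP).
    case/orP=> [/orP[/eqP|yd]|/orP[|/hasP[d dd yd]]]; [by left | right; right | by right; left |].
      by exists y; rewrite ?eqxx.
    by right; right; exists d; rewrite // yd orbT.
  case=> [->|[->|[d dd /orP[/eqP->|yd]]]]; rewrite ?eqxx ?dd ?orbT //=.
  by apply/orP; right; apply/orP; right; apply/hasP; exists d.
suff [ds [Bs0 [s3 s3' BC OK HB]]] : exists ds (Bs : seq {set T}), [/\ size ds <= 3, size Bs <= 3,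
    {subset Bs <= Cs}, Om \subset nbs (x :: ds) &
    forall D, D \in Cs -> D \notin Bs ->
      (forall y, y \in D -> y \notin barrier V x ds) /\
      (forall y z, z \in D -> y \in Om -> e y z -> y \in barrier V x ds)].
  exists x, ds, [seq B <- Bs0 | B != [set c]]; split=> //.
  - by apply: leq_trans s3'; rewrite size_filter count_size.
  - move=> B; rewrite mem_filter => /andP[Bc /BC BC']; split; last exact: CsM.
    exact: Cs_conn.
  - move=> B B'; rewrite !mem_filter => /andP[_ /BC BC1] /andP[_ /BC BC2].
    exact: Cs_dis.
  move=> v vI vM; have vO : v \notin Om by apply/negP => /OI; apply.
  have vV := subsetP sMV _ vM; have DC := Cs_mem vV vO.
  have vD : v \in Dm v by apply: comp_self; rewrite in_setD vO.
  have Dc : Dm v != [set c].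
    by apply: contraTneq vM => ED; move: vD; rewrite ED => /set1P->; case: cnM.
  have [DB|DB] := boolP (Dm v \in Bs0).
    by left; exists (Dm v); rewrite ?mem_filter ?Dc.
  right; have [nbar bar] := HB _ DC DB; have gD := CsM DC Dc; have [sDM _ _ _] := goodP gD.
  have -> : component (M :\: barrier V x ds) v = Dm v.
    apply: comp_eq => //; first exact: Cs_conn.
      by apply/subsetP => y yD; rewrite in_setD nbar // (subsetP sDM).
    move=> y z yD; rewrite in_setD => /andP[zb zM] yz; apply: contraT => zD.
    case/negP: zb; apply: (bar z y) => //; last by rewrite esym.
    exact: Cs_bd DC yD (subsetP sMV _ zM) yz zD.
  split=> // B; rewrite mem_filter => /andP[_ BB]; apply: Cs_dis => //; first exact: BC.
  by apply: contraNneq DB => ->.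
have farD ds D : Om \subset nbs (x :: ds) -> D \in Cs -> D \notin Ds x ->
    (forall d, d \in ds -> exists2 D', D' \in Cs & (D' != D) && (d \in D')) ->
    (forall y, y \in D -> y \notin nbs (x :: ds)).
  move=> OK DC Dx Hd y yD; have [yV yO] := Cs_sub DC yD.
  apply/nbsP => -[yx|[yx|[d /Hd[D' D'C /andP[ne dD']] yd]]].
  - by rewrite yx xO in yO.
  - by case/negP: Dx; apply/DsP; split=> //; exists y; rewrite // esym.
  - have /touchPn/(_ d y dD' yD) := Cs_dis D'C DC ne.
    by rewrite (eq_sym d) (esym d) -negb_or yd.
have farok ds D : Om \subset nbs (x :: ds) -> D \in Cs ->
    (forall y, y \in D -> y \notin nbs (x :: ds)) ->
      (forall y, y \in D -> y \notin barrier V x ds) /\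
      (forall y z, z \in D -> y \in Om -> e y z -> y \in barrier V x ds).
  move=> OK DC Dn; split=> [y yD|y z zD yO yz].
    rewrite inE (negPf (Dn y yD)) andbF orbF -leqNgt; apply: leq_trans (leqnSn 0).
    rewrite leqn0 -leqn0 leqNgt -has_count; apply: contra (Dn y yD) => /hasP[d dd yd].
    by apply/nbsP; right; right; exists d; rewrite // yd orbT.
  rewrite inE (subsetP sOV) // (subsetP OK) //=; apply/orP; right; apply/existsP; exists z.
  by have [zV _] := Cs_sub DC zD; rewrite zV Dn.
have [D1 D1x] := Ds_neq0 xO; have /DsP[D1C _] := D1x.
have [d1 d1D d1I] := Cs_I D1C.
have [D2n|D2n] := boolP [exists D, (D \in Ds x) && (D != D1)]; last first.
  have Dx1 D : D \in Ds x -> D = D1.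
    by move=> Dx; apply/eqP; apply: contraT => ne; case/negP: D2n; apply/existsP; exists D; rewrite Dx.
  have [E1|n1] := eqVneq D1 [set c].
    have OK : Om \subset nbs [:: x; c].
      apply/subsetP => y yO; apply/nbsP; have [->|ne] := eqVneq y x; [by left | right].
      have [xy|xy] := boolP (e x y); [by left; rewrite esym | right].
      have /subsetP/(_ D1 D1x)/DsP[_ [z]] := nadj y yO ne xy.
      by rewrite E1 => /set1P-> yc; exists c; rewrite ?inE // yc orbT.
    exists [:: c], [:: D1]; split=> //; first by move=> B; rewrite inE => /eqP->.
    move=> D DC; rewrite inE => ne; apply: farok => //; apply: farD => //.
      by apply: contra ne => /Dx1/eqP.
    by move=> d; rewrite inE => /eqP->; exists D1 => //; rewrite eq_sym ne E1 inE eqxx.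
  (* With only one component in view, its anchor [c'] takes over: a separator vertex that sees [D1]
     but not [c'] is complete to [D1], so it sees [d1]. *)
  have [_ _ _ [c' c'V [c'I c'D Hc']]] := goodP (CsM D1C n1).
  have c'O : c' \notin Om by apply/negP => /OI; apply.
  have c'C := Cs_mem c'V c'O.
  have c'Dm : c' \in Dm c' by apply: comp_self; rewrite in_setD c'O.
  have OK : Om \subset nbs [:: x; d1; c'].
    apply/subsetP => y yO; apply/nbsP; have [->|ne] := eqVneq y x; [by left | right].
    have [xy|xy] := boolP (e x y); [by left; rewrite esym | right].
    have /subsetP/(_ D1 D1x)/DsP[_ [z zD yz]] := nadj y yO ne xy.
    have [c'y|c'y] := boolP (e c' y); first by exists c'; rewrite ?inE ?eqxx ?orbT // esym c'y orbT.
    exists d1; rewrite ?inE ?eqxx // Hc' ?orbT //.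
      by apply/negP => yD; have [_] := Cs_sub D1C yD; rewrite yO.
    by apply/nbP; right; exists z.
  exists [:: d1; c'], [:: D1; Dm c']; split=> //.
    by move=> B; rewrite !inE => /orP[] /eqP->.
  move=> D DC; rewrite !inE negb_or => /andP[ne ne']; apply: farok => //; apply: farD => //.
    by apply: contra ne => /Dx1/eqP.
  move=> d; rewrite !inE => /orP[] /eqP->; first by exists D1 => //; rewrite eq_sym ne.
  by exists (Dm c') => //; rewrite eq_sym ne'.
(* [x] is mixed on at most one of the components that it sees; if there is one, it becomes [D1]. *)
have {D1 D1x D1C d1 d1D d1I D2n} [D1 [D2 [D1x D2x n12 compl]]] : exists D1 D2,
    [/\ D1 \in Ds x, D2 \in Ds x, D1 != D2 &
      forall D y, D \in Ds x -> D != D1 -> y \in D -> e x y].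
  have [/existsP[D /andP[Dx /existsP[z /andP[zD xz]]]]|no] :=
      boolP [exists D, (D \in Ds x) && [exists z, (z \in D) && ~~ e x z]].
    have [D2 D2x n2] : exists2 D2, D2 \in Ds x & D != D2.
      have [E|n] := eqVneq D D1; last by exists D1.
      by case/existsP: D2n => D2 /andP[D2x n2]; exists D2; rewrite // E eq_sym.
    exists D, D2; split=> // D' y D'x n yD'; rewrite eq_sym in n.
    exact: one_mixed Dx D'x n zD xz y yD'.
  case/existsP: D2n => D2 /andP[D2x n2]; exists D1, D2; rewrite eq_sym n2; split=> // D y Dx _ yD.
  apply: contraT => xy; case/negP: no; apply/existsP; exists D; rewrite Dx.
  by apply/existsP; exists y; rewrite yD.
have /DsP[D1C _] := D1x; have /DsP[D2C _] := D2x.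
have [d1 d1D d1I] := Cs_I D1C; have [d2 d2D d2I] := Cs_I D2C.
have two D D' d d' y : D \in Ds y -> D' \in Ds y -> D != D' -> d \in D -> d' \in D' ->
    e y d || e y d'.
  move=> Dy D'y ne dD d'D; apply: contraT; rewrite negb_or => /andP[yd yd'].
  by have := one_mixed Dy D'y ne dD yd d'D; rewrite (negPf yd').
have OK ds : d1 \in ds -> d2 \in ds -> Om \subset nbs (x :: ds).
  move=> d1s d2s; apply/subsetP => y yO; apply/nbsP.
  have [->|ne] := eqVneq y x; [by left | right].
  have [xy|xy] := boolP (e x y); [by left; rewrite esym | right].
  have /subsetP sD := nadj y yO ne xy.
  case/orP: (two _ _ _ _ _ (sD _ D1x) (sD _ D2x) n12 d1D d2D) => [yd|yd].
    by exists d1; rewrite // yd orbT.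
  by exists d2; rewrite // yd orbT.
have [/existsP[D3 /and3P[D3x n31 n32]]|no3] :=
    boolP [exists D, [&& D \in Ds x, D != D1 & D != D2]]; last first.
  have OK2 : Om \subset nbs [:: x; d1; d2] by apply: OK; rewrite !inE eqxx ?orbT.
  exists [:: d1; d2], [:: D1; D2]; split=> //.
    by move=> B; rewrite !inE => /orP[] /eqP->.
  move=> D DC; rewrite !inE negb_or => /andP[ne ne']; apply: farok => //; apply: farD => //.
    by apply: contra no3 => Dx; apply/existsP; exists D; rewrite Dx ne.
  move=> d; rewrite !inE => /orP[] /eqP->; first by exists D1 => //; rewrite eq_sym ne.
  by exists D2 => //; rewrite eq_sym ne'.
have /DsP[D3C _] := D3x; have [d3 d3D d3I] := Cs_I D3C.
have OK3 : Om \subset nbs [:: x; d1; d2; d3] by apply: OK; rewrite !inE eqxx ?orbT.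
exists [:: d1; d2; d3], [:: D1; D2; D3]; split=> //.
  by move=> B; rewrite !inE => /or3P[] /eqP->.
move=> D DC; rewrite !inE !negb_or => /and3P[ne1 ne2 ne3].
have dD D'' : D'' \in Cs -> D'' \notin [:: D1; D2; D3] ->
    forall d, d \in [:: d1; d2; d3] -> exists2 D', D' \in Cs & (D' != D'') && (d \in D').
  move=> DC''; rewrite !inE !negb_or => /and3P[m1 m2 m3] d; rewrite !inE => /or3P[] /eqP->.
  - by exists D1; rewrite // eq_sym m1.
  - by exists D2; rewrite // eq_sym m2.
  - by exists D3; rewrite // eq_sym m3.
have notB : D \notin [:: D1; D2; D3] by rewrite !inE !negb_or ne1 ne2.
have [Dx|Dx] := boolP (D \in Ds x); last first.
  by apply: farok => //; apply: farD => //; apply: dD.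
have xD y : y \in D -> e x y by apply: compl.
split=> [y yD|y z zD yO yz].
  have [yV yO'] := Cs_sub DC yD; rewrite inE negb_or; apply/andP; split.
    rewrite -leqNgt; apply: leq_trans (leqnSn 0); rewrite leqNgt -has_count.
    apply/hasP => -[d /(dD D DC notB)[D' D'C /andP[n dD']] yd].
    by have := Cs_nadj D'C DC n dD' yD; rewrite esym yd.
  apply/negP => /and3P[_ _ /existsP[z /and3P[zV zn yz]]]; case/negP: zn.
  have [zD|zD] := boolP (z \in D).
    by apply/nbsP; right; left; rewrite esym xD.
  by apply: (subsetP OK3); apply: Cs_bd DC yD zV yz zD.
(* A vertex [y] that sees the same components as [x] is mixed on at most one of [D1], [D2], [D3], so
   it has two neighbours in [ds]. Any other [y] sees a component that is invisible to [x] and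
   [ds]. *)
have [sy|/subsetPn[D'' D''y D''x]] := boolP (Ds y \subset Ds x).
  have E := Dsx y yO sy; rewrite inE; apply/orP; left; rewrite /= addn0.
  rewrite -E in D1x D2x D3x; rewrite eq_sym in n31; rewrite eq_sym in n32.
  have := two _ _ _ _ _ D1x D2x n12 d1D d2D; have := two _ _ _ _ _ D1x D3x n31 d1D d3D.
  have := two _ _ _ _ _ D2x D3x n32 d2D d3D.
  by case: (e y d1); case: (e y d2); case: (e y d3).
have /DsP[D''C [u uD'' yu]] := D''y.
rewrite inE (subsetP sOV) // (subsetP OK3) //=; apply/orP; right; apply/existsP; exists u.
have [uV _] := Cs_sub D''C uD''; rewrite uV yu andbT /=.
apply: (farD _ D'') => //; apply: dD => //.
by apply: contra D''x; rewrite !in_cons in_nil orbF => /or3P[] /eqP->.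
Qed.

End Minimal.

Lemma split_piece : exists x ds (Bs : seq {set T}), [/\ size ds <= 3, size Bs <= 3,
  forall B, B \in Bs -> conn B /\ goodb B,
  forall B B', B \in Bs -> B' \in Bs -> B != B' -> ~~ touch B B' &
  forall v, v \in I -> v \in M -> (exists2 B, B \in Bs & v \in B) \/
    (goodb (component (M :\: barrier V x ds) v) /\
     forall B, B \in Bs -> ~~ touch (component (M :\: barrier V x ds) v) B)].
Proof.
case: (arg_minnP (fun Om : {set T} => #|Om|) adm0) => Om admOm minOm.
exact: split_minimal admOm minOm.
Qed.

End Separation.

(** * Maximum weight independent sets in P5-free graphs *)

Fixpoint seqs (A : Type) n (l : seq A) : seq (seq A) :=
  if n is m.+1 then [::] :: flatten [seq [seq x :: s | s <- seqs m l] | x <- l] else [:: [::]].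

Lemma mem_seqs (A : eqType) n (l s : seq A) :
  (s \in seqs n l) = (size s <= n) && all (mem l) s.
Proof.
elim: n s => [|n IH] [|x s] //=; rewrite inE /=.
apply/flatten_mapP/and3P => [[y yl /mapP[s' s's [-> ->]]]|[sz xl sl]].
  by move: s's; rewrite IH => /andP[? ?]; split.
by exists x => //; apply/mapP; exists s; rewrite // IH -ltnS sz.
Qed.

Arguments seqs : simpl never.

Section Weights.
Variables (T : finType) (w : T -> nat).
Implicit Types S U : {set T}.

Definition wt S := \sum_(v in S) w v.

Lemma wt_set0 : wt set0 = 0. Proof. exact: big_set0. Qed.

Lemma wtS S U : S \subset U -> wt S <= wt U.
Proof.
by move=> sSU; rewrite /wt [X in _ <= X](big_setID S) /= (setIidPr sSU) leq_addr.
Qed.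

Definition best (l : seq {set T}) :=
  foldl (fun S S' => if wt S <= wt S' then S' else S) set0 l.

Lemma best_ind (P : {set T} -> Prop) l : P set0 -> (forall S, S \in l -> P S) -> P (best l).
Proof.
rewrite /best; elim: l set0 => //= S l IH S0 P0 Pl; apply: IH => [|S' S'l].
  by case: ifP => // _; apply: Pl; rewrite mem_head.
by apply: Pl; rewrite inE S'l orbT.
Qed.

Lemma best_max l S : S \in l -> wt S <= wt (best l).
Proof.
rewrite /best; suff H S0 : wt S0 <= wt (foldl (fun S S' => if wt S <= wt S' then S' else S) S0 l)
    /\ (S \in l -> wt S <= wt (foldl (fun S S' => if wt S <= wt S' then S' else S) S0 l)).
  by case: (H set0).
elim: l S0 => //= S1 l IH S0; have [IH1 IH2] := IH (if wt S0 <= wt S1 then S1 else S0).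
split=> [|]; first by apply: leq_trans IH1; case: (leqP (wt S0) (wt S1)).
rewrite inE => /orP[/eqP->|/IH2 //]; apply: leq_trans IH1.
by case: (leqP (wt S0) (wt S1)) => // /ltnW.
Qed.

Lemma wt_bigcup_le (K : finType) (P : {set K}) (F : K -> {set T}) :
  wt (\bigcup_(i in P) F i) <= \sum_(i in P) wt (F i).
Proof.
rewrite /wt (exchange_big_dep xpredT) //= big_mkcond; apply: leq_sum => v _.
case: ifP => // /bigcupP[i iP vF]; rewrite (bigD1 i) ?iP //=.
exact: leq_addr.
Qed.

Lemma wt_bigcup_disjoint (K : finType) (P : {set K}) (F : K -> {set T}) U :
  (forall i j, i \in P -> j \in P -> i != j -> [disjoint F i & F j]) ->
  (forall i, i \in P -> F i \subset U) -> \sum_(i in P) wt (F i) <= wt U.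
Proof.
move=> dF sF; rewrite /wt (exchange_big_dep xpredT) //= [X in _ <= X]big_mkcond.
apply: leq_sum => v _; have [/existsP[i /andP[iP vF]]|no] := boolP [exists i, (i \in P) && (v \in F i)].
  rewrite (subsetP (sF i iP)) // (big_pred1 i) // => j /=; apply/andP/eqP => [[jP vFj]|->//].
  apply/eqP; apply: contraT => ne; have := dF j i jP iP ne.
  by rewrite disjoint_subset => /subsetP/(_ v vFj); rewrite inE vF.
by rewrite big_pred0 // => i; apply: contraNF no => Hi; apply/existsP; exists i.
Qed.

Lemma wt_disjointU S U : [disjoint S & U] -> wt (S :|: U) = wt S + wt U.
Proof. by move=> dSU; rewrite /wt (eq_bigl [predU S & U]) ?bigU // => v; rewrite !inE. Qed.

(** Turns comparisons on pieces into a global one: [f] gives the solution found in each piece, and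
    disjointness of the pieces lets these weights add up inside [U]. *)
Lemma wt_family (P : {set {set T}}) (f : {set T} -> {set T}) (I U : {set T}) : trivIset P ->
  (forall B, B \in P -> [/\ f B \subset B, f B \subset U & wt (I :&: B) <= wt (f B)]) ->
  wt (I :&: cover P) <= wt U.
Proof.
move=> tP Hf; rewrite /cover big_distrr /=.
apply: leq_trans (wt_bigcup_le _ _) _; apply: (@leq_trans (\sum_(B in P) wt (f B))).
  by apply: leq_sum => B /Hf[].
apply: wt_bigcup_disjoint => [A B AP BP ne|B /Hf[] //].
have [sA _ _] := Hf _ AP; have [sB _ _] := Hf _ BP.
by apply: disjointWl sA _; apply: disjointWr sB _; apply: (trivIsetP tP).
Qed.

End Weights.

Lemma untouch_disjoint (T : finType) (e : rel T) (A B : {set T}) : ~~ touch e A B -> [disjoint A & B].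
Proof.
move=> /touchPn nt; rewrite -setI_eq0; apply/eqP/setP => x; rewrite !inE.
by apply/negP => /andP[xA xB]; have := nt x x xA xB; rewrite eqxx.
Qed.

Section MWIS.
Variables (T : finType) (e : rel T) (w : T -> nat).
Implicit Types (A B C M S W : {set T}).
Notation entry := (T * {set T} * {set T})%type.
Notation part := ({set T} * {set T})%type.
Implicit Types (tab : seq entry).

(** Closing a pair under mixed vertices that miss [c] yields a set attached to [c] by construction.
    Three vertices describe a hull, so there are at most n^3 of them to tabulate. *)
Definition hullF c x y S := [set z | [|| z == x, z == y |
  [&& z != c, ~~ e c z, [exists u, (u \in S) && e z u] & [exists u, (u \in S) && ~~ e z u]]]].
Definition hull c x y := fixset (hullF c x y).

Definition keys := [seq (t.1.1, hull t.1.1 t.1.2 t.2) |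
  t <- [seq (p, y) | p <- [seq (c, x) | c <- enum T, x <- enum T], y <- enum T]].
Definition tab0 : seq entry := [seq (k, set0) | k <- keys].

Definition tabval tab B := best w ([seq p.2 | p : entry <- tab & p.1.2 \subset B] ++
  [seq [set v] | v <- enum T & v \in B]).

Definition parts tab : seq part :=
  [seq ([set v], [set v]) | v <- enum T] ++ [seq (p.1.2, p.2) | p <- tab].

Definition okparts M (ps : seq part) := all (fun p : part => (p.1 \subset M) &&
  all (fun q : part => (p == q) || ~~ touch e p.1 q.1) ps) ps.

(** The parts stand for the components listed in [Bs], the table supplies the components of [W].
    Skipping components that touch a part keeps the union independent for every choice of [ps], even
    a useless one. *)
Definition combine tab W (ps : seq part) := [set v | has (fun p : part => v \in p.2) ps ||
  [exists u, [&& u \in W, ~~ has (fun p : part => touch e (component e W u) p.1) ps &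
    v \in tabval tab (component e W u)]]].

Definition candidates tab c M := [seq combine tab (M :\: barrier e (ext e c M) q.1.1 q.1.2) q.2 |
  q <- [seq (xd, ps) | xd <- [seq (x, ds) | x <- enum T, ds <- seqs 3 (enum T)],
                       ps <- seqs 3 (parts tab)] & okparts M q.2].

Definition tab_step tab : seq entry :=
  [seq (p.1, best w (candidates tab p.1.1 p.1.2)) | p <- tab].

Definition apart c := [set v | v \notin nb e [set c]].

(** [c] is a guessed solution vertex; components of its nonneighbourhood are attached to it, since
    all their outside neighbours see [c]. After t rounds the hulls of size at most t are settled, so
    [#|T|] rounds are enough. *)
Definition mwis := let tab := iter #|T| tab_step tab0 in
  best w [seq [set v | (v == c) || [exists u, (u \in apart c) &&
    (v \in tabval tab (component e (apart c) u))]] | c <- enum T].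

Definition indep S := forall x y, x \in S -> y \in S -> ~~ e x y.

Hypotheses (esym : symmetric e) (eirr : irreflexive e).

Lemma indep0 : indep set0. Proof. by move=> x y; rewrite inE. Qed.
Lemma indep1 v : indep [set v]. Proof. by move=> x y /set1P-> /set1P->; rewrite eirr. Qed.

Definition sound tab := forall p, p \in tab -> p.2 \subset p.1.2 /\ indep p.2.

Lemma val_sound tab B : sound tab -> tabval tab B \subset B /\ indep (tabval tab B).
Proof.
move=> snd; rewrite /tabval.
apply: (@best_ind _ w (fun S => S \subset B /\ indep S)); first by rewrite sub0set; split=> //; apply: indep0.
move=> S; rewrite mem_cat => /orP[] /mapP[p + ->]; rewrite mem_filter => /andP[sB pt].
  by have [s1 s2] := snd _ pt; split=> //; apply: subset_trans s1 sB.
by rewrite sub1set; split=> //; apply: indep1.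
Qed.

Lemma parts_sound tab p : sound tab -> p \in parts tab -> p.2 \subset p.1 /\ indep p.2.
Proof.
move=> snd; rewrite mem_cat => /orP[] /mapP[q qt ->] /=; last exact: snd.
by split=> //; apply: indep1.
Qed.

Lemma combine_sound tab M W ps : sound tab -> {subset ps <= parts tab} -> okparts M ps ->
  W \subset M -> combine tab W ps \subset M /\ indep (combine tab W ps).
Proof.
move=> snd sps /allP ok sW.
have cP v : v \in combine tab W ps -> (exists2 p, p \in ps & v \in p.2) \/
    exists u, [/\ u \in W, forall p, p \in ps -> ~~ touch e (component e W u) p.1 &
      v \in tabval tab (component e W u)].
  rewrite inE => /orP[/hasP[p pp vp]|/existsP[u /and3P[uW /hasPn nt vu]]].
    by left; exists p.
  by right; exists u.
have vs u := @val_sound tab (component e W u) snd.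
have ps1 p : p \in ps -> p.2 \subset p.1 /\ indep p.2.
  by move=> pp; apply: parts_sound (sps _ pp).
split.
  apply/subsetP => v /cP[[p pp vp]|[u [uW _ vu]]].
    have [s12 _] := ps1 _ pp; have /andP[sM _] := ok _ pp.
    by apply: (subsetP sM); apply: (subsetP s12).
  apply: (subsetP sW); apply: (subsetP (comp_sub e W u)).
  by have [s _] := vs u; apply: (subsetP s).
have mixed u p x y : u \in W -> p \in ps -> ~~ touch e (component e W u) p.1 ->
    x \in tabval tab (component e W u) -> y \in p.2 -> ~~ e x y.
  move=> uW pp nt xu yp; have [s _] := vs u; have [s' _] := ps1 _ pp.
  by have /touchPn/(_ x y (subsetP s _ xu) (subsetP s' _ yp))/andP[] := nt.
move=> x y /cP[[p pp xp]|[u [uW nt xu]]] /cP[[q qp yq]|[u' [u'W nt' yu]]].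
- have [E|ne] := eqVneq p q; first by rewrite -E in yq; apply: (proj2 (ps1 _ pp)).
  have /andP[_ /allP/(_ q qp)] := ok _ pp; rewrite (negPf ne) /= => nt.
  have [s _] := ps1 _ pp; have [s' _] := ps1 _ qp.
  by have /touchPn/(_ x y (subsetP s _ xp) (subsetP s' _ yq))/andP[] := nt.
- by rewrite esym; apply: mixed u'W pp (nt' _ pp) yu xp.
- exact: mixed uW qp (nt _ qp) xu yq.
have [E|ne] := eqVneq (component e W u) (component e W u').
  by have [_ iv] := vs u'; apply: iv => //; rewrite -E.
have [s _] := vs u; have [s' _] := vs u'.
by have /touchPn/(_ x y (subsetP s _ xu) (subsetP s' _ yu))/andP[] := comp_untouch esym ne.
Qed.

Lemma step_sound tab : sound tab -> sound (tab_step tab).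
Proof.
move=> snd _ /mapP[p pt ->] /=.
apply: (@best_ind _ w (fun S => S \subset p.1.2 /\ indep S)); first by rewrite sub0set; split=> //; apply: indep0.
move=> S /mapP[q + ->]; rewrite mem_filter => /andP[ok /allpairsP[[xd ps] /= [_ + Eq]]].
rewrite Eq /= in ok *; rewrite mem_seqs => /andP[_ /allP sps].
by apply: combine_sound => //; apply: subsetDl.
Qed.

Lemma tab_sound n : sound (iter n tab_step tab0).
Proof.
elim: n => [|n IH] /=; last exact: step_sound.
by move=> _ /mapP[k _ ->] /=; rewrite sub0set; split=> //; apply: indep0.
Qed.

Lemma mwis_indep : indep mwis.
Proof.
apply: (@best_ind _ w indep); first exact: indep0.
move=> S /mapP[c _ ->]; set tab := iter _ _ _.
have vs B := @val_sound tab B (@tab_sound #|T|).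
have capart x : x \in apart c -> ~~ e c x.
  by rewrite inE => /notin_nb[_ /(_ c)]; rewrite inE esym; apply.
have sub x u : u \in apart c -> x \in tabval tab (component e (apart c) u) ->
    x \in component e (apart c) u /\ ~~ e c x.
  move=> uW xu; have [s _] := vs (component e (apart c) u).
  have xC := subsetP s _ xu; split=> //; apply: capart.
  exact: (subsetP (comp_sub e _ _) _ xC).
move=> x y; rewrite !inE => /orP[/eqP->|/existsP[u /andP[uW xu]]]
  /orP[/eqP->|/existsP[u' /andP[u'W yu]]]; first by rewrite eirr.
- by case: (sub _ _ u'W yu).
- by rewrite esym; case: (sub _ _ uW xu).
have [xC _] := sub _ _ uW xu; have [yC _] := sub _ _ u'W yu.
have [E|ne] := eqVneq (component e (apart c) u) (component e (apart c) u').
  by have [_ iv] := vs (component e (apart c) u'); apply: iv => //; rewrite -E.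
by have /touchPn/(_ x y xC yC)/andP[] := comp_untouch esym ne.
Qed.

Section Hull.
Variables c x y : T.

Lemma hullF_mono : {homo hullF c x y : A B / A \subset B}.
Proof.
move=> A B /subsetP sAB; apply/subsetP => z; rewrite !inE => /or3P[->|->|]; rewrite ?orbT //.
case/and4P=> -> -> /existsP[u /andP[/sAB uB zu]] /existsP[v /andP[/sAB vB zv]].
rewrite /=; apply/or3P; apply: Or33; apply/andP.
by split; apply/existsP; [exists u; rewrite uB | exists v; rewrite vB].
Qed.

Lemma mem_hull z : (z \in hull c x y) = [|| z == x, z == y | [&& z != c, ~~ e c z,
  [exists u, (u \in hull c x y) && e z u] & [exists u, (u \in hull c x y) && ~~ e z u]]].
Proof. by rewrite {1}/hull -fixsetK ?inE //; apply: hullF_mono. Qed.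

Lemma hull_closed z u v : z != c -> ~~ e c z -> u \in hull c x y -> e z u ->
  v \in hull c x y -> ~~ e z v -> z \in hull c x y.
Proof.
move=> zc cz uH zu vH zv; rewrite mem_hull zc cz /=; apply/or3P; apply: Or33; apply/andP.
by split; apply/existsP; [exists u; rewrite uH | exists v; rewrite vH].
Qed.

Lemma hull_l : x \in hull c x y. Proof. by rewrite mem_hull eqxx. Qed.
Lemma hull_r : y \in hull c x y. Proof. by rewrite mem_hull eqxx orbT. Qed.

Lemma hull_min S : x \in S -> y \in S ->
  (forall z u v, z != c -> ~~ e c z -> u \in S -> e z u -> v \in S -> ~~ e z v -> z \in S) ->
  hull c x y \subset S.
Proof.
move=> xS yS clS; rewrite /hull /fixset; elim: #|T| => [|n IH] /=; first exact: sub0set.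
apply/subsetP => z; rewrite inE => /or3P[/eqP->//|/eqP->//|].
case/and4P=> zc cz /existsP[u /andP[/(subsetP IH) uS zu]] /existsP[v /andP[/(subsetP IH) vS zv]].
exact: clS zc cz uS zu vS zv.
Qed.

Lemma hull_conn : e x y -> conn e (hull c x y).
Proof.
move=> xy; suff -> : hull c x y = component e (hull c x y) x by apply: conn_comp.
have xC := comp_self e hull_l.
apply/eqP; rewrite eqEsubset comp_sub andbT; apply: hull_min => //.
  exact: comp_closed xC hull_r xy.
move=> z u v zc cz uC zu vC zv; have sC := subsetP (comp_sub e (hull c x y) x).
apply: (comp_closed uC); last by rewrite esym.
exact: hull_closed zc cz (sC _ uC) zu (sC _ vC) zv.
Qed.

End Hull.

Section Completeness.
Hypothesis no5 : ~ p5in e setT.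
Variable I : {set T}.
Hypotheses (indI : indep I) (maxI : forall v, v \notin I -> exists2 i, i \in I & e v i).

Lemma hull_attached c x y : c \in I -> c != x -> c != y -> ~~ e c x -> ~~ e c y ->
  attached e I (hull c x y) c.
Proof.
move=> cI cx cy ncx ncy; split=> //.
  apply/nbP => -[|[d]]; rewrite mem_hull; first by rewrite (negPf cx) (negPf cy) eqxx.
  by case/or3P=> [/eqP->|/eqP->|/and4P[_ + _ _]]; apply/negP.
move=> s sH /nbP[sH'|[u uH su]] cs v vH; first by rewrite sH' in sH.
apply: contraT => sv; case/negP: sH; apply: (hull_closed _ cs uH su vH sv).
apply: contraTneq su => ->; move: uH; rewrite mem_hull.
by case/or3P=> [/eqP->|/eqP->|/and4P[_ + _ _]].
Qed.

(** An attached piece may fail to be a hull, but some hull inside it covers its solution vertices.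
    Choose a neighbour [y] of [x] whose hull [M] is largest. If [M] missed a solution vertex, some
    edge p q of [B] would have [p] complete to [M] and [q] without neighbours in [M]; then the hull
    of [x] and [p] absorbs [q] and after it all of [M], and is larger. *)
Lemma hull_cover B c x : conn e B -> attached e I B c -> x \in B -> x \in I -> 1 < #|B| ->
  exists y, [/\ y \in B, e x y, hull c x y \subset B & I :&: B \subset hull c x y].
Proof.
move=> cB [cI cnB att] xB xI B2.
have Bc z : z \in B -> z != c /\ ~~ e c z.
  move=> zB; have [c1 c2] := notin_nb cnB; split; last exact: c2.
  by apply: contraNneq c1 => <-.
have [y0 /andP[y0B xy0]] : exists y, (y \in B) && e x y.
  have [|||p [q [/set1P-> qB _ xq]]] := cB [set x]; first by rewrite sub1set.
  - by apply/set0Pn; exists x; rewrite inE.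
  - by apply: contraTneq B2 => <-; rewrite cards1.
  by exists q; rewrite qB.
case: (@arg_maxnP _ y0 [pred y | (y \in B) && e x y] (fun y => #|hull c x y|)) => [|y /= /andP[yB xy] maxy].
  by rewrite /= y0B.
have sHB y' : y' \in B -> hull c x y' \subset B.
  move=> y'B; apply: hull_min => // z u v zc cz uB zu vB zv; apply: contraT => zB.
  have znb : z \in nb e B by apply/nbP; right; exists u.
  by have := att z zB znb cz v vB; rewrite (negPf zv).
exists y; split=> //; first exact: sHB.
apply/subsetP => j; rewrite inE => /andP[jI jB]; apply: contraT => jM.
set M := hull c x y in maxy jM *.
have xM : x \in M by apply: hull_l.
pose N1 := [set z in B | [exists u, (u \in M) && e z u]].
have N1c z u : z \in N1 -> z \notin M -> u \in M -> e z u.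
  rewrite inE => /andP[zB /existsP[v /andP[vM zv]]] zM uM; apply: contraT => zu.
  by have [zc cz] := Bc z zB; case/negP: zM; apply: hull_closed zc cz vM zv uM zu.
have [|||p [q [pA qB qA pq]]] := cB (M :|: N1).
- by rewrite subUset sHB //; apply/subsetP => z; rewrite inE => /andP[].
- by apply/set0Pn; exists x; rewrite inE xM.
- apply: contraTneq jB => E; rewrite -E inE (negPf jM) /=.
  by apply: contra jM => jN; apply: contraT => /(N1c j x jN)/(_ xM); rewrite (negPf (indI jI xI)).
move: qA; rewrite in_setU negb_or => /andP[qM qN].
have qn u : u \in M -> ~~ e q u.
  by move=> uM; apply: contra qN => qu; rewrite inE qB; apply/existsP; exists u; rewrite uM.
have pM : p \notin M by apply/negP => /qn; rewrite esym pq.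
have pN : p \in N1 by move: pA; rewrite inE (negPf pM).
have pB : p \in B by move: pN; rewrite inE => /andP[].
have xp : e x p by rewrite esym; apply: N1c.
set M' := hull c x p.
have qM' : q \in M'.
  have [qc cq] := Bc q qB.
  by apply: (hull_closed qc cq (hull_r c x p) _ (hull_l c x p)); [rewrite esym | apply: qn].
have MM' : p |: M \subset M'.
  rewrite subUset sub1set hull_r; apply/subsetP => m mM; apply: contraT => mM'.
  have [mc cm] := Bc m (subsetP (sHB y yB) _ mM).
  case/negP: mM'; apply: (hull_closed mc cm (hull_r c x p) _ qM').
    by rewrite esym; apply: N1c.
  by rewrite esym; apply: qn.
have := subset_leq_card MM'; rewrite cardsU1 pM add1n => lt_M.
by have := maxy p; rewrite pB xp => /(_ isT); rewrite leqNgt lt_M.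
Qed.

(** The table knows nothing of [I]; it is compared with an arbitrary maximal independent set, piece
    by piece. An entry must exist at every size, and only its quality depends on [t]. *)
Definition good_tab t tab := forall c x y, c \in I -> x \in I -> e x y ->
  c != x -> c != y -> ~~ e c x -> ~~ e c y ->
  exists2 S, (c, hull c x y, S) \in tab &
    #|hull c x y| <= t -> wt w (I :&: hull c x y) <= wt w S.

Lemma part_good t tab B c : good_tab t tab -> conn e B -> attached e I B c -> #|B| <= t ->
  I :&: B != set0 ->
  exists p, [/\ p \in parts tab, p.1 \subset B & wt w (I :&: B) <= wt w p.2].
Proof.
move=> gt cB att Bt /set0Pn[x]; rewrite inE => /andP[xI xB].
have [le1|B2] := leqP #|B| 1.
  exists ([set x], [set x]); split; rewrite ?sub1set //=.
    by rewrite mem_cat; apply/orP; left; apply/mapP; exists x; rewrite ?mem_enum.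
  apply: wtS; apply: subset_trans (subsetIr _ _) _.
  have /eqP-> // : [set x] == B by rewrite eqEcard sub1set xB cards1.
have [y [yB xy sHB cover]] := hull_cover cB att xB xI B2.
have [cI cnB _] := att; have [c1 c2] := notin_nb cnB.
have [||||S St wS] := gt c x y cI xI xy; rewrite ?c2 //.
- by apply: contraNneq c1 => ->.
- by apply: contraNneq c1 => ->.
exists (hull c x y, S); split=> //=.
  by rewrite mem_cat; apply/orP; right; apply/mapP; exists (c, hull c x y, S).
apply: leq_trans (wS _); last exact: leq_trans (subset_leq_card sHB) Bt.
by apply: wtS; rewrite subsetI subsetIl.
Qed.

Lemma val_ge tab B p : p \in parts tab -> p.1 \subset B -> wt w p.2 <= wt w (tabval tab B).
Proof.
move=> pp sB; apply: best_max; move: pp; rewrite !mem_cat => /orP[] /mapP[q qt Ep].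
  apply/orP; right; apply/mapP; exists q; last by rewrite Ep.
  by rewrite mem_filter qt andbT -sub1set; move: sB; rewrite Ep.
apply/orP; left; apply/mapP; exists q; last by rewrite Ep.
by rewrite mem_filter qt andbT; move: sB; rewrite Ep.
Qed.

Lemma val_good t tab B c : good_tab t tab -> conn e B -> attached e I B c -> #|B| <= t ->
  wt w (I :&: B) <= wt w (tabval tab B).
Proof.
move=> gt cB att Bt; have [->|IB] := eqVneq (I :&: B) set0; first by rewrite wt_set0.
have [p [pp sB wp]] := part_good gt cB att Bt IB.
exact: leq_trans wp (val_ge pp sB).
Qed.

(** [split_piece] supplies one candidate. The sets that it involves are proper subsets of [M]
    attached to anchors, so the previous round already has good values for them. *)
Lemma step_good t tab : sound tab -> good_tab t tab -> good_tab t.+1 (tab_step tab).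
Proof.
move=> snd gt c x y cI xI xy cx cy ncx ncy.
have [S St _] := gt c x y cI xI xy cx cy ncx ncy.
set M := hull c x y in St *.
exists (best w (candidates tab c M)).
  by apply/mapP; exists (c, M, S).
move=> Mt; have att := hull_attached cI cx cy ncx ncy; rewrite -/M in att.
have xM : x \in M := hull_l c x y.
have M2 : 1 < #|M|.
  have xney : x != y by apply: contraTneq xy => ->; rewrite eirr.
  apply: (@leq_trans #|[set x; y]|); first by rewrite cards2 xney.
  by apply: subset_leq_card; rewrite subUset !sub1set xM hull_r.
have MI : M :&: I != set0 by apply/set0Pn; exists x; rewrite inE xM.
have [x' [ds [Bs [s3 s3' gB dB cov]]]] :=
  split_piece esym no5 indI maxI cI (hull_conn (c := c) xy) att M2 MI.
set W := M :\: barrier e (ext e c M) x' ds in cov.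
have gt_part B : exists p, B \in Bs -> [/\ p \in parts tab, p.1 \subset B &
    wt w (I :&: B) <= wt w p.2].
  have [BB|] := boolP (B \in Bs); last by exists (set0, set0).
  have [cB /goodP[//|sB nB IB [c' _ attB]]] := gB _ BB.
  have [|//|p Hp] := part_good gt cB attB; [|by rewrite setIC|by exists p].
  by rewrite -ltnS; apply: leq_trans Mt; apply: proper_card; rewrite properEneq nB.
have [pf Hpf] := fin_all_exists gt_part.
pose ps := [seq pf B | B <- Bs].
have psin : ps \in seqs 3 (parts tab).
  rewrite mem_seqs size_map s3'; apply/allP => _ /mapP[B BB ->].
  by have [] := Hpf _ BB.
have dsin : ds \in seqs 3 (enum T) by rewrite mem_seqs s3; apply/allP => z _; rewrite inE mem_enum.
have cand : combine tab W ps \in candidates tab c M.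
  apply/mapP; exists ((x', ds), ps) => //; rewrite mem_filter; apply/andP; split.
    apply/allP => _ /mapP[B BB ->]; have [_ sp _] := Hpf _ BB.
    have [_ /goodP[//|sB _ _ _]] := gB _ BB; rewrite (subset_trans sp sB) /=.
    apply/allP => _ /mapP[B' BB' ->]; have [_ sp' _] := Hpf _ BB'.
    have [->|ne] := eqVneq B B'; rewrite ?eqxx //.
    by apply/orP; right; apply: contra (dB _ _ BB BB' ne); apply: touchS.
  apply/allpairsP; exists ((x', ds), ps); split=> //.
  by apply/allpairsP; exists (x', ds); rewrite mem_enum.
apply: leq_trans (best_max w cand).
pose Z := [set v in I :&: M | ~~ has (fun B : {set T} => v \in B) Bs].
have ZP v : v \in Z -> goodb e I c M (component e W v) /\
    forall B, B \in Bs -> ~~ touch e (component e W v) B.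
  rewrite !inE => /andP[/andP[vI vM] /hasPn nB].
  by case: (cov v vI vM) => // -[B BB vB]; have := nB _ BB; rewrite vB.
pose P := [set B in Bs] :|: [set component e W v | v in Z].
have PP B : B \in P -> B \in Bs \/ exists2 v, v \in Z & B = component e W v.
  by rewrite !inE => /orP[->|/imsetP[v vZ ->]]; [left | right; exists v].
have tP : trivIset P.
  apply/trivIsetP => A B /PP[AB|[v vZ ->]] /PP[BB|[u uZ ->]] ne; apply: (@untouch_disjoint _ e).
  - exact: dB.
  - by rewrite nb_sym //; have [_ H] := ZP _ uZ; apply: H.
  - by have [_ H] := ZP _ vZ; apply: H.
  - exact: comp_untouch.
apply: (@leq_trans (wt w (I :&: cover P))).
  apply: wtS; apply/subsetP => v; rewrite in_setI => /andP[vI vM]; rewrite in_setI vI /=.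
  have [/hasP[B BB vB]|nB] := boolP (has (fun B : {set T} => v \in B) Bs).
    by apply/bigcupP; exists B; rewrite // !inE BB.
  have vZ : v \in Z by rewrite inE nB inE vI vM.
  apply/bigcupP; exists (component e W v).
    by rewrite in_setU; apply/orP; right; apply/imsetP; exists v.
  have [/goodP[//|_ _ /set0Pn[j]] + _ _] := ZP _ vZ.
  by rewrite inE => /andP[/comp_root vW _]; apply: comp_self.
apply: (@wt_family _ _ _ (fun B => if B \in Bs then (pf B).2 else tabval tab B)) => // B BP.
case: ifP => BB.
  have [pp sp wp] := Hpf _ BB; have [s12 _] := parts_sound snd pp.
  split=> //; first exact: subset_trans s12 sp.
  apply/subsetP => v vp; rewrite inE; apply/orP; left; apply/hasP.
  by exists (pf B) => //; apply/mapP; exists B.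
case: (PP _ BP) => [|[v vZ EB]]; first by rewrite BB.
have [/goodP[//|sB nB IB [c' _ attB]] nt] := ZP _ vZ.
rewrite -EB in sB nB IB attB nt.
have [sv _] := @val_sound tab B snd; split=> //.
  apply/subsetP => z zv; rewrite inE; apply/orP; right; apply/existsP; exists v.
  rewrite -EB zv andbT; apply/andP; split.
    by have [j] := set0Pn _ IB; rewrite inE EB => /andP[/comp_root].
  apply/hasPn => _ /mapP[B' BB' ->]; have [_ sp' _] := Hpf _ BB'.
  by apply: contra (nt _ BB'); apply: touchS.
apply: val_good gt _ attB _; first by rewrite EB; apply: conn_comp.
by rewrite -ltnS; apply: leq_trans Mt; apply: proper_card; rewrite properEneq nB.
Qed.

Lemma tab_good n : good_tab n (iter n tab_step tab0).
Proof.
elim: n => [|n IH] /=; last exact: step_good (@tab_sound n) IH.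
move=> c x y _ _ _ _ _ _ _; exists set0.
  apply/mapP; exists (c, hull c x y) => //; apply/mapP; exists ((c, x), y) => //.
  apply/allpairsP; exists ((c, x), y); split=> //=; last by rewrite mem_enum.
  by apply/allpairsP; exists (c, x); split=> //=; rewrite mem_enum.
by move=> le0; have := hull_l c x y; rewrite (card0_eq (_ : #|hull c x y| = 0)) //; lia.
Qed.

Lemma mwis_ge : wt w I <= wt w mwis.
Proof.
have [->|/set0Pn[c cI]] := eqVneq I set0; first by rewrite wt_set0.
set tab := iter #|T| tab_step tab0.
have snd : sound tab by apply: tab_sound.
pose S := [set v | (v == c) || [exists u, (u \in apart c) &&
    (v \in tabval tab (component e (apart c) u))]].
apply: (@leq_trans (wt w S)); last by apply: best_max; apply/mapP; exists c; rewrite ?mem_enum.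
have attC u : attached e I (component e (apart c) u) c.
  have cap x : x \in component e (apart c) u -> x != c /\ ~~ e c x.
    move=> /(subsetP (comp_sub e _ _)); rewrite inE => /notin_nb[xc /(_ c)].
    by rewrite inE eqxx esym => /(_ isT); rewrite inE in xc.
  split=> //.
    apply/nbP => -[/cap[/eqP//]|[d /cap[_ cd] cd']].
    by rewrite cd' in cd.
  move=> s sC /nbP[sC'|[d dC sd]] cs; first by rewrite sC' in sC.
  case/negP: sC; apply: (comp_closed dC); last by rewrite esym.
  rewrite inE; apply/nbP => -[/set1P Es|[z /set1P-> sc]].
    by have [_] := cap d dC; rewrite -Es sd.
  by rewrite esym sc in cs.
pose P := [set c] |: [set component e (apart c) u | u in apart c].
have tP : trivIset P.
  have cu u : [disjoint [set c] & component e (apart c) u].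
    rewrite disjoints1; apply/negP => /(subsetP (comp_sub e _ _)).
    by rewrite inE; apply/negP; rewrite negbK inE inE eqxx.
  apply/trivIsetP => A B /setU1P[->|/imsetP[u _ ->]] /setU1P[->|/imsetP[v _ ->]].
  - by rewrite eqxx.
  - by move=> _; apply: cu.
  - by move=> _; rewrite disjoint_sym; apply: cu.
  - by move=> ne; apply: untouch_disjoint (comp_untouch esym ne).
apply: (@leq_trans (wt w (I :&: cover P))).
  apply: wtS; rewrite subsetI subxx /=; apply/subsetP => v vI; apply/bigcupP.
  have [->|vc] := eqVneq v c; first by exists [set c]; rewrite ?inE ?eqxx.
  have va : v \in apart c.
    rewrite inE; apply/nbP => -[/set1P/eqP|[d /set1P-> vc']]; first by rewrite (negPf vc).
    by have := indI vI cI; rewrite vc'.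
  exists (component e (apart c) v); last exact: comp_self.
  by rewrite in_setU; apply/orP; right; apply/imsetP; exists v.
apply: (@wt_family _ _ _ (fun B => if B == [set c] then B else tabval tab B)) => // B.
case/setU1P=> [->|/imsetP[u ua EB]].
  by rewrite eqxx; split; [|rewrite sub1set inE eqxx | apply: wtS; apply: subsetIr].
case: eqP => [->|_]; first by split; [|rewrite sub1set inE eqxx | apply: wtS; apply: subsetIr].
have [sv _] := @val_sound tab B snd; split=> //.
  apply/subsetP => z zv; rewrite inE; apply/orP; right; apply/existsP; exists u.
  by rewrite ua -EB.
rewrite EB; apply: (val_good (@tab_good #|T|) _ (attC u)); first exact: conn_comp.
exact: max_card.
Qed.

End Completeness.

Theorem mwis_max J : ~ p5in e setT -> indep J -> wt w J <= wt w mwis.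
Proof.
move=> no5 indJ.
pose ok (S : {set T}) := (J \subset S) && [forall x, forall y, (x \in S) && (y \in S) ==> ~~ e x y].
have okP S : reflect (J \subset S /\ indep S) (ok S).
  apply: (iffP andP) => -[sJ H]; split=> //.
    by move=> x y xS yS; have /forallP/(_ y) := forallP H x; rewrite xS yS.
  by apply/forallP => x; apply/forallP => y; apply/implyP => /andP[]; apply: H.
have okJ : ok J by apply/okP.
case: (arg_maxnP (fun S : {set T} => #|S|) okJ) => I /okP[sJ indI] maxI.
apply: leq_trans (wtS w sJ) (mwis_ge no5 indI _) => v vI.
have [/existsP[i /andP[iI vi]]|no] := boolP [exists i, (i \in I) && e v i]; first by exists i.
have {}no i : i \in I -> ~~ e v i.
  by move=> iI; apply: contra no => vi; apply/existsP; exists i; rewrite iI.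
suff /maxI : ok (v |: I) by rewrite /= cardsU1 vI add1n ltnn.
apply/okP; split; first by apply: subset_trans sJ (subsetUr _ _).
move=> x y /setU1P[->|xI] /setU1P[->|yI]; rewrite ?eirr ?no //; last exact: indI.
by rewrite esym no.
Qed.

End MWIS.

(** * The recursive algorithm *)

Section Blobs.
Variables (T : finType) (e : rel T) (w : T -> nat) (cs : seq {set T}).

Definition blob_adj : rel 'I_(size cs) :=
  fun i j => (i != j) && touch e (nth set0 cs i) (nth set0 cs j).
Definition blob_wt (i : 'I_(size cs)) := wt w (nth set0 cs i).
Definition blob_union := [set v | [exists i : 'I_(size cs),
  (i \in mwis blob_adj blob_wt) && (v \in nth set0 cs i)]].

Hypothesis esym : symmetric e.

Lemma blob_sym : symmetric blob_adj.
Proof. by move=> i j; rewrite /blob_adj eq_sym nb_sym. Qed.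

Lemma blob_irr : irreflexive blob_adj.
Proof. by move=> i; rewrite /blob_adj eqxx. Qed.

Lemma conn_touchU A B : conn e A -> conn e B -> touch e A B -> conn e (A :|: B).
Proof.
move=> cA cB /existsP[x /andP[xA xB]].
have xU : x \in A :|: B by rewrite inE xA.
suff -> : A :|: B = component e (A :|: B) x by apply: conn_comp.
have sA := comp_conn_sub cA (subsetUl A B) xA.
apply/eqP; rewrite eqEsubset comp_sub andbT subUset sA /=.
case/nbP: xB => [xB|[d dB xd]]; first exact: comp_conn_sub cB (subsetUr A B) xB.
have dU : d \in A :|: B by rewrite inE dB orbT.
rewrite -(comp_mem esym (comp_closed (comp_self e xU) dU xd)).
exact: comp_conn_sub cB (subsetUr A B) dB.
Qed.

(** The five sets yield a [link5] over the middle one: in the union of the first two, an edge leads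
    from a vertex [b] without contact to the third set to a vertex [x] with contact, and likewise
    from the other end. *)
Lemma blob_p5free X : ~ p5in e X -> (forall B, B \in cs -> conn e B /\ B \subset X) ->
  ~ p5in blob_adj setT.
Proof.
move=> no5 HB [i1 [i2 [i3 [i4 [i5 [_]]]]]].
rewrite /p5 => /and5P[e12 e23 e34 e45 /and5P[n13 n14 n15 n24 /andP[n25 n35]]].
have cB i : conn e (nth set0 cs i) /\ nth set0 cs i \subset X.
  have [lt_i|le_i] := ltnP i (size cs); first by apply: HB; apply: mem_nth.
  rewrite nth_default // sub0set; split=> // A; rewrite subset0 => /eqP->.
  by rewrite eqxx.
have tch i j : blob_adj i j -> touch e (nth set0 cs i) (nth set0 cs j) by case/andP.
(* Nonadjacent indices could coincide; an index adjacent to only one of them excludes this, so the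
   sets really do not touch. *)
have ntc i j k : blob_adj i k -> ~~ blob_adj j k -> ~~ blob_adj i j ->
    ~~ touch e (nth set0 cs i) (nth set0 cs j).
  move=> ik jk; rewrite negb_and negbK => /orP[/eqP ij|//].
  by rewrite -ij ik in jk.
have e21 : blob_adj i2 i1 by rewrite blob_sym.
have e32 : blob_adj i3 i2 by rewrite blob_sym.
have e43 : blob_adj i4 i3 by rewrite blob_sym.
have e54 : blob_adj i5 i4 by rewrite blob_sym.
have t13 : ~~ touch e (nth set0 cs i1) (nth set0 cs i3).
  by rewrite nb_sym //; apply: (ntc _ _ i4); rewrite // blob_sym.
have t53 : ~~ touch e (nth set0 cs i5) (nth set0 cs i3).
  by rewrite nb_sym //; apply: (ntc _ _ i2); rewrite // blob_sym.
have t14 : ~~ touch e (nth set0 cs i1) (nth set0 cs i4).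
  by rewrite nb_sym //; apply: (ntc _ _ i3); rewrite // blob_sym.
have t15 : ~~ touch e (nth set0 cs i1) (nth set0 cs i5).
  by apply: (ntc _ _ i2); rewrite // blob_sym.
have t24 : ~~ touch e (nth set0 cs i2) (nth set0 cs i4).
  by apply: (ntc _ _ i1); rewrite // blob_sym.
have t25 : ~~ touch e (nth set0 cs i2) (nth set0 cs i5).
  by apply: (ntc _ _ i3); rewrite // blob_sym.
pose B1 := nth set0 cs i1; pose B2 := nth set0 cs i2; pose B3 := nth set0 cs i3.
pose B4 := nth set0 cs i4; pose B5 := nth set0 cs i5.
have edge A B : conn e A -> conn e B -> touch e A B -> ~~ touch e A B3 -> touch e B B3 ->
    A != set0 ->
    exists b x, [/\ b \in A :|: B, x \in B, e b x, exists2 d, d \in B3 & e x d &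
      forall d, d \in B3 -> ~~ e b d].
  move=> cA cB' AB nA tB A0; have cU := conn_touchU cA cB' AB.
  pose O := [set z in A :|: B | z \notin nb e B3].
  have sO : O \subset A :|: B by apply/subsetP => z; rewrite inE => /andP[].
  have nbA z : z \in A -> z \notin nb e B3.
    by move=> zA; apply: contra nA => zn; apply/existsP; exists z; rewrite zA.
  have O0 : O != set0.
    by have [z zA] := set0Pn _ A0; apply/set0Pn; exists z; rewrite inE nbA // inE zA.
  have nO : O != A :|: B.
    case/existsP: tB => z /andP[zB zn]; apply: contraTneq zn => E.
    by have : z \in O; [rewrite E inE zB orbT | rewrite inE => /andP[]].
  have [b [x [bO xU xO bx]]] := cU O sO O0 nO.
  have [bU bn3] : b \in A :|: B /\ b \notin nb e B3 by move: bO; rewrite in_set => /andP[].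
  have xn3 : x \in nb e B3 by move: xO; rewrite in_set xU negbK.
  have [_ nb3] := notin_nb bn3; exists b, x; split=> //.
    by move: xU; rewrite inE => /orP[/nbA|//]; rewrite xn3.
  by case/nbP: xn3 => // xB3; have := nb3 _ xB3; rewrite bx.
have ne0 i j : blob_adj i j -> nth set0 cs i != set0.
  by move=> /tch/existsP[z /andP[zi _]]; apply/set0Pn; exists z.
have [b [x [bU xB bx xd nbd]]] := edge B1 B2 (cB i1).1 (cB i2).1 (tch _ _ e12) t13 (tch _ _ e23) (ne0 _ _ e12).
have [b' [y [b'U yB b'y yd nb'd]]] := edge B5 B4 (cB i5).1 (cB i4).1 (tch _ _ e54) t53 (tch _ _ e43) (ne0 _ _ e54).
have na u v : u \in B1 :|: B2 -> v \in B5 :|: B4 -> ~~ e u v.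
  by rewrite !inE => /orP[] uB /orP[] vB;
    [have /touchPn/(_ u v uB vB)/andP[] := t15 | have /touchPn/(_ u v uB vB)/andP[] := t14
    |have /touchPn/(_ u v uB vB)/andP[] := t25 | have /touchPn/(_ u v uB vB)/andP[] := t24].
have xU : x \in B1 :|: B2 by rewrite inE xB orbT.
have yU : y \in B5 :|: B4 by rewrite inE yB orbT.
apply: no5; apply: p5inS (link5 esym (cB i3).1 xd yd (na _ _ xU yU) bx b'y nbd nb'd
  (na _ _ bU yU) _ (na _ _ bU b'U)); last by rewrite esym; apply: na.
have inX i z : z \in nth set0 cs i -> z \in X by apply: (subsetP (cB i).2).
rewrite !subUset !sub1set (cB i3).2 (inX i2 x) // (inX i4 y) //=.
apply/andP; split; first by move: bU; rewrite inE => /orP[]; apply: inX.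
by move: b'U; rewrite inE => /orP[]; apply: inX.
Qed.

End Blobs.

Section Solve.
Variables (T : finType) (e : rel T) (w : T -> nat) (k r N1 N2 : nat).
Implicit Types (A B C D H R S X Z : {set T}) (L : seq {set T}) (s : seq (T * nat)).
Notation guess := (seq (T * nat) * seq (T * nat))%type.
Implicit Types g : guess.

Definition act L := [set v | has (fun A : {set T} => v \in A) L].
Definition restr L R := [seq [set v | (v \in A) && (v \in R)] | A : {set T} <- L].
Definition verts s := [set v | has (fun p => p.1 == v) s].
Definition colset s c := [set v | has (fun p => (p.1 == v) && (p.2 == c)) s].

(** The first half of a guess is the coloured dominating set, the second half its enlargement. Both
    take part in colour conflicts, but only the first has to dominate. *)
Definition valid L g := all (fun p => [&& p.1 \in nth set0 L p.2, p.1 \in nb e (verts g.1) &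
  all (fun q => (p.2 == q.2) ==> ~~ e p.1 q.1) (g.1 ++ g.2)]) (g.1 ++ g.2).

Definition allowed L g c :=
  list2 e r L (verts g.1) (colset (g.1 ++ g.2)) (verts (g.1 ++ g.2)) c.
Definition sublists L g A :=
  [seq [set u | (u \in allowed L g c) && (trace e (verts g.1) u == A)] | c <- iota 0 k].

(** A dominated vertex outside the guess has a nonempty trace and may not take the colour of a
    vertex in it. Hence only nonempty traces are solved, and each of these instances has lost a
    colour. *)
Definition dom (sv : seq {set T} -> {set T}) L g :=
  if valid L g then [set u | (u \in verts (g.1 ++ g.2)) || [exists v,
    (trace e (verts g.1) v != set0) && (u \in sv (sublists L g (trace e (verts g.1) v)))]]
  else set0.

(** Whatever is found here is nonadjacent to every active vertex outside N[D], so it can be joined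
    to any solution found out there. *)
Definition interior L D := [set v | [&& v \in act L, v \in nb e D &
  [forall u, (u \in act L) && (u \notin nb e D) ==> ~~ e u v]]].
Definition outside D := [set v | v \notin nb e D].

Definition pairs := [seq (v, c) | v <- enum T, c <- iota 0 k].
Definition guesses : seq guess := [seq (s1, s2) | s1 <- seqs N1 pairs, s2 <- seqs N2 pairs].

Definition connb D := [forall x, (x \in D) ==> (D \subset component e D x)].

(** A connected first half makes the piece connected, because the piece contains it and lies in its
    neighbourhood; [blob_p5free] relies on this. *)
Definition pieces sv L := [seq dom sv (restr L (interior L (verts g.1))) g | g <- guesses &
  [&& verts g.1 != set0, connb (verts g.1) & valid (restr L (interior L (verts g.1))) g]].

(* A solution is either dominated by a bounded set, or splits into boundedly many components with
   a dominating set D and a part outside N[D], where the graph is P5-free; there the components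
   are chosen by an independent set of maximum weight in the graph of candidate pieces. The
   parameter j bounds the number of colours with a nonempty list. *)
Fixpoint solve j L := if j is j'.+1 then
  best w ([seq dom (solve j') L g | g <- guesses] ++
    [seq [set v | (v \in dom (solve j') (restr L (interior L (verts g.1))) g) ||
        (v \in blob_union e w (pieces (solve j') (restr L (outside (verts g.1)))))] | g <- guesses])
  else set0.

Hypotheses (esym : symmetric e) (eirr : irreflexive e).

Definition lcolourable L S := exists col, lcol e L col S.

Lemma nth_restr L R c : nth set0 (restr L R) c = [set v | (v \in nth set0 L c) && (v \in R)].
Proof.
have [lt_c|le_c] := ltnP c (size L); first by rewrite (nth_map set0).
by rewrite !nth_default ?size_map //; apply/setP => v; rewrite !inE.
Qed.

Lemma act_nth L c v : v \in nth set0 L c -> v \in act L.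
Proof.
have [lt_c|le_c] := ltnP c (size L) => vL; last by rewrite nth_default // inE in vL.
by rewrite inE; apply/hasP; exists (nth set0 L c) => //; apply: mem_nth.
Qed.

Lemma act_restr L R : act (restr L R) \subset R.
Proof. by apply/subsetP => v; rewrite inE => /hasP[_ /mapP[A _ ->]]; rewrite inE => /andP[]. Qed.

Lemma lcol_act L col S : lcol e L col S -> S \subset act L.
Proof. by move=> [HL _]; apply/subsetP => x /HL/act_nth. Qed.

Lemma lcol_le L L' col S : (forall c, nth set0 L c \subset nth set0 L' c) ->
  lcol e L col S -> lcol e L' col S.
Proof. by move=> sL [HL pr]; split=> // x /HL; apply: (subsetP (sL _)). Qed.

Lemma restr_le L R c : nth set0 (restr L R) c \subset nth set0 L c.
Proof. by rewrite nth_restr; apply/subsetP => v; rewrite inE => /andP[]. Qed.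

Lemma lcol_restr L R col S : lcol e L col S -> S \subset R -> lcol e (restr L R) col S.
Proof. by move=> [HL pr] /subsetP sR; split=> // x xS; rewrite nth_restr inE HL ?sR. Qed.

Lemma lcolS L col S S' : S' \subset S -> lcol e L col S -> lcol e L col S'.
Proof. by move=> /subsetP sS [HL pr]; split=> [x /sS/HL|x y /sS xS /sS]; [|apply: pr]. Qed.

Lemma lcolourable0 L : lcolourable L set0.
Proof. by exists (fun=> 0); split=> x; rewrite inE. Qed.

Lemma lcolourableU L A B : lcolourable L A -> lcolourable L B -> ~~ touch e A B ->
  lcolourable L (A :|: B).
Proof.
move=> [colA [LA prA]] [colB [LB prB]] /touchPn nt.
have AB x : x \in B -> x \notin A.
  by move=> xB; apply/negP => xA; have := nt x x xA xB; rewrite eqxx.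
exists (fun v => if v \in A then colA v else colB v); split=> [x|x y].
  by rewrite inE; case: ifP => [/LA //|_ /= /LB].
rewrite !inE; case: ifP => xA; case: ifP => yA //=; first by move=> _ _; apply: prA.
- by move=> _ yB xy; have := nt x y xA yB; rewrite xy andbF.
- by move=> xB _ xy; have := nt y x yA xB; rewrite esym xy andbF.
- by move=> xB yB; apply: prB.
Qed.

Lemma nth_sublists L g A c : nth set0 (sublists L g A) c =
  [set u | [&& c < k, u \in allowed L g c & trace e (verts g.1) u == A]].
Proof.
have [lt_c|le_c] := ltnP c k; first by rewrite (nth_map 0) ?size_iota // nth_iota.
by rewrite nth_default ?size_map ?size_iota //; apply/setP => u; rewrite !inE.
Qed.

Lemma vertsP s v : reflect (exists c, (v, c) \in s) (v \in verts s).
Proof.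
rewrite inE; apply: (iffP hasP) => [[[u c] us /eqP /= <-]|[c vc]]; first by exists c.
by exists (v, c) => /=.
Qed.

Lemma colsetP s v c : (v \in colset s c) = ((v, c) \in s).
Proof.
rewrite inE; apply/hasP/idP => [[[u d] us /andP[/eqP /= <- /eqP <-]] //|vs].
by exists (v, c); rewrite /= ?eqxx.
Qed.

Lemma sv_trace sv L g A u : (forall L', lcolourable L' (sv L')) ->
  u \in sv (sublists L g A) -> exists c, u \in allowed L g c /\ trace e (verts g.1) u = A.
Proof.
move=> snd uS; have [col [/(_ u uS) + _]] := snd (sublists L g A).
by rewrite nth_sublists inE => /and3P[_ ? /eqP]; exists (col u).
Qed.

(** Solutions for different traces are coloured independently. An edge between two of them cannot be
    monochromatic: both ends passed [list2] for that colour, so each trace would contain the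
    other. *)
Lemma dom_sound sv L g : (forall L', lcolourable L' (sv L')) -> valid L g ->
  [/\ lcolourable L (dom sv L g), dom sv L g \subset nb e (verts g.1) &
    verts g.1 \subset dom sv L g].
Proof.
move=> snd vld; rewrite /dom vld; set s := g.1 ++ g.2; set D0 := verts g.1; set D := verts s.
move: (vld) => /allP vP; split; last first.
- apply/subsetP => v /vertsP[c vc]; rewrite inE; apply/orP; left; apply/vertsP.
  by exists c; rewrite mem_cat vc.
- apply/subsetP => u; rewrite inE => /orP[/vertsP[c uc]|]; first by have /and3P[] := vP _ uc.
  case/existsP=> v /andP[/set0Pn[d dv]] /(sv_trace snd)[c [_ tu]].
  by move: dv; rewrite -tu inE => /andP[dD ud]; apply/nbP; right; exists d.
have colD u : exists c, u \in D -> (u, c) \in s.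
  have [/vertsP[c uc]|_] := boolP (u \in D); first by exists c.
  by exists 0.
have [cD HcD] := fin_all_exists colD.
have [F HF] := fin_all_exists (fun A : {set T} => snd (sublists L g A)).
pose col u := if u \in D then cD u else F (trace e D0 u) u.
have nD u : u \in [set u | (u \in D) || [exists v, (trace e D0 v != set0) &&
     (u \in sv (sublists L g (trace e D0 v)))]] -> u \notin D ->
    u \in sv (sublists L g (trace e D0 u)) /\ u \in allowed L g (F (trace e D0 u) u).
  rewrite inE => /orP[->//|/existsP[v /andP[_ uS]]] _.
  have [c [_ tu]] := sv_trace snd uS; rewrite -/D0 in tu.
  rewrite tu; split=> //; have [/(_ u uS) + _] := HF (trace e D0 v).
  by rewrite nth_sublists inE => /and3P[].
have l12 u c : u \in allowed L g c -> u \in list1 e r L D0 (colset s) D c.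
  by rewrite inE => /andP[].
exists col; split=> [x xS|x y xS yS xy]; rewrite /col.
  case: ifP => [xD|/negbT /(nD x xS)[_ /l12]]; first by have /and3P[] := vP _ (HcD x xD).
  by rewrite inE => /and4P[].
have DnD u v : u \in D -> v \in allowed L g (cD u) -> ~~ e v u.
  move=> uD /l12; rewrite inE => /and4P[_ _ /forallP/(_ u) + _].
  by rewrite colsetP HcD.
case: ifP => xD; case: ifP => yD.
- have /and3P[_ _ /allP/(_ _ (HcD y yD))] := vP _ (HcD x xD).
  by rewrite /= xy implybF.
- have [_ yA] := nD y yS (negbT yD); apply: contraTneq xy => E; rewrite esym.
  by apply: DnD => //; rewrite E.
- have [_ xA] := nD x xS (negbT xD); apply: contraTneq xy => E.
  by apply: DnD => //; rewrite -E.
have [xSv xA] := nD x xS (negbT xD); have [ySv yA] := nD y yS (negbT yD).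
have [E|ne] := eqVneq (trace e D0 x) (trace e D0 y).
  by rewrite E in xSv *; have [_ pr] := HF (trace e D0 y); apply: pr.
apply: contra ne => /eqP Ec; rewrite eqEsubset; rewrite -Ec in yA.
set c := F _ x in Ec xA yA.
move: (xA) (yA); rewrite [x \in _]inE [y \in _]inE.
move=> /andP[_ /forallP/(_ y)] + /andP[_ /forallP/(_ x)].
by rewrite (l12 _ _ xA) (l12 _ _ yA) (esym y x) xy => /= -> ->.
Qed.

Lemma interior_nb L D : interior L D \subset nb e D.
Proof. by apply/subsetP => v; rewrite inE => /and3P[]. Qed.

Lemma dom_interior sv L g D : (forall L', lcolourable L' (sv L')) ->
  dom sv (restr L (interior L D)) g \subset interior L D.
Proof.
move=> snd; have [vld|] := boolP (valid (restr L (interior L D)) g); last first.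
  by rewrite /dom => /negPf->; apply: sub0set.
have [[col /lcol_act sA] _ _] := dom_sound snd vld.
exact: subset_trans sA (act_restr _ _).
Qed.

Lemma pieceP sv L S : (forall L', lcolourable L' (sv L')) -> S \in pieces sv L ->
  [/\ lcolourable L S, conn e S & S \subset act L].
Proof.
move=> snd /mapP[g + ->]; rewrite mem_filter => /andP[/and3P[D0 cD vld] _].
have [[col lc] sN sD] := dom_sound snd vld.
have lc' := lcol_le (restr_le _ _) lc.
split; [by exists col | | exact: lcol_act lc'].
apply: (conn_ext esym (D := verts g.1)) => // [|x xS xD].
  have [x xD] := set0Pn _ D0; have sC := implyP (forallP cD x) xD.
  have -> : verts g.1 = component e (verts g.1) x by apply/eqP; rewrite eqEsubset sC comp_sub.
  exact: conn_comp.
by have /nbP[|] := subsetP sN _ xS; first by rewrite (negPf xD).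
Qed.

Lemma blob_disjoint cs (i j : 'I_(size cs)) : i \in mwis (@blob_adj _ e cs) (@blob_wt _ w cs) ->
  j \in mwis (@blob_adj _ e cs) (@blob_wt _ w cs) -> i != j ->
  ~~ touch e (nth set0 cs i) (nth set0 cs j).
Proof.
move=> iM jM ne; have := mwis_indep (blob_sym esym) (@blob_irr _ e cs) iM jM.
by rewrite /blob_adj ne.
Qed.

Lemma blob_union_sound L cs : (forall S, S \in cs -> lcolourable L S) ->
  lcolourable L (blob_union e w cs).
Proof.
move=> snd; set M := mwis (@blob_adj _ e cs) (@blob_wt _ w cs).
have [F HF] := fin_all_exists (fun i : 'I_(size cs) => snd _ (mem_nth set0 (ltn_ord i))).
have pick v : exists o : option 'I_(size cs), v \in blob_union e w cs ->
    exists i, [/\ o = Some i, i \in M & v \in nth set0 cs i].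
  have [|_] := boolP (v \in blob_union e w cs); last by exists None.
  by rewrite inE => /existsP[i /andP[iM vi]]; exists (Some i) => _; exists i.
have [f Hf] := fin_all_exists pick.
exists (fun v => if f v is Some i then F i v else 0); split=> [v /Hf[i [-> iM vi]]|x y].
  by have [HL _] := HF i; apply: HL.
move=> /Hf[i [-> iM xi]] /Hf[j [-> jM yj]] xy.
have [E|ne] := eqVneq i j; first by rewrite -E in yj *; have [_ pr] := HF i; apply: pr.
by have /touchPn/(_ x y xi yj) := blob_disjoint iM jM ne; rewrite xy andbF.
Qed.

Lemma solve_sound j L : lcolourable L (solve j L).
Proof.
elim: j L => [|j IH] L /=; first exact: lcolourable0.
have domL L' g : lcolourable L' (dom (solve j) L' g).
  have [vld|nv] := boolP (valid L' g); first by have [] := dom_sound IH vld.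
  by rewrite /dom (negPf nv); apply: lcolourable0.
apply: best_ind; first exact: lcolourable0.
move=> S; rewrite mem_cat => /orP[] /mapP[g _ ->]; first exact: domL.
set D := dom _ _ _; set U := blob_union _ _ _.
have -> : [set v | (v \in D) || (v \in U)] = D :|: U by apply/setP => v; rewrite !inE.
have up L1 R S' : lcolourable (restr L1 R) S' -> lcolourable L1 S'.
  by case=> col /(lcol_le (restr_le _ _)); exists col.
have UL : lcolourable (restr L (outside (verts g.1))) U.
  by apply: blob_union_sound => S' /(pieceP IH)[].
apply: lcolourableU; [exact: up (domL _ _) | exact: up UL |].
have sD := dom_interior L g (verts g.1) IH; rewrite -/D in sD.
case: UL => col UL; have /subsetP sU := subset_trans (lcol_act UL) (act_restr _ _).
have lcU := lcol_act (lcol_le (restr_le _ _) UL).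
apply/touchPn => x y /(subsetP sD) xI yU.
have yn : y \notin nb e (verts g.1) by have := sU _ yU; rewrite in_set.
move: xI; rewrite in_set => /and3P[_ xn /forallP/(_ y)].
rewrite (subsetP lcU) // yn esym /= => ->; rewrite andbT.
by apply: contraNneq yn => <-.
Qed.

End Solve.

Lemma wtID (T : finType) (w : T -> nat) (S A : {set T}) :
  wt w S = wt w (S :&: A) + wt w (S :\: A).
Proof. by rewrite /wt (big_setID A). Qed.

Lemma p5in_dec (T : finType) (e : rel T) X : p5in e X \/ ~ p5in e X.
Proof.
pose P (t : T * T * T * T * T) := let: (a, b, c, d, f) := t in
  [&& a \in X, b \in X, c \in X, d \in X & f \in X] && p5 e a b c d f.
have [[[[[a b] c] d] f] /andP[Hin H5]|no] := pickP P; [left | right].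
  by exists a, b, c, d, f; split.
move=> [a [b [c [d [f [/and5P[aX bX cX dX fX] H]]]]]].
by have := no (a, b, c, d, f); rewrite /P aX bX cX dX fX H.
Qed.

(** * Optimality of the recursive algorithm *)

Section Complete.
Variables (T : finType) (e : rel T) (w : T -> nat) (k r N1 N2 : nat).
Implicit Types (A B C D H R S X Z : {set T}) (L : seq {set T}).
Hypotheses (esym : symmetric e) (eirr : irreflexive e) (Hfree : p5r_free e r).
(** The three origins of a dominating set: a five-vertex path with at most [r] vertices of each
    colour, one set from [conn_dominating] in each of at most [r] components, and one set from
    [isolate] in each of [r.+1] components. *)
Hypotheses (N1a : 5 + k * r <= N1) (N1b : r * (1 + 2 * (k * k)) <= N1)
  (N1c : r.+1 * (1 + 2 * (k * k) + k + k) <= N1) (HN2 : dec_bound r k N1 <= N2).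
Notation solve := (solve e w k r N1 N2).
Notation guesses := (guesses T k N1 N2).

(** The recursion measure. It counts colours instead of vertices, so the depth is at most [k]
    whatever the size of the graph. *)
Definition pal L := #|[set c : 'I_k | nth set0 L c != set0]|.

Lemma pal_restr L R : pal (restr L R) <= pal L.
Proof.
apply: subset_leq_card; apply/subsetP => c; rewrite !inE => /set0Pn[v vL].
by apply/set0Pn; exists v; apply: (subsetP (restr_le L R c)).
Qed.

Lemma dec_bound_le m n : m <= n -> dec_bound r k m <= dec_bound r k n.
Proof.
move=> le_mn; have le2 : 2 ^ m <= 2 ^ n by rewrite leq_exp2l.
by rewrite !leq_add // ?leq_mul.
Qed.

Lemma eq_list2 L D0 Dc Dc' D c : Dc c = Dc' c ->
  list2 e r L D0 Dc D c = list2 e r L D0 Dc' D c.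
Proof. by move=> E; rewrite /list2 /list1 /present /large E. Qed.

Definition solves j := forall L H, size L = k -> pal L <= j -> lcolourable e L H ->
  wt w H <= wt w (solve j L).

(** The right guess records [D0] and the enlargement from [decouple], both with the colours of [H];
    the rest of [H] then survives in the sublists, sorted by traces. *)
Lemma dom_ge j L col H D0 : solves j -> size L = k -> pal L <= j.+1 -> lcol e L col H ->
  D0 \subset H -> H \subset nb e D0 -> #|D0| <= N1 ->
  exists g, [/\ g \in guesses, verts g.1 = D0, valid e L g &
    wt w H <= wt w (dom e k r (solve j) L g)].
Proof.
move=> IH sL pL lc sD0 dH card0.
have [D [sD sDH cD HD]] := decouple esym Hfree lc sD0 dH.
have [Hk _] := lcol_kcol lc; rewrite sL in Hk cD.
pose s1 := [seq (x, col x) | x <- enum D0].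
pose s2 := [seq (x, col x) | x <- enum (D :\: D0)].
have mem_s x c : ((x, c) \in s1 ++ s2) = (x \in D) && (c == col x).
  rewrite mem_cat; apply/orP/andP => [[] /mapP[y + [-> ->]]|[xD /eqP->]].
  - by rewrite mem_enum => /(subsetP sD)->; rewrite eqxx.
  - by rewrite mem_enum => /setDP[->]; rewrite eqxx.
  - by have [x0|x0] := boolP (x \in D0); [left | right]; apply/mapP; exists x;
      rewrite ?mem_enum // in_setD x0.
have v1 : verts s1 = D0.
  apply/setP => x; apply/vertsP/idP => [[c /mapP[y + [-> _]]]|xD]; first by rewrite mem_enum.
  by exists (col x); apply/mapP; exists x; rewrite ?mem_enum.
have vD : verts (s1 ++ s2) = D.
  apply/setP => x; apply/vertsP/idP => [[c]|xD]; first by rewrite mem_s => /andP[].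
  by exists (col x); rewrite mem_s xD eqxx.
have cD' c : colset (s1 ++ s2) c = colclass col D c.
  by apply/setP => x; rewrite colsetP mem_s inE eq_sym.
have in_pairs x : x \in H -> (x, col x) \in pairs T k.
  by move=> xH; apply/allpairsP; exists (x, col x); rewrite mem_enum mem_iota Hk.
have vld : valid e L (s1, s2).
  apply/allP => -[x c]; rewrite mem_s => /andP[xD /eqP->] /=.
  have xH := subsetP sDH _ xD; rewrite v1 (proj1 lc) // (subsetP dH) //=.
  apply/allP => -[y c']; rewrite mem_s => /andP[yD /eqP->] /=.
  by apply/implyP; apply: contraL => /(proj2 lc)->//; apply: (subsetP sDH).
exists (s1, s2); split=> //.
  apply/allpairsP; exists (s1, s2); split=> //=; rewrite mem_seqs size_map -cardE.
    rewrite card0; apply/allP => _ /mapP[x + ->]; rewrite mem_enum => /(subsetP sD0).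
    exact: in_pairs.
  apply/andP; split; last first.
    apply/allP => _ /mapP[x + ->]; rewrite mem_enum => /setDP[/(subsetP sDH) xH _].
    exact: in_pairs.
  apply: leq_trans (subset_leq_card (subsetDl _ _)) _.
  by apply: leq_trans cD (leq_trans _ HN2); apply: dec_bound_le.
rewrite /dom vld /= v1 vD; set U := [set u | _ || _].
pose P := [set A | (A != set0) && [exists v, trace e D0 v == A]].
pose HA A := [set h in H :\: D | trace e D0 h == A].
have al c : allowed e r L (s1, s2) c = list2 e r L D0 (colclass col D) D c.
  by rewrite /allowed v1 vD; apply: eq_list2.
have subP A u : u \in solve j (sublists e k r L (s1, s2) A) ->
    [/\ u \notin D, trace e D0 u = A & exists c, u \in allowed e r L (s1, s2) c].
  case/(sv_trace (solve_sound w k r N1 N2 esym j)) => c [uA]; rewrite /= v1 => tu.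
  split=> //; last by exists c.
  by move: uA; rewrite al inE => /andP[+ _]; rewrite inE => /and4P[].
have HAle A : A \in P -> wt w (HA A) <= wt w (solve j (sublists e k r L (s1, s2) A)).
  rewrite inE => /andP[/set0Pn[d dA] /existsP[v0 /eqP tv0]].
  have d0 : d \in D0 by move: dA; rewrite -tv0 inE => /andP[].
  apply: IH; first by rewrite size_map size_iota.
    (* The lost colour is that of a vertex [d] of the trace: every vertex in the sublists is
       adjacent to [d], and candidates have no guessed neighbour of their own colour. *)
    rewrite -ltnS; apply: leq_trans pL; apply: proper_card; apply/properP; split.
      apply/subsetP => c; rewrite !inE => /set0Pn[u]; rewrite nth_sublists inE => /and3P[_ uA _].
      by apply/set0Pn; exists u; move: uA; rewrite al inE => /andP[+ _]; rewrite inE => /and4P[].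
    have dH0 := subsetP sD0 _ d0.
    exists (Ordinal (Hk _ dH0)); rewrite inE /=.
      by apply/set0Pn; exists d; apply: (proj1 lc).
    rewrite negbK; apply/eqP/setP => u; rewrite nth_sublists in_set in_set0.
    apply/negP => /and3P[_ uA /eqP tu]; rewrite /= v1 in tu.
    move: uA; rewrite al inE => /andP[+ _]; rewrite inE => /and4P[_ _ /forallP/(_ d) + _].
    rewrite inE (subsetP sD) // eqxx /=; apply/negP; rewrite negbK.
    by move: dA; rewrite -tu inE => /andP[].
  exists col; split=> [h|x y].
    rewrite inE => /andP[/setDP[hH hD] /eqP th].
    by rewrite nth_sublists inE Hk // al HD //= v1 th eqxx.
  rewrite !inE => /andP[/andP[_ xH] _] /andP[/andP[_ yH] _]; exact: (proj2 lc).
have cov : H :\: D \subset \bigcup_(A in P) HA A.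
  apply/subsetP => h hHD; apply/bigcupP; exists (trace e D0 h); last by rewrite inE hHD eqxx.
  rewrite inE; apply/andP; split; last by apply/existsP; exists h.
  case/setDP: hHD => hH hD; case/nbP: (subsetP dH _ hH) => [h0|[d dD hd]].
    by rewrite (subsetP sD) in hD.
  by apply/set0Pn; exists d; rewrite inE dD hd.
rewrite (wtID w H D) (wtID w U D); apply: leq_add.
  apply: wtS; rewrite (setIidPr sDH) subsetI subxx andbT; apply/subsetP => u uD.
  by rewrite inE uD.
apply: leq_trans (wtS w cov) (leq_trans (wt_bigcup_le _ _ _) _).
apply: leq_trans (leq_sum _ HAle) _; apply: wt_bigcup_disjoint => [A B _ _ ne|A].
  rewrite -setI_eq0; apply/eqP/setP => u; rewrite in_setI in_set0; apply/negP.
  by case/andP=> /subP[_ tA _] /subP[_ tB _]; rewrite -tA -tB eqxx in ne.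
rewrite inE => /andP[A0 /existsP[v /eqP tv]]; apply/subsetP => u uS.
have [uD _ _] := subP _ _ uS; rewrite in_setD uD inE (negPf uD) /=.
by apply/existsP; exists v; rewrite tv A0.
Qed.

Lemma interiorP L D x : reflect [/\ x \in act L, x \in nb e D &
  forall y, y \in act L -> y \notin nb e D -> ~~ e y x] (x \in interior e L D).
Proof.
rewrite [x \in interior _ _ _]in_set; apply: (iffP and3P) => -[xL xD H]; split=> //.
  by move=> y yL yD; apply: (implyP (forallP H y)); rewrite yL.
by apply/forallP => y; apply/implyP => /andP[]; apply: H.
Qed.

(** By [isolate] and [dom_ge], each component of the solution has a piece that is at least as heavy.
    The pieces of different components do not touch, so they are independent in the graph of
    pieces. *)
Lemma blob_ge j L H : solves j -> size L = k -> pal L <= j.+1 -> ~ p5in e (act L) ->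
  lcolourable e L H -> wt w H <= wt w (blob_union e w (pieces e k r N1 N2 (solve j) L)).
Proof.
move=> IH sL pL no5 [col lc]; set cs := pieces _ _ _ _ _ _ _.
pose P := [set component e H u | u in H].
have snd := solve_sound w k r N1 N2 esym j.
have HP C : exists q : {set T} * {set T}, C \in P ->
    [/\ q.1 \subset C, q.2 \in cs, q.2 \subset interior e L q.1 & wt w C <= wt w q.2].
  have [/imsetP[u uH EC]|_] := boolP (C \in P); last by exists (set0, set0).
  have uC : u \in C by rewrite EC; apply: comp_self.
  have sCH : C \subset H by rewrite EC; apply: comp_sub.
  have cC : conn e C by rewrite EC; apply: conn_comp.
  have lcC := lcolS sCH lc.
  have kc := lcol_kcol lcC; rewrite sL in kc.
  have [D [sD [cD uD] dC cardD sep]] := isolate esym eirr cC uC (lcol_act lcC) kc no5.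
  have sCI : C \subset interior e L D.
    apply/subsetP => x xC; apply/interiorP; split=> [||y yL yD].
    - exact: (subsetP (lcol_act lcC)).
    - exact: (subsetP dC).
    - by rewrite esym; apply: sep.
  have [|||g [gG vg vld wg]] := @dom_ge j (restr L (interior e L D)) col C D IH _ _ (lcol_restr lcC sCI) sD dC.
  - by rewrite size_map.
  - exact: leq_trans (pal_restr _ _) pL.
  - by apply: leq_trans cardD (leq_trans _ N1c); rewrite leq_pmull.
  exists (D, dom e k r (solve j) (restr L (interior e L D)) g) => _; split=> //=.
    apply/mapP; exists g; rewrite ?vg // mem_filter gG andbT vg; apply/and3P; split=> //.
      by apply/set0Pn; exists u.
    by apply/forallP => x; apply/implyP => xD; apply: comp_conn_sub.
  exact: dom_interior.
have [q Hq] := fin_all_exists HP.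
have unt C C' : C \in P -> C' \in P -> C != C' -> ~~ touch e (q C).2 (q C').2.
  move=> CP C'P ne; have [s1 _ i1 _] := Hq _ CP; have [s2 _ i2 _] := Hq _ C'P.
  have nt : ~~ touch e C C'.
    by case/imsetP: CP ne => u _ ->; case/imsetP: C'P => v _ ->; apply: comp_untouch.
  have sub C1 x : C1 \in P -> x \in C1 -> x \in act L.
    by case/imsetP=> u _ -> /(subsetP (comp_sub _ _ _)); apply: (subsetP (lcol_act lc)).
  (* The components do not touch, so the dominating set of [C] consists of active vertices outside
     the closed neighbourhood of that of [C'], and the interior of the latter has no neighbour
     there. *)
  have sep y : y \in (q C').2 -> y \notin nb e (q C).1.
    move=> /(subsetP i2)/interiorP[yL yn ynb]; apply/nbP => yD.
    have dn d : d \in (q C).1 -> d \in act L /\ d \notin nb e (q C').1.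
      move=> /(subsetP s1) dC; split; first exact: sub dC.
      by apply: contra nt => dn; apply/existsP; exists d; rewrite dC (subsetP (nbS e s2)).
    case: yD => [/dn[_]|[d /dn[dL dn'] yd]]; first by rewrite yn.
    by have := ynb d dL dn'; rewrite esym yd.
  apply/touchPn => x y /(subsetP i1)/interiorP[xL xn xnb] yS.
  have yn := sep _ yS; have /interiorP[yL _ _] := subsetP i2 _ yS.
  rewrite esym xnb // andbT; by apply: contraNneq yn => <-.
(* Pieces may repeat in [cs]; the first index of each picks one copy. *)
pose J := [set i : 'I_(size cs) | [exists C, (C \in P) && (i == index (q C).2 cs :> nat)]].
have JP i : i \in J -> exists2 C, C \in P & nth set0 cs i = (q C).2.
  rewrite inE => /existsP[C /andP[CP /eqP->]]; exists C => //.
  by rewrite nth_index //; have [] := Hq _ CP.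
have indJ : indep (@blob_adj _ e cs) J.
  move=> i i' iJ i'J; rewrite /blob_adj.
  case/JP: (iJ) => C CP EC; case/JP: (i'J) => C' C'P EC'; rewrite EC EC'.
  have [EE|ne] := eqVneq C C'; last by rewrite negb_and unt ?orbT.
  move: iJ i'J; rewrite !inE => /existsP[A /andP[AP /eqP iA]] /existsP[B /andP[BP /eqP iB]].
  have [AB|ne] := eqVneq A B.
    by rewrite negb_and negbK; apply/orP; left; apply/eqP/val_inj; rewrite /= iA iB AB.
  have [_ Aq _ _] := Hq _ AP; have [_ Bq _ _] := Hq _ BP.
  have := unt _ _ AP BP ne; rewrite -(nth_index set0 Aq) -(nth_index set0 Bq) -iA -iB EC EC'.
  by move=> nt; rewrite negb_and nt orbT.
have no5b : ~ p5in (@blob_adj _ e cs) setT.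
  by apply: (blob_p5free esym no5) => B /(pieceP esym snd)[].
have := mwis_max (@blob_wt _ w cs) (blob_sym esym) (@blob_irr _ e cs) no5b indJ.
move=> le_mw; apply: (@leq_trans (\sum_(C in P) wt w (q C).2)).
  apply: (@leq_trans (\sum_(C in P) wt w C)); last by apply: leq_sum => C /Hq[].
  apply: leq_trans (wt_bigcup_le w P (fun C => C)); apply: wtS; apply/subsetP => x xH.
  by apply/bigcupP; exists (component e H x); [apply: imset_f | apply: comp_self].
apply: (@leq_trans (wt (@blob_wt _ w cs) J)).
  apply: leq_trans (wt_bigcup_le w J (fun i => nth set0 cs i)).
  apply: wt_bigcup_disjoint => [C C' CP C'P ne|C CP]; first exact: untouch_disjoint (unt _ _ CP C'P ne).
  have [_ Cq _ _] := Hq _ CP; have lt_i := Cq; rewrite -index_mem in lt_i.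
  apply: (@subset_trans _ _ _ _ _ (bigcup_sup (Ordinal lt_i) _)); first by rewrite /= nth_index.
  by rewrite inE; apply/existsP; exists C; rewrite CP /=.
apply: leq_trans le_mw _; apply: wt_bigcup_disjoint => [i i' iM i'M ne|i iM].
  exact: untouch_disjoint (blob_disjoint esym iM i'M ne).
by apply/subsetP => v vi; rewrite in_set; apply/existsP; exists i; rewrite iM.
Qed.

Lemma solveS j L : solve j.+1 L = best w ([seq dom e k r (solve j) L g | g <- guesses] ++
    [seq [set v | (v \in dom e k r (solve j) (restr L (interior e L (verts g.1))) g) ||
        (v \in blob_union e w (pieces e k r N1 N2 (solve j) (restr L (outside e (verts g.1)))))] |
      g <- guesses]).
Proof. by []. Qed.

(** The number [r.+1] is chosen so that each selected component has [r] representatives in the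
    others; far from these the graph is P5-free and [isolate] applies. All representatives belong to
    [D], so whatever lies outside N[D] is far from them. This confines the selected components to
    [interior] and makes the outside P5-free for [blob_ge]. *)
Lemma solve_many j L col H : solves j -> size L = k -> pal L <= j.+1 -> lcol e L col H ->
  r < #|[set component e H u | u in H]| -> wt w H <= wt w (solve j.+1 L).
Proof.
move=> IH sL pL lc lt_r; set P0 := imset _ _ in lt_r.
have snd := solve_sound w k r N1 N2 esym j.
pose P := firstn r.+1 P0.
have cP : #|P| = r.+1 by rewrite card_firstn; apply/minn_idPl.
have PP C : C \in P -> [/\ C \subset H, conn e C & exists2 u, u \in C & C = component e H u].
  move=> /(subsetP (firstn_sub _ _))/imsetP[u uH ->]; split; [exact: comp_sub|exact: conn_comp|].
  by exists u => //; apply: comp_self.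
have repP C : exists u, C \in P -> u \in C.
  have [/PP[_ _ [u uC _]]|_] := boolP (C \in P); first by exists u.
  have [C0 C0P] : exists C0, C0 \in P by apply/card_gt0P; rewrite cP.
  by have [_ _ [u _ _]] := PP _ C0P; exists u.
have [rep Hrep] := fin_all_exists repP.
have unt C C' : C \in P -> C' \in P -> C != C' -> ~~ touch e C C'.
  move=> /PP[_ _ [u _ ->]] /PP[_ _ [v _ ->]]; exact: comp_untouch.
have na C C' x y : C \in P -> C' \in P -> C != C' -> x \in C -> y \in C' -> ~~ e x y.
  by move=> CP C'P ne xC yC; have /touchPn/(_ x y xC yC)/andP[] := unt _ _ CP C'P ne.
have repE C x : C \in P -> x \in C -> C = component e H x.
  by move=> /PP[_ _ [u _ ->]] xC; rewrite (comp_mem esym xC).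
pose J C := [set rep C' | C' in P :\ C].
have cJ C : C \in P -> #|J C| = r.
  move=> CP; rewrite card_in_imset; first by have := cardsD1 C P; rewrite CP cP => -[].
  move=> A B /setD1P[_ AP] /setD1P[_ BP] E.
  by rewrite (repE _ _ AP (Hrep _ AP)) E -(repE _ _ BP (Hrep _ BP)).
have iJ C x y : x \in J C -> y \in J C -> ~~ e x y.
  case/imsetP=> A /setD1P[_ AP] -> /imsetP[B /setD1P[_ BP] ->].
  have [->|ne] := eqVneq A B; first by rewrite eirr.
  by apply: (na A B); rewrite ?Hrep.
have HD C : exists D, C \in P -> [/\ D \subset C, rep C \in D, C \subset nb e D,
    #|D| <= 1 + 2 * (k * k) + k + k &
    forall x y, x \in C -> y \in act L -> y \in far e (J C) -> y \notin nb e D -> ~~ e x y].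
  have [CP|_] := boolP (C \in P); last by exists set0.
  have [sCH cC _] := PP _ CP; have lcC := lcolS sCH lc.
  have kc := lcol_kcol lcC; rewrite sL in kc.
  have sCF : C \subset act L :&: far e (J C).
    rewrite subsetI (lcol_act lcC); apply/subsetP => x xC; apply/farP => _ /imsetP[B /setD1P[ne BP] ->].
    exact: na BP CP ne (Hrep _ BP) xC.
  have no5 : ~ p5in e (act L :&: far e (J C)).
    by move=> h5; apply: (Hfree (cJ _ CP) (@iJ C)); apply: p5inS h5; apply: subsetIr.
  have [D [sD [cD uD] dC cardD sep]] := isolate esym eirr cC (Hrep _ CP) sCF kc no5.
  by exists D => _; split=> // x y xC yL yJ; apply: sep => //; rewrite in_setI yL.
have [DD HDD] := fin_all_exists HD.
pose D := \bigcup_(C in P) DD C.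
have sDD C : C \in P -> DD C \subset D by move=> CP; apply: bigcup_sup.
have cardD : #|D| <= N1.
  apply: leq_trans (card_bigcup_le (m := 1 + 2 * (k * k) + k + k) _) _; first by move=> C /HDD[].
  by rewrite cP.
have farJ C y : C \in P -> y \notin nb e D -> y \in far e (J C).
  move=> CP /notin_nb[_ yD]; apply/farP => _ /imsetP[B /setD1P[ne BP] ->].
  by rewrite esym; apply: yD; apply: (subsetP (sDD _ BP)); have [] := HDD _ BP.
pose H1 := cover P; pose H0 := H :\: H1.
have sH1 : H1 \subset H by apply/bigcupsP => C /PP[].
have dH1 : H1 \subset nb e D.
  apply/bigcupsP => C CP; have [_ _ s _ _] := HDD _ CP.
  exact: subset_trans s (nbS e (sDD _ CP)).
have sD1 : D \subset H1.
  by apply/bigcupsP => C CP; have [s _ _ _ _] := HDD _ CP; apply: subset_trans s (bigcup_sup _ _).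
have sI1 : H1 \subset interior e L D.
  apply/subsetP => x xH1; apply/interiorP; split; [|exact: (subsetP dH1)|].
    exact: subsetP (lcol_act lc) _ (subsetP sH1 _ xH1).
  move=> y yL yD; case/bigcupP: xH1 => C CP xC; rewrite esym.
  have [_ _ _ _ sep] := HDD _ CP; apply: sep => //; first exact: farJ.
  by apply: contra yD; apply: (subsetP (nbS e (sDD _ CP))).
have sO : H0 \subset outside e D.
  apply/subsetP => h /setDP[hH hH1]; rewrite in_set; apply: contra hH1.
  case/nbP => [/(subsetP sD1)//|[d dD hd]].
  have /bigcupP[C CP dC] := subsetP sD1 _ dD; apply/bigcupP; exists C => //.
  have EC := repE _ _ CP dC; rewrite EC in dC *.
  by apply: (comp_closed dC hH); rewrite esym.
have [|||g [gG vg vld wg]] := @dom_ge j (restr L (interior e L D)) col H1 D IH _ _ (lcol_restr (lcolS sH1 lc) sI1) sD1 dH1.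
- by rewrite size_map.
- exact: leq_trans (pal_restr _ _) pL.
- by [].
have no5 : ~ p5in e (act (restr L (outside e D))).
  have [C CP] : exists C, C \in P by apply/card_gt0P; rewrite cP.
  move=> h5; apply: (Hfree (cJ _ CP) (@iJ C)); apply: p5inS h5.
  apply: subset_trans (act_restr _ _) _; apply/subsetP => y; rewrite in_set.
  exact: farJ.
have wb : wt w H0 <= wt w (blob_union e w (pieces e k r N1 N2 (solve j) (restr L (outside e D)))).
  apply: blob_ge => //; first by rewrite size_map.
    exact: leq_trans (pal_restr _ _) pL.
  by exists col; apply: lcol_restr sO; apply: lcolS lc; apply: subsetDl.
set U := blob_union _ _ _ in wb; set S := dom _ _ _ _ _ _ in wg.
apply: (@leq_trans (wt w (S :|: U))); last first.
  rewrite solveS; apply: best_max; rewrite mem_cat; apply/orP; right; apply/mapP.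
  exists g; first exact: gG.
  by rewrite vg; apply/setP => v; rewrite in_setU in_set.
rewrite wt_disjointU; first by rewrite (wtID w H H1) (setIidPr sH1) leq_add.
have sS : S \subset nb e D.
  by apply: subset_trans (dom_interior k r esym L g D snd) (interior_nb _ _ _).
have [c0 lcU] : lcolourable e (restr L (outside e D)) U.
  by apply: blob_union_sound => // S' /(pieceP esym snd)[].
have sU := subset_trans (lcol_act lcU) (act_restr _ _).
rewrite -setI_eq0; apply/eqP/setP => v; rewrite in_setI in_set0; apply/negP => /andP[vS vU].
by have := subsetP sU _ vU; rewrite in_set (subsetP sS).
Qed.

Lemma solve_dominated j L col H D : solves j -> size L = k -> pal L <= j.+1 ->
  lcol e L col H -> D \subset H -> H \subset nb e D -> #|D| <= N1 ->
  wt w H <= wt w (solve j.+1 L).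
Proof.
move=> IH sL pL lc sD dH cD; have [g [gG _ _ wg]] := dom_ge IH sL pL lc sD dH cD.
apply: leq_trans wg _; rewrite solveS; apply: best_max; rewrite mem_cat; apply/orP; left.
by apply/mapP; exists g.
Qed.

Lemma solve_ge j : solves j.
Proof.
elim: j => [|j IH] L H sL pL [col lc]; have [Hk _] := lcol_kcol lc.
  (* With no colour left all lists are empty. *)
  suff -> : H = set0 by rewrite wt_set0.
  apply/eqP; rewrite -subset0; apply/subsetP => h hH.
  rewrite sL in Hk; move: pL; rewrite leqn0 => /eqP/card0_eq/(_ (Ordinal (Hk _ hH))).
  by rewrite inE /= => /negbFE/eqP E; have := proj1 lc _ hH; rewrite E.
have kc := lcol_kcol lc; rewrite sL in kc Hk.
have [le_r|lt_r] := leqP #|[set component e H u | u in H]| r; last exact: solve_many lc lt_r.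
have [[a [b [c [d [f [/and5P[aH bH cH dH fH] p5H]]]]]]|no5] := p5in_dec e H.
  pose K := [set a; b; c; d; f].
  have sK : K \subset H by rewrite !subUset !sub1set aH bH cH dH fH.
  pose R := H :\: nb e K.
  (* [r] vertices of one colour outside the closed neighbourhood of the path would extend it to the
     forbidden graph. *)
  have cl c0 : #|colclass col R c0| <= r.
    rewrite leqNgt; apply/negP => lt_c.
    pose J := firstn r (colclass col R c0).
    have cJ : #|J| = r by rewrite card_firstn; apply/minn_idPl/ltnW.
    have JP x : x \in J -> [/\ x \in H, x \notin nb e K & col x = c0].
      by move=> /(subsetP (firstn_sub _ _)); rewrite in_set => /andP[/setDP[? ?] /eqP].
    apply: (Hfree cJ) => [x y /JP[xH _ xc] /JP[yH _ yc]|].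
      by apply: kcol_nadj kc xH yH _; rewrite xc yc.
    have KF z : z \in K -> z \in far e J.
      by move=> zK; apply/farP => x /JP[_ /notin_nb[_ nx] _]; apply: nx.
    exists a, b, c, d, f; split=> //; apply/and5P.
    by split; apply: KF; rewrite !inE eqxx ?orbT.
  apply: (solve_dominated (D := K :|: R) IH sL pL lc).
  - by rewrite subUset sK subsetDl.
  - apply/subsetP => h hH; have [hK|hK] := boolP (h \in nb e K).
      by apply: (subsetP (nbS e (subsetUl K R))).
    by apply: (subsetP (nb_sub e (K :|: R))); rewrite in_setU in_setD hK hH orbT.
  - apply: leq_trans (leq_of_leqif (leq_card_setU _ _)) (leq_trans _ N1a); apply: leq_add.
      apply: leq_trans (leq_of_leqif (leq_card_setU _ _)) _; rewrite cards1 (leq_add (n1 := 4)) //.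
      apply: leq_trans (leq_of_leqif (leq_card_setU _ _)) _; rewrite cards1 (leq_add (n1 := 3)) //.
      by apply: leq_trans (leq_of_leqif (leq_card_setU _ _)) _; rewrite cards1 cards2; case: (_ != _).
    have sR : R \subset \bigcup_(i in [set: 'I_k]) colclass col R i.
      apply/subsetP => x xR; have xH : x \in H by case/setDP: xR.
      by apply/bigcupP; exists (Ordinal (Hk _ xH)); rewrite // in_set xR eqxx.
    apply: leq_trans (subset_leq_card sR) (leq_trans (card_bigcup_le (m := r) _) _) => [i _|].
      exact: cl.
    by rewrite cardsT card_ord.
set P := imset _ _ in le_r.
have HD C : exists D, C \in P -> [/\ D \subset C, C \subset nb e D & #|D| <= 1 + 2 * (k * k)].
  have [/imsetP[u uH ->]|_] := boolP (C \in P); last by exists set0.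
  have sC := comp_sub e H u.
  have [D [sD _ _ dC cD]] := conn_dominating esym (@conn_comp _ _ esym H u) (comp_self e uH) (kcolS sC kc)
    (fun h5 => no5 (p5inS sC h5)).
  by exists D.
have [DD HDD] := fin_all_exists HD.
apply: (solve_dominated (D := \bigcup_(C in P) DD C) IH sL pL lc).
- apply/bigcupsP => C CP; have [s _ _] := HDD _ CP; apply: subset_trans s _.
  by case/imsetP: CP => u _ ->; apply: comp_sub.
- apply/subsetP => h hH; have hP : component e H h \in P by apply: imset_f.
  have [_ s _] := HDD _ hP; apply: (subsetP (nbS e (bigcup_sup _ hP))).
  by apply: (subsetP s); apply: comp_self.
- apply: leq_trans (card_bigcup_le (m := 1 + 2 * (k * k)) _) _; first by move=> C /HDD[].
  by apply: leq_trans N1b; rewrite leq_mul2r le_r orbT.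
Qed.

End Complete.

(** * Running time *)

Section Combinators.
Variables (E : Type) (a : E -> tree).

(** The curried form of [ptime_foldl]: accumulator and element are two nested bound variables, a
    shape that the tactic [pt] can handle. *)
Lemma ptime_fold (A B : E -> Type) (encA : forall x, A x -> tree) (encB : forall x, B x -> tree)
    (step : forall x, A x -> B x -> A x) (z : forall x, A x) (l : forall x, seq (B x)) (S : E -> nat) :
  ptime a (fun x => enc_seq (@encB x) (l x)) -> ptime a (fun x => encA x (z x)) ->
  ptime (env (env a encA) (fun s : {x : E & A x} => @encB (tag s)))
    (fun s => encA _ (step _ (tagged (tag s)) (tagged s))) ->
  pbound a S ->
  (forall x i, tree_size (encA x (foldl (@step x) (z x) (take i (l x)))) <= S x) ->
  ptime a (fun x => encA x (foldl (@step x) (z x) (l x))).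
Proof.
move=> Hl Hz Hs HS Sb; apply: (ptime_foldl Hl Hz _ HS Sb).
pose f (s : {x : E & (A x * B x)%type}) :=
  existT (fun t : {x : E & A x} => B (tag t)) (existT A (tag s) (tagged s).1) (tagged s).2.
refine (@ptime_comp _ _ (fun s => env (env a encA) (fun t => @encB (tag t)) (f s)) _ _ (ptime_reindex f Hs)).
exact: (ptime_pair (ptime_pair (ptime_hd (ptime_id _)) (ptime_hd (ptime_tl (ptime_id _))))
  (ptime_tl (ptime_tl (ptime_id _)))).
Qed.

Lemma ptime_mkpair (A B : E -> Type) (encA : forall x, A x -> tree) (encB : forall x, B x -> tree)
    (u : forall x, A x) (v : forall x, B x) :
  ptime a (fun x => encA x (u x)) -> ptime a (fun x => encB x (v x)) ->
  ptime a (fun x => enc_pair (@encA x) (@encB x) (u x, v x)).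
Proof. exact: ptime_pair. Qed.

Lemma ptime_ife (A : E -> Type) (enc : forall x, A x -> tree) (p : E -> bool) (u v : forall x, A x) :
  ptime a (fun x => enc_bool (p x)) -> ptime a (fun x => enc x (u x)) ->
  ptime a (fun x => enc x (v x)) -> ptime a (fun x => enc x (if p x then u x else v x)).
Proof. by move=> Hp Hu Hv; apply: ptime_ext (ptime_if Hp Hu Hv) => x; case: ifP. Qed.

Lemma ptime_mapl (A B : E -> Type) (enc : forall x, A x -> tree) (enc' : forall x, B x -> tree)
    (f : forall x, A x -> B x) (l : forall x, seq (A x)) :
  ptime a (fun x => enc_seq (@enc x) (l x)) ->
  ptime (env a enc) (fun s => enc' _ (f _ (tagged s))) ->
  ptime a (fun x => enc_seq (@enc' x) [seq f x y | y <- l x]).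
Proof.
move=> Hl Hf; have := ptime_map (g := fun x y => enc' x (f x y)) Hl Hf.
by apply: ptime_ext => x; rewrite enc_seq_map.
Qed.

Lemma ptime_cons (A : E -> Type) (enc : forall x, A x -> tree) (u : forall x, A x) l :
  ptime a (fun x => enc x (u x)) -> ptime a (fun x => enc_seq (@enc x) (l x)) ->
  ptime a (fun x => enc_seq (@enc x) (u x :: l x)).
Proof. exact: ptime_pair. Qed.

Lemma ptime_count (A : E -> Type) (enc : forall x, A x -> tree) (p : forall x, A x -> bool) l :
  ptime a (fun x => enc_seq (@enc x) (l x)) ->
  ptime (env a enc) (fun s => enc_bool (p _ (tagged s))) ->
  ptime a (fun x => encn (count (p x) (l x))).
Proof.
move=> Hl Hp; have := ptime_size_seq (ptime_filter Hl Hp).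
by apply: ptime_ext => x; rewrite size_filter.
Qed.

End Combinators.

Lemma ptime_ifS E a (T : E -> finType) (p : E -> bool) (A B : forall x, {set T x}) :
  ptime a (fun x => enc_bool (p x)) -> ptime a (fun x => encS (A x)) ->
  ptime a (fun x => encS (B x)) -> ptime a (fun x => encS (if p x then A x else B x)).
Proof. exact: (ptime_ife (enc := fun x => @encS (T x))). Qed.

Ltac pt_split H :=
  lazymatch type of H with
  | ptime _ (fun s => @enc_pair _ _ _ _ _) =>
    let H1 := fresh "H" in let H2 := fresh "H" in
    pose proof (ptime_fst H) as H1; pose proof (ptime_snd H) as H2;
    cbv beta in H1, H2; pt_split H1; pt_split H2
  | _ => idtac
  end.

(** Going below a binder: known facts are weakened to the larger context, and the new variable is
    added, taken apart if it is a pair. *)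
Ltac pt_lift a enc :=
  repeat match goal with
  | H : ptime a ?g |- _ =>
    let H' := fresh "H" in pose proof (ptime_lift enc H) as H'; cbv beta in H'; clear H
  end;
  let H' := fresh "H" in pose proof (ptime_var a enc) as H'; cbv beta in H'; pt_split H'.

Ltac pt_under :=
  cbv beta; lazymatch goal with |- ptime (@env _ _ ?a ?enc) _ => pt_lift a enc end.

Ltac pt_under2 :=
  cbv beta; lazymatch goal with
  | |- ptime (@env _ _ (@env _ _ ?a ?enc) ?enc') _ =>
    pt_lift a enc; let a' := constr:(env a enc) in pt_lift a' enc'
  end.

Ltac pt_hyp := match goal with H : ptime ?a _ |- ptime ?a _ => refine H end.
Ltac pt_user := fail.
Ltac pt_eq := fail.
Ltac pt_mem := fail.

(** The goal is decomposed along the syntax of the encoded term. The order matters: an existential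
    quantifier is a negation and comes before [negb], and set comprehension is last because its
    pattern fits every set. [pt_user], [pt_eq] and [pt_mem] are redefined as more operations become
    available. *)
Ltac pt :=
  cbv beta;
  first [ match goal with H : ptime ?a ?g |- ptime ?a ?g => exact H end
  | lazymatch goal with |- ptime _ (fun s => ?t) => apply: ptime_const end
  | pt_user
  | lazymatch goal with
    | |- ptime _ (fun s => enc_bool (andb _ _)) => apply: ptime_andb; pt
    | |- ptime _ (fun s => enc_bool (orb _ _)) => apply: ptime_orb; pt
    | |- ptime _ (fun s => enc_bool (implb _ _)) => apply: ptime_implyb; pt
    | |- ptime _ (fun s => enc_bool (~~ FiniteQuant.quant0b _)) =>
      apply: ptime_exists; [pt | pt_under; pt]
    | |- ptime _ (fun s => enc_bool (FiniteQuant.quant0b _)) =>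
      apply: ptime_forall; [pt | pt_under; pt]
    | |- ptime _ (fun s => enc_bool (negb _)) => apply: ptime_negb; pt
    | |- ptime _ (fun s => enc_bool (has _ _)) => apply: ptime_has; [pt | pt_under; pt]
    | |- ptime _ (fun s => enc_bool (all _ _)) => apply: ptime_all; [pt | pt_under; pt]
    | |- ptime _ (fun s => enc_bool (if _ then _ else _)) => apply: ptime_ifb; pt
    | |- ptime _ (fun s => enc_bool (leq _ _)) => apply: ptime_leq; pt
    | |- ptime _ (fun s => enc_bool (eq_op _ _)) => pt_eq
    | |- ptime _ (fun s => enc_bool (in_mem _ _)) => pt_mem
    | |- ptime _ (fun s => encn (card _)) => apply: ptime_card; pt
    | |- ptime _ (fun s => encn (count _ _)) => apply: ptime_count; [pt | pt_under; pt]
    | |- ptime _ (fun s => encn (size _)) => apply: ptime_size_seq; pt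
    | |- ptime _ (fun s => enc_pair _ _ (_, _)) => apply: ptime_mkpair; pt
    | |- ptime _ (fun s => enc_seq _ (map _ _)) => apply: ptime_mapl; [pt | pt_under; pt]
    | |- ptime _ (fun s => enc_seq _ (filter _ _)) => apply: ptime_filter; [pt | pt_under; pt]
    | |- ptime _ (fun s => enc_seq _ (cat _ _)) => apply: ptime_cat; pt
    | |- ptime _ (fun s => enc_seq _ (flatten _)) => apply: ptime_flatten; pt
    | |- ptime _ (fun s => enc_seq _ (cons _ _)) => apply: ptime_cons; pt
    | |- ptime _ (fun s => encS (if _ then _ else _)) => apply: ptime_ifS; pt
    end
  | pt_hyp
  | match goal with H : ptime ?a (fun s => encG _) |- ptime ?a (fun s => enc_bool _) =>
      apply: (ptime_adj H); pt end
  | lazymatch goal with |- ptime _ (fun s => encS _) =>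
      apply: ptime_set; [pt | pt_under; pt] end ].

Ltac pt_eq ::= first [ solve [apply: ptime_eqv; pt] | solve [apply: ptime_eqn; pt] ].
Ltac pt_mem ::= solve [apply: ptime_mem; pt].

Section SetOps.
Variables (E : Type) (a : E -> tree) (T : E -> finType).
Hypothesis HV : ptime a (fun x => enc_seq (@encv (T x)) (enum (T x))).

Lemma ptime_memseq (s : forall x, seq (T x)) (v : forall x, T x) :
  ptime a (fun x => enc_seq (@encv (T x)) (s x)) -> ptime a (fun x => encv (v x)) ->
  ptime a (fun x => enc_bool (v x \in s x)).
Proof.
move=> Hs Hv; apply: (ptime_ext (g := fun x => enc_bool (has (fun u => v x == u) (s x)))); last by pt.
move=> x; congr enc_bool; apply/hasP/idP => [[u us /eqP->]|vs] //.
by exists (v x).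
Qed.

Lemma ptime_eqS (A B : forall x, {set T x}) : ptime a (fun x => encS (A x)) ->
  ptime a (fun x => encS (B x)) -> ptime a (fun x => enc_bool (A x == B x)).
Proof.
move=> HA HB; apply: (ptime_ext (g := fun x => enc_bool [forall v,
  ((v \in A x) ==> (v \in B x)) && ((v \in B x) ==> (v \in A x))])); last by pt.
move=> x; congr enc_bool; apply/forallP/eqP => [H|-> v]; last by rewrite implybb.
by apply/setP => v; have := H v; case: (v \in A x); case: (v \in B x).
Qed.

Lemma ptime_subset (A B : forall x, {set T x}) : ptime a (fun x => encS (A x)) ->
  ptime a (fun x => encS (B x)) -> ptime a (fun x => enc_bool (A x \subset B x)).
Proof.
move=> HA HB; apply: (ptime_ext (g := fun x => enc_bool [forall v, (v \in A x) ==> (v \in B x)])); last by pt.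
by move=> x; congr enc_bool; apply/forallP/subsetP => H v; [apply/implyP/H | apply/implyP/H].
Qed.

Lemma ptime_set0 : ptime a (fun x => encS (set0 : {set T x})).
Proof.
apply: (ptime_ext (g := fun x => encS [set v : T x | false])); last by pt.
by move=> x; congr encS; apply/setP => v; rewrite !inE.
Qed.

Lemma ptime_set1 (v : forall x, T x) : ptime a (fun x => encv (v x)) ->
  ptime a (fun x => encS [set v x]).
Proof.
move=> Hv; apply: (ptime_ext (g := fun x => encS [set u | u == v x])); last by pt.
by move=> x; congr encS; apply/setP => u; rewrite !inE.
Qed.

Lemma ptime_setD (A B : forall x, {set T x}) : ptime a (fun x => encS (A x)) ->
  ptime a (fun x => encS (B x)) -> ptime a (fun x => encS (A x :\: B x)).
Proof.
move=> HA HB; apply: (ptime_ext (g := fun x => encS [set u | (u \notin B x) && (u \in A x)])); last by pt.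
by move=> x; congr encS; apply/setP => u; rewrite !inE.
Qed.

(** A characteristic vector has a size bound that does not depend on the set, which settles the size
    condition of folds that accumulate a set. *)
Lemma pbound_encS : exists2 K, pbound a K & forall x (S : {set T x}), tree_size (encS S) <= K x.
Proof.
exists (fun x => tree_size (enc_seq (@encv (T x)) (enum (T x))) * 4 + 1).
  by apply: pbound_add (pbound_const _ _); apply: pbound_mul (pbound_const _ _); apply: ptime_size.
move=> x S; apply: leq_trans (size_encS S) _; rewrite leq_add2r leq_mul2r /=.
by rewrite size_enc_seq; lia.
Qed.

(** The vertex list serves as a clock for the iteration. *)
Lemma ptime_iter (A : E -> Type) (enc : forall x, A x -> tree) (f : forall x, A x -> A x)
    (z : forall x, A x) S :
  ptime a (fun x => enc x (z x)) -> ptime (env a enc) (fun s => enc _ (f _ (tagged s))) ->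
  pbound a S -> (forall x i, tree_size (enc x (iter i (f x) (z x))) <= S x) ->
  ptime a (fun x => enc x (iter #|T x| (f x) (z x))).
Proof.
move=> Hz Hf HS Sb.
have E1 x (s : seq (T x)) : foldl (fun acc _ => f x acc) (z x) s = iter (size s) (f x) (z x).
  elim: s (z x) => //= _ s IH y; rewrite IH -iterSr //.
apply: (ptime_ext (g := fun x => enc x (foldl (fun acc _ => f x acc) (z x) (enum (T x))))).
  by move=> x; rewrite E1 cardT.
apply: (ptime_fold (step := fun x acc _ => f x acc) HV Hz _ HS); last by move=> x i; rewrite E1.
exact: (ptime_lift _ Hf).
Qed.

Lemma ptime_fixset (F : forall x, {set T x} -> {set T x}) :
  ptime (env a (fun x => @encS (T x))) (fun s => encS (F _ (tagged s))) ->
  ptime a (fun x => encS (fixset (F x))).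
Proof.
move=> HF; have [K HK KB] := pbound_encS.
by apply: (ptime_iter (f := F) ptime_set0 HF HK) => x i; apply: KB.
Qed.

End SetOps.

(** * Binary addition and comparison of weights *)

Definition bval : seq bool -> nat := foldr (fun (b : bool) n => b + n.*2) 0.

Lemma bval_cat s t : bval (s ++ t) = bval s + 2 ^ size s * bval t.
Proof. by elim: s => [|b s IH] /=; rewrite ?mul1n // IH expnS; lia. Qed.

Lemma bitsS m : 0 < m -> bits m = odd m :: bits m./2.
Proof.
move=> m0; rewrite /bits up_log2S // /mkseq /= divn1; congr (_ :: _).
rewrite (iotaDl 1 0) -map_comp; apply: eq_map => i /=.
by rewrite add1n expnS divnMA divn2.
Qed.

Lemma bits0 : bits 0 = [::]. Proof. by []. Qed.

(** A zero is dropped as long as no more significant digit has been kept, which produces the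
    canonical form of [bits]. *)
Definition strip_step (acc : seq bool) (b : bool) := if b || ~~ nilp acc then b :: acc else [::].
Definition strip : seq bool -> seq bool := foldr (fun b acc => strip_step acc b) [::].

Lemma bits_bval s : bits (bval s) = strip s.
Proof.
elim: s => //= b s IH; rewrite /strip_step; have [E0|pos] := posnP (bval s).
  by rewrite -IH E0 bits0; case: b.
rewrite bitsS; last by lia.
rewrite -IH (bitsS pos) orbT; congr (_ :: _); first by rewrite oddD odd_double addbF oddb.
by rewrite halfD odd_double half_double andbF; case: (b); rewrite bitsS.
Qed.

Lemma bval_bits m : bval (bits m) = m.
Proof.
elim/ltn_ind: m => -[|m] IH //; rewrite bitsS //= IH; last by lia.
by rewrite -[RHS]odd_double_half.
Qed.

Lemma size_bits m : size (bits m) = up_log 2 m.+1. Proof. exact: size_mkseq. Qed.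

Lemma size_bitsD m n : size (bits (m + n)) <= size (bits m) + size (bits n).
Proof.
rewrite !size_bits; apply: up_log_min => //; rewrite expnD.
have := @up_logP 2 m.+1 isT; have := @up_logP 2 n.+1 isT; nia.
Qed.

Lemma size_enc_bits (s : seq bool) : size s < tree_size (enc_seq enc_bool s) <= (size s * 4).+1.
Proof.
rewrite size_enc_seq; apply/andP; split; first by lia.
by elim: s => [|b s IH]; rewrite ?big_nil // big_cons /=; case: b => /=; lia.
Qed.

(** A full adder; the state holds the unread digits of the second number, the carry and the reversed
    sum. Equal digits emit the old carry and become the new one, different digits emit its negation
    and keep it. *)
Definition add_step (st : seq bool * bool * seq bool) (b : bool) :=
  (behead st.1.1, (if b == head false st.1.1 then b else st.1.2),
   (if b == head false st.1.1 then st.1.2 else ~~ st.1.2) :: st.2).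

Lemma add_stepsP s st : let st' := foldl add_step st s in
  [/\ size st'.2 = size st.2 + size s, st'.1.1 = drop (size s) st.1.1 &
    bval (rev st'.2) + 2 ^ size st'.2 * (st'.1.2 + bval st'.1.1) =
    bval (rev st.2) + 2 ^ size st.2 * (bval s + bval st.1.1 + st.1.2)].
Proof.
elim: s st => [|b s IH] st /=; first by rewrite addn0 drop0; split=> //; lia.
case: (IH (add_step st b)) => -> -> ->; case: st => [[y c] out]; rewrite /add_step /=.
split; [lia | by case: y => // d y; rewrite /= ?drop0 | ].
rewrite rev_cons -cats1 bval_cat size_rev expnS /=.
by case: y => [|d y] /=; case: b; case: c; try (case: d); rewrite /=; nia.
Qed.

Definition add_state x y := foldl add_step (y, false, [::]) (x ++ nseq (size y) false).

(** The final carry is the most significant digit, so it heads the reversed sum; stripping from that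
    end restores the order at the same time. *)
Definition addbits x y := foldl strip_step [::] ((add_state x y).1.2 :: (add_state x y).2).

Lemma bval_nseq0 n : bval (nseq n false) = 0.
Proof. by elim: n => //= n ->. Qed.

Lemma foldl_strip l :
  foldl strip_step [::] l = strip (rev l).
Proof. by rewrite -{1}[l]revK foldl_rev. Qed.

Lemma addbitsP m n : addbits (bits m) (bits n) = bits (m + n).
Proof.
rewrite /addbits foldl_strip -bits_bval; set x := bits m; set y := bits n.
have [/= _ E1 E2] := add_stepsP (x ++ nseq (size y) false) (y, false, [::]).
rewrite -/(add_state x y) in E1 E2; set st := add_state _ _ in E1 E2 *.
congr bits; rewrite rev_cons -cats1 bval_cat size_rev /=.
move: E2; rewrite E1 drop_oversize ?size_cat ?size_nseq; last by lia.
by rewrite bval_cat bval_nseq0 !bval_bits /=; lia.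
Qed.

(** Digits come with the least significant first, so a later difference overrides an earlier one.
    The flag starts as the answer for equal numbers. *)
Definition le_step (st : seq bool * bool) (b : bool) :=
  (behead st.1, if b == head false st.1 then st.2 else head false st.1).

Lemma le_stepsP s y f : size y <= size s ->
  (foldl le_step (y, f) s).2 = if f then bval s <= bval y else bval s < bval y.
Proof.
elim: s y f => [|b s IH] [|d y] f //=; first by case: f.
- move=> _; rewrite /le_step /= IH //=; case: b => /=; first by case: f; lia.
  by case: f; lia.
- rewrite ltnS => le_ys; rewrite /le_step /= IH //; case: b; case: d; case: f => /=; lia.
Qed.

Section Arithmetic.
Variables (E : Type) (a : E -> tree).
Implicit Types s : E -> seq bool.
Notation encb := (enc_seq enc_bool).

Lemma ptime_behead s : ptime a (fun x => encb (s x)) -> ptime a (fun x => encb (behead (s x))).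
Proof. by move=> /ptime_tl; apply: ptime_ext => x; case: (s x). Qed.

Lemma ptime_headb s : ptime a (fun x => encb (s x)) -> ptime a (fun x => enc_bool (head false (s x))).
Proof. by move=> /ptime_hd; apply: ptime_ext => x; case: (s x). Qed.

Lemma ptime_nilp s : ptime a (fun x => encb (s x)) -> ptime a (fun x => enc_bool (nilp (s x))).
Proof.
move=> Hs; have := ptime_negb (ptime_has (p := fun=> xpredT) Hs (ptime_const _ _)).
by apply: ptime_ext => x; case: (s x).
Qed.

Lemma ptime_pad s s' : ptime a (fun x => encb (s x)) -> ptime a (fun x => encb (s' x)) ->
  ptime a (fun x => encb (s x ++ nseq (size (s' x)) false)).
Proof.
move=> Hs Hs'; apply: ptime_cat => //.
have := ptime_mapl (enc' := fun=> enc_bool) (f := fun=> fun=> false) Hs' (ptime_const _ _).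
by apply: ptime_ext => x; congr enc_seq; elim: (s' x) => //= b t ->.
Qed.

End Arithmetic.

Ltac pt_user ::= lazymatch goal with
  | |- ptime _ (fun s => enc_seq enc_bool (behead _)) => apply: ptime_behead; pt
  | |- ptime _ (fun s => enc_bool (head _ _)) => apply: ptime_headb; pt
  | |- ptime _ (fun s => enc_bool (nilp _)) => apply: ptime_nilp; pt
  | |- ptime _ (fun s => enc_seq enc_bool (if _ then _ else _)) =>
    refine (ptime_ife (enc := fun=> enc_seq enc_bool) _ _ _); pt
  end.
Ltac pt_eq ::= apply: ptime_eqb; pt.

Section Addition.
Variables (E : Type) (a : E -> tree).
Notation encb := (enc_seq enc_bool).

Notation enc2 := (enc_pair encb enc_bool).
Notation enc3 := (enc_pair enc2 encb).

Lemma pbound_bits (s : E -> seq bool) : ptime a (fun x => encb (s x)) -> pbound a (fun x => size (s x)).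
Proof.
move=> /ptime_size; apply: pbound_le => x.
by have /andP[/ltnW] := size_enc_bits (s x).
Qed.

Lemma ptime_addn (m n : E -> nat) : ptime a (fun x => enc_nat (m x)) ->
  ptime a (fun x => enc_nat (n x)) -> ptime a (fun x => enc_nat (m x + n x)).
Proof.
rewrite /enc_nat => Hm Hn.
apply: (ptime_ext (g := fun x => encb (addbits (bits (m x)) (bits (n x))))).
  by move=> x; rewrite addbitsP.
have Sm := pbound_bits Hm; have Sn := pbound_bits Hn; have Hp := ptime_pad Hm Hn.
have Sp := pbound_bits Hp.
pose K x := (size (bits (n x)) + size (bits (m x) ++ nseq (size (bits (n x))) false)) * 4 + 7.
have Hst : ptime a (fun x => enc3 (add_state (bits (m x)) (bits (n x)))).
  apply: (ptime_fold (encA := fun=> enc3) (step := fun=> add_step)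
    (z := fun x => (bits (n x), false, [::])) Hp (S := K)).
  - by pt.
  - by pt_under2; rewrite /add_step; pt.
  - apply: pbound_add (pbound_const _ _); apply: pbound_mul (pbound_const _ _); exact: pbound_add.
  move=> x i; set st := foldl _ _ _; have := add_stepsP (take i (bits (m x) ++ nseq (size (bits (n x))) false)) (bits (n x), false, [::]).
  rewrite -/st => -[/= E1 E2 _]; rewrite /enc_pair /K /=.
  have := size_enc_bits st.1.1; have := size_enc_bits st.2; rewrite E1 E2 size_drop.
  have := geq_minl i (size (bits (m x) ++ nseq (size (bits (n x))) false)).
  rewrite size_take_min; have := geq_minr i (size (bits (m x) ++ nseq (size (bits (n x))) false)).
  by case: (st.1.2) => /=; lia.
pt_split Hst.
rewrite /addbits.
pose K' x := K x * 4 + 5.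
apply: (ptime_fold (encA := fun=> encb) (step := fun=> strip_step) (z := fun=> [::])
  (l := fun x => (add_state (bits (m x)) (bits (n x))).1.2 :: (add_state (bits (m x)) (bits (n x))).2)
  (S := K')).
- by pt.
- by pt.
- by pt_under2; rewrite /strip_step; pt.
- apply: pbound_add (pbound_const _ _); apply: pbound_mul (pbound_const _ _).
  apply: pbound_add (pbound_const _ _); apply: pbound_mul (pbound_const _ _); exact: pbound_add.
move=> x i; set t := take i _.
have Ht : size t <= K x.
  rewrite /t size_take_min; apply: leq_trans (geq_minr _ _) _ => /=; rewrite /add_state.
  by have [/= -> _ _] := add_stepsP (bits (m x) ++ nseq (size (bits (n x))) false) (bits (n x), false, [::]); rewrite /K; lia.
have HF u acc : size (foldl strip_step acc u) <= size acc + size u.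
  elim: u acc => [|b u IH] acc /=; first by rewrite addn0.
  by apply: leq_trans (IH _) _; rewrite addnS -addSn leq_add2r /strip_step; case: ifP.
have /andP[_] := size_enc_bits (foldl strip_step [::] t); have := HF t [::]; rewrite /K' /=; lia.
Qed.

Lemma ptime_leqbits (m n : E -> nat) : ptime a (fun x => enc_nat (m x)) ->
  ptime a (fun x => enc_nat (n x)) -> ptime a (fun x => enc_bool (m x <= n x)).
Proof.
rewrite /enc_nat => Hm Hn.
have Sn := pbound_bits Hn; have Hp := ptime_pad Hm Hn.
have Hst : ptime a (fun x => enc2 (foldl le_step (bits (n x), true)
    (bits (m x) ++ nseq (size (bits (n x))) false))).
  apply: (ptime_fold (encA := fun=> enc2) (step := fun=> le_step)
    (z := fun x => (bits (n x), true)) Hp (S := fun x => size (bits (n x)) * 4 + 5)).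
  - by pt.
  - by pt_under2; rewrite /le_step; pt.
  - by apply: pbound_add (pbound_const _ _); apply: pbound_mul (pbound_const _ _).
  suff bnd t y f : tree_size (enc2 (foldl le_step (y, f) t)) <= size y * 4 + 5 by move=> x i; apply: bnd.
  elim: t y f => [|b t IH] y f /=.
    rewrite /enc_pair; have /andP[_ H1] := size_enc_bits y.
    have H2 : tree_size (enc_bool f) <= 3 by case: f.
    by change ((tree_size (encb y) + tree_size (enc_bool f)).+1 <= size y * 4 + 5); lia.
  by apply: leq_trans (IH _ _) _; rewrite /= size_behead leq_add2r leq_mul2r /= leq_pred.
pt_split Hst; move: H0; apply: ptime_ext => x.
by rewrite le_stepsP ?size_cat ?size_nseq ?leq_addl // bval_cat bval_nseq0 !bval_bits muln0 addn0.
Qed.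

End Addition.

Ltac pt_base :=
  lazymatch goal with
  | |- ptime ?a (fun s => enc_seq _ (enum _)) =>
    match goal with H : ptime a (fun s => enc_seq (@encv _) (enum _)) |- _ => refine H end
  | |- ptime _ (fun s => encS set0) => apply: ptime_set0; pt
  | |- ptime _ (fun s => encS (set1 _)) => apply: ptime_set1; pt
  | |- ptime _ (fun s => encS (setD _ _)) => apply: ptime_setD; pt
  | |- ptime _ (fun s => encS (fixset _)) => apply: ptime_fixset; [pt | pt_under; pt]
  | |- ptime _ (fun s => enc_bool (subset _ _)) => apply: ptime_subset; pt
  end.
Ltac pt_eq ::= first [ solve [apply: ptime_eqv; pt] | solve [apply: ptime_eqn; pt]
  | solve [apply: ptime_eqS; pt] ].
Ltac pt_user ::= pt_base.
Ltac pt_mem ::= first [ solve [apply: ptime_mem; pt] | solve [apply: ptime_memseq; pt] ].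

Section GraphOps.
Variables (E : Type) (a : E -> tree) (T : E -> finType) (e : forall x, rel (T x)).
Hypothesis HG : ptime a (fun x => encG (@e x)).
Implicit Types (A B D W : forall x, {set T x}).

Lemma ptime_nb D : ptime a (fun x => encS (D x)) -> ptime a (fun x => encS (nb (@e x) (D x))).
Proof. by have HV := ptime_enum HG; move=> HD; rewrite /nb; pt. Qed.

Lemma ptime_touch A B : ptime a (fun x => encS (A x)) -> ptime a (fun x => encS (B x)) ->
  ptime a (fun x => enc_bool (touch (@e x) (A x) (B x))).
Proof. by have HV := ptime_enum HG; move=> HA /ptime_nb HB; rewrite /touch; pt. Qed.

Lemma ptime_component W (u : forall x, T x) : ptime a (fun x => encS (W x)) ->
  ptime a (fun x => encv (u x)) -> ptime a (fun x => encS (component (@e x) (W x) (u x))).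
Proof. by have HV := ptime_enum HG; move=> HW Hu; rewrite /component /compF; pt. Qed.

Lemma ptime_hull (c u v : forall x, T x) : ptime a (fun x => encv (c x)) ->
  ptime a (fun x => encv (u x)) -> ptime a (fun x => encv (v x)) ->
  ptime a (fun x => encS (hull (@e x) (c x) (u x) (v x))).
Proof. by have HV := ptime_enum HG; move=> Hc Hu Hv; rewrite /hull /hullF; pt. Qed.

Lemma ptime_apart (c : forall x, T x) : ptime a (fun x => encv (c x)) ->
  ptime a (fun x => encS (apart (@e x) (c x))).
Proof.
have HV := ptime_enum HG; move=> Hc; have /ptime_nb Hn := ptime_set1 HV Hc.
by rewrite /apart; pt.
Qed.

Lemma ptime_ext_set (c : forall x, T x) D : ptime a (fun x => encv (c x)) ->
  ptime a (fun x => encS (D x)) -> ptime a (fun x => encS (ext (@e x) (c x) (D x))).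
Proof. by have HV := ptime_enum HG; move=> Hc HD; have Hn := ptime_nb HD; rewrite /ext; pt. Qed.

Lemma ptime_nbs (s : forall x, seq (T x)) : ptime a (fun x => enc_seq (@encv (T x)) (s x)) ->
  ptime a (fun x => encS (nbs (@e x) (s x))).
Proof. by have HV := ptime_enum HG; move=> Hs; rewrite /nbs; pt. Qed.

Lemma ptime_barrier D (u : forall x, T x) (s : forall x, seq (T x)) :
  ptime a (fun x => encS (D x)) -> ptime a (fun x => encv (u x)) ->
  ptime a (fun x => enc_seq (@encv (T x)) (s x)) ->
  ptime a (fun x => encS (barrier (@e x) (D x) (u x) (s x))).
Proof.
have HV := ptime_enum HG; move=> HD Hu Hs.
have Hn := ptime_nbs (ptime_cons (enc := fun x => @encv (T x)) Hu Hs).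
by rewrite /barrier; pt.
Qed.

End GraphOps.

Definition encW (T : finType) (w : T -> nat) : tree := enc_seq (fun v => enc_nat (w v)) (enum T).

Section Weights.
Variables (E : Type) (a : E -> tree) (T : E -> finType) (w : forall x, T x -> nat).
Hypotheses (HV : ptime a (fun x => enc_seq (@encv (T x)) (enum (T x))))
  (HW : ptime a (fun x => encW (@w x))).

Lemma ptime_weight (v : forall x, T x) : ptime a (fun x => encv (v x)) ->
  ptime a (fun x => enc_nat (w (v x))).
Proof.
move=> Hv.
have HW' : ptime a (fun x => enc_seq id [seq enc_nat (w u) | u <- enum (T x)]).
  by apply: ptime_ext HW => x; rewrite enc_seq_map.
by have := ptime_nth HW' Hv; apply: ptime_ext => x; rewrite nth_enum_index.
Qed.

Lemma ptime_wt (S : forall x, {set T x}) : ptime a (fun x => encS (S x)) ->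
  ptime a (fun x => enc_nat (wt (@w x) (S x))).
Proof.
move=> HS; pose step x acc (v : T x) := if v \in S x then acc + w v else acc.
have E1 x s acc : foldl (@step x) acc s = acc + \sum_(v <- s | v \in S x) w v.
  elim: s acc => [|v s IH] acc; rewrite ?big_nil ?addn0 // big_cons /= IH /step.
  by case: ifP => // _; rewrite addnA.
(* A partial sum has at most as many digits as its summands together, which bounds the accumulator
   by the size of the input. *)
have E2 x s : size (bits (\sum_(v <- s | v \in S x) w v)) <= \sum_(v <- s) size (bits (w v)).
  elim: s => [|v s IH]; rewrite ?big_nil // !big_cons; case: ifP => _.
    by apply: leq_trans (size_bitsD _ _) _; rewrite leq_add2l.
  exact: leq_trans IH (leq_addl _ _).
apply: (ptime_ext (g := fun x => enc_nat (foldl (@step x) 0 (enum (T x))))).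
  by move=> x; rewrite E1 add0n big_enum_cond.
apply: (ptime_fold (encA := fun=> enc_nat) (step := step) (z := fun=> 0) HV
  (S := fun x => (tree_size (encW (@w x)) * 4).+1)).
- exact: ptime_const.
- have Hw := ptime_weight; rewrite /step.
  refine (ptime_ife (enc := fun=> enc_nat) _ _ _); first by pt_under2; pt.
    apply: ptime_addn; first exact: (ptime_lift _ (ptime_var _ _)).
    set a' := env _ _.
    have HW2 : ptime a' (fun s => enc_seq id [seq enc_nat (w u) | u <- enum (T (tag (tag s)))]).
      apply: (ptime_ext (g := fun s => encW (@w (tag (tag s))))).
        by move=> s; rewrite enc_seq_map.
      exact: (ptime_lift _ (ptime_lift _ HW)).
    have := ptime_nth HW2 (ptime_var _ _); apply: ptime_ext => s.
    by rewrite nth_enum_index.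
  exact: (ptime_lift _ (ptime_var _ _)).
- apply: (pbound_le (F' := fun x => tree_size (encW (@w x)) * 4 + 1)); first by move=> x; rewrite addn1.
  apply: pbound_add (pbound_const _ _); apply: pbound_mul (pbound_const _ _); exact: ptime_size.
move=> x i; rewrite E1 add0n; set t := take i _.
have /andP[_ le1] := size_enc_bits (bits (\sum_(v <- t | v \in S x) w v)).
apply: leq_trans le1 _; rewrite ltnS leq_mul2r /=; apply: leq_trans (E2 x t) _.
apply: leq_trans (size_enc_seq_take (fun v => enc_nat (w v)) (enum (T x)) i); rewrite -/t size_enc_seq.
apply: leq_trans (leq_sum _ _) (leq_trans (leq_addl (size t) _) (leqnSn _)) => v _.
by have /andP[/ltnW] := size_enc_bits (bits (w v)).
Qed.

End Weights.

Lemma ptime_best (E : Type) (a : E -> tree) (T : E -> finType) (w : forall x, T x -> nat)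
    (l : forall x, seq {set T x}) :
  ptime a (fun x => enc_seq (@encv (T x)) (enum (T x))) -> ptime a (fun x => encW (@w x)) ->
  ptime a (fun x => enc_seq (@encS (T x)) (l x)) -> ptime a (fun x => encS (best (@w x) (l x))).
Proof.
move=> HV HW Hl; have [K HK KB] := pbound_encS HV.
apply: (ptime_fold (encA := fun x => @encS (T x)) Hl _ _ HK) => [||x i]; last exact: KB.
  exact: ptime_set0.
apply: ptime_ifS; last exact: (ptime_lift _ (ptime_var _ _)); last exact: ptime_var.
apply: ptime_leqbits; apply: ptime_wt; try exact: (ptime_lift _ (ptime_lift _ HV));
  try exact: (ptime_lift _ (ptime_lift _ HW)); last exact: ptime_var.
exact: (ptime_lift _ (ptime_var _ _)).
Qed.

Lemma ptime_allpairs (E : Type) (a : E -> tree) (A B : E -> Type) (encA : forall x, A x -> tree)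
    (encB : forall x, B x -> tree) (l : forall x, seq (A x)) (l' : forall x, seq (B x)) :
  ptime a (fun x => enc_seq (@encA x) (l x)) -> ptime a (fun x => enc_seq (@encB x) (l' x)) ->
  ptime a (fun x => enc_seq (enc_pair (@encA x) (@encB x)) [seq (u, v) | u <- l x, v <- l' x]).
Proof.
move=> Hl Hl'; apply: ptime_flatten.
apply: (ptime_mapl (enc' := fun x => enc_seq (enc_pair (encA x) (encB x))) Hl).
by pt_under; pt.
Qed.

Lemma ptime_seqs (E : Type) (a : E -> tree) (A : E -> Type) (enc : forall x, A x -> tree) n
    (l : forall x, seq (A x)) : ptime a (fun x => enc_seq (@enc x) (l x)) ->
  ptime a (fun x => enc_seq (enc_seq (@enc x)) (seqs n (l x))).
Proof.
move=> Hl; elim: n => [|n IH]; first exact: (ptime_const a (Node Leaf Leaf)).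
apply: (ptime_cons (enc := fun x => enc_seq (@enc x)) (u := fun=> [::])
  (l := fun x => flatten [seq [seq y :: s | s <- seqs n (l x)] | y <- l x])); first exact: (ptime_const a Leaf).
apply: (ptime_flatten (enc := fun x => enc_seq (@enc x))).
apply: (ptime_mapl (enc' := fun x => enc_seq (enc_seq (enc x))) Hl).
by pt_under; pt.
Qed.

Lemma ptime_eqpairS (E : Type) (a : E -> tree) (T : E -> finType) (p q : forall x, {set T x} * {set T x}) :
  ptime a (fun x => enc_seq (@encv (T x)) (enum (T x))) ->
  ptime a (fun x => encS (p x).1) -> ptime a (fun x => encS (p x).2) ->
  ptime a (fun x => encS (q x).1) -> ptime a (fun x => encS (q x).2) ->
  ptime a (fun x => enc_bool (p x == q x)).
Proof.
move=> HV p1 p2 q1 q2; have := ptime_andb (ptime_eqS HV p1 q1) (ptime_eqS HV p2 q2).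
by apply: ptime_ext => x; case: (p x) (q x) => ? ? [].
Qed.

Ltac pt_eq ::= first [ solve [apply: ptime_eqv; pt] | solve [apply: ptime_eqn; pt]
  | solve [apply: ptime_eqS; pt] | solve [apply: ptime_eqpairS; pt] ].
Ltac pt_graph :=
  lazymatch goal with
  | |- ptime _ (fun s => enc_seq _ (flatten (map _ _))) => apply: ptime_allpairs; pt
  | |- ptime _ (fun s => enc_seq _ (seqs _ _)) => apply: ptime_seqs; pt
  | |- ptime _ (fun s => encS (best _ _)) => apply: ptime_best; pt
  | |- ptime _ (fun s => encS (nb _ _)) => apply: ptime_nb; pt
  | |- ptime _ (fun s => encS (component _ _ _)) => apply: ptime_component; pt
  | |- ptime _ (fun s => encS (hull _ _ _ _)) => apply: ptime_hull; pt
  | |- ptime _ (fun s => encS (apart _ _)) => apply: ptime_apart; pt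
  | |- ptime _ (fun s => encS (ext _ _ _)) => apply: ptime_ext_set; pt
  | |- ptime _ (fun s => encS (barrier _ _ _ _)) => apply: ptime_barrier; pt
  | |- ptime _ (fun s => enc_bool (touch _ _ _)) => apply: ptime_touch; pt
  | _ => pt_base
  end.
Ltac pt_user ::= pt_graph.

Section Mwis.
Variables (E : Type) (a : E -> tree) (T : E -> finType) (e : forall x, rel (T x))
  (w : forall x, T x -> nat).
Hypotheses (HG : ptime a (fun x => encG (@e x)))
  (HV : ptime a (fun x => enc_seq (@encv (T x)) (enum (T x))))
  (HW : ptime a (fun x => encW (@w x))).
Notation entry x := (T x * {set T x} * {set T x})%type.
Notation part x := ({set T x} * {set T x})%type.
Notation enc_key := (enc_pair (@encv _) (@encS _)).
Notation enc_entry := (enc_pair enc_key (@encS _)).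
Notation enc_part := (enc_pair (@encS _) (@encS _)).

Lemma ptime_tab0 : ptime a (fun x => enc_seq enc_entry (tab0 (@e x))).
Proof.
have Hk : ptime a (fun x => enc_seq enc_key (keys (@e x))) by rewrite /keys; pt.
by rewrite /tab0; pt.
Qed.

Lemma ptime_tabval (tab : forall x, seq (entry x)) B : ptime a (fun x => enc_seq enc_entry (tab x)) ->
  ptime a (fun x => encS (B x)) -> ptime a (fun x => encS (tabval (@w x) (tab x) (B x))).
Proof. by move=> Ht HB; rewrite /tabval; pt. Qed.

Lemma ptime_parts (tab : forall x, seq (entry x)) : ptime a (fun x => enc_seq enc_entry (tab x)) ->
  ptime a (fun x => enc_seq enc_part (parts (tab x))).
Proof. by move=> Ht; rewrite /parts; pt. Qed.

Lemma ptime_okparts M (ps : forall x, seq (part x)) : ptime a (fun x => encS (M x)) ->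
  ptime a (fun x => enc_seq enc_part (ps x)) -> ptime a (fun x => enc_bool (okparts (@e x) (M x) (ps x))).
Proof. by move=> HM Hp; rewrite /okparts; pt. Qed.

End Mwis.

Ltac pt_mwis :=
  lazymatch goal with
  | |- ptime _ (fun s => encS (tabval _ _ _)) => apply: ptime_tabval; pt
  | |- ptime _ (fun s => enc_seq _ (parts _)) => apply: ptime_parts; pt
  | |- ptime _ (fun s => enc_bool (okparts _ _ _)) => apply: ptime_okparts; pt
  | _ => pt_graph
  end.
Ltac pt_user ::= pt_mwis.

Section Mwis2.
Variables (E : Type) (a : E -> tree) (T : E -> finType) (e : forall x, rel (T x))
  (w : forall x, T x -> nat).
Hypotheses (HG : ptime a (fun x => encG (@e x)))
  (HV : ptime a (fun x => enc_seq (@encv (T x)) (enum (T x))))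
  (HW : ptime a (fun x => encW (@w x))).
Notation entry x := (T x * {set T x} * {set T x})%type.
Notation part x := ({set T x} * {set T x})%type.
Notation enc_key := (enc_pair (@encv _) (@encS _)).
Notation enc_entry := (enc_pair enc_key (@encS _)).
Notation enc_part := (enc_pair (@encS _) (@encS _)).

Lemma ptime_combine (tab : forall x, seq (entry x)) W (ps : forall x, seq (part x)) :
  ptime a (fun x => enc_seq enc_entry (tab x)) -> ptime a (fun x => encS (W x)) ->
  ptime a (fun x => enc_seq enc_part (ps x)) ->
  ptime a (fun x => encS (combine (@e x) (@w x) (tab x) (W x) (ps x))).
Proof. by move=> Ht HM Hp; rewrite /combine; pt. Qed.

End Mwis2.

Ltac pt_stage0 :=
  lazymatch goal with
  | |- ptime _ (fun s => encS (combine _ _ _ _ _)) => apply: ptime_combine; pt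
  | _ => pt_mwis
  end.
Ltac pt_user ::= pt_stage0.

Lemma ptime_candidates (E : Type) (a : E -> tree) (T : E -> finType) (e : forall x, rel (T x))
    (w : forall x, T x -> nat) (tab : forall x, seq (T x * {set T x} * {set T x})) (c : forall x, T x) (M : forall x, {set T x}) :
  ptime a (fun x => encG (@e x)) ->
  ptime a (fun x => enc_seq (@encv (T x)) (enum (T x))) ->
  ptime a (fun x => encW (@w x)) ->
  ptime a (fun x => enc_seq (enc_pair (enc_pair (@encv (T x)) (@encS (T x))) (@encS (T x))) (tab x)) ->
  ptime a (fun x => encv (c x)) ->
  ptime a (fun x => encS (M x)) ->
  ptime a (fun x => enc_seq (@encS (T x)) (candidates (@e x) (@w x) (tab x) (c x) (M x))).
Proof. by move=> HG HV HW Ht Hc HM; rewrite /candidates; pt. Qed.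

Ltac pt_stage1 :=
  lazymatch goal with
  | |- ptime _ (fun s => enc_seq _ (candidates _ _ _ _ _)) => apply: ptime_candidates; pt
  | _ => pt_stage0
  end.
Ltac pt_user ::= pt_stage1.

Lemma ptime_tab_step (E : Type) (a : E -> tree) (T : E -> finType) (e : forall x, rel (T x))
    (w : forall x, T x -> nat) (tab : forall x, seq (T x * {set T x} * {set T x})) :
  ptime a (fun x => encG (@e x)) ->
  ptime a (fun x => enc_seq (@encv (T x)) (enum (T x))) ->
  ptime a (fun x => encW (@w x)) ->
  ptime a (fun x => enc_seq (enc_pair (enc_pair (@encv (T x)) (@encS (T x))) (@encS (T x))) (tab x)) ->
  ptime a (fun x => enc_seq (enc_pair (enc_pair (@encv (T x)) (@encS (T x))) (@encS (T x))) (tab_step (@e x) (@w x) (tab x))).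
Proof. by move=> HG HV HW Ht; rewrite /tab_step; pt. Qed.

Ltac pt_stage2 :=
  lazymatch goal with
  | |- ptime _ (fun s => enc_seq _ (tab_step _ _ _)) => apply: ptime_tab_step; pt
  | _ => pt_stage1
  end.
Ltac pt_user ::= pt_stage2.

Lemma size_enc_seq_le (A : Type) (enc : A -> tree) K s : (forall u, tree_size (enc u) <= K) ->
  tree_size (enc_seq enc s) <= size s * K.+1 + 1.
Proof. by move=> HK; elim: s => //= u s IH; have := HK u; rewrite mulSn; lia. Qed.

Lemma size_encv (T : finType) (v : T) : tree_size (encv v) <= (size (enum T)).*2.+1.
Proof. by rewrite size_encn ltnS leq_double index_size. Qed.

(** A round keeps the number of entries, and an entry is a vertex with two sets, so the table stays
    within a bound fixed at the start. *)
Lemma ptime_tab (E : Type) (a : E -> tree) (T : E -> finType) (e : forall x, rel (T x))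
    (w : forall x, T x -> nat) :
  ptime a (fun x => encG (@e x)) ->
  ptime a (fun x => enc_seq (@encv (T x)) (enum (T x))) ->
  ptime a (fun x => encW (@w x)) ->
  ptime a (fun x => enc_seq (enc_pair (enc_pair (@encv (T x)) (@encS (T x))) (@encS (T x))) (iter #|T x| (tab_step (@e x) (@w x)) (tab0 (@e x)))).
Proof.
move=> HG HV HW; have Ht := ptime_tab0 HG HV HW.
have Hs := ptime_size Ht; have Hn := ptime_size HV.
pose n x := tree_size (enc_seq (@encv (T x)) (enum (T x))).
pose m x := tree_size (enc_seq (enc_pair (enc_pair (@encv (T x)) (@encS (T x))) (@encS (T x))) (tab0 (@e x))).
refine (ptime_iter (enc := fun x => enc_seq (enc_pair (enc_pair (@encv (T x)) (@encS (T x))) (@encS (T x)))) (f := fun x => tab_step (@e x) (@w x))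
  (S := fun x => m x * (n x * 20 + 20) + 1) HV Ht _ _ _).
- by clear Hs Hn n m; pt_under; pt.
- apply: pbound_add (pbound_const _ _); apply: pbound_mul => //.
  by apply: pbound_add (pbound_const _ _); apply: pbound_mul (pbound_const _ _).
move=> x i.
have szT : size (enum (T x)) <= n x by rewrite /n size_enc_seq; lia.
have szt : size (iter i (tab_step (@e x) (@w x)) (tab0 (@e x))) <= m x.
  have -> : size (iter i (tab_step (@e x) (@w x)) (tab0 (@e x))) = size (tab0 (@e x)).
    by elim: i => //= i <-; rewrite size_map.
  by rewrite /m size_enc_seq; lia.
apply: leq_trans (size_enc_seq_le (K := n x * 20 + 19) _ _) _; last by rewrite leq_add2r -addnS leq_mul2r szt orbT.
case=> [[c M] S]; change ((tree_size (encv c) + tree_size (encS M)).+1 + tree_size (encS S) < n x * 20 + 19).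
have := size_encv c; have := size_encS M; have := size_encS S; lia.
 Qed.

Lemma ptime_mwis (E : Type) (a : E -> tree) (T : E -> finType) (e : forall x, rel (T x))
    (w : forall x, T x -> nat) :
  ptime a (fun x => encG (@e x)) ->
  ptime a (fun x => enc_seq (@encv (T x)) (enum (T x))) ->
  ptime a (fun x => encW (@w x)) ->
  ptime a (fun x => encS (mwis (@e x) (@w x))).
Proof.
move=> HG HV HW.
(* The table is generalized, so that it is carried below the binders as a known list. *)
have key (tab : forall x, seq (T x * {set T x} * {set T x})) : ptime a (fun x => enc_seq (enc_pair (enc_pair (@encv (T x)) (@encS (T x))) (@encS (T x))) (tab x)) ->
  ptime a (fun x => encS (best (@w x)
    [seq [set v | (v == c) || [exists u, (u \in apart (@e x) c) &&
      (v \in tabval (@w x) (tab x) (component (@e x) (apart (@e x) c) u))]] | c <- enum (T x)])).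
  move=> Ht; apply: ptime_best; [exact: HV | exact: HW |].
  apply: (ptime_mapl (enc := fun x => @encv (T x)) (enc' := fun x => @encS (T x)) HV).
  by pt_under; pt.
exact: (key _ (ptime_tab HG HV HW)).
 Qed.

(** An ordinal is encoded by its value, so programs for the graph of pieces run over plain
    numbers. *)
Lemma enc_ord m (F : nat -> tree) :
  enc_seq (fun i : 'I_m => F i) (enum 'I_m) = enc_seq F (iota 0 m).
Proof. by rewrite -val_enum_ord enc_seq_map. Qed.

Lemma ptime_ordn (E : Type) (a : E -> tree) (m : E -> nat) (i : forall x, 'I_(m x)) :
  ptime a (fun x => encv (i x)) -> ptime a (fun x => encn (i x)).
Proof. by apply: ptime_ext => x; rewrite /encv index_enum_ord. Qed.

Lemma ptime_nthS (E : Type) (a : E -> tree) (T : E -> finType) (cs : forall x, seq {set T x}) (i : E -> nat) :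
  ptime a (fun x => enc_seq (@encv (T x)) (enum (T x))) ->
  ptime a (fun x => enc_seq (@encS (T x)) (cs x)) ->
  ptime a (fun x => encn (i x)) ->
  ptime a (fun x => encS (nth set0 (cs x) (i x))).
Proof.
move=> HV Hc Hi.
have Hl : ptime a (fun x => enc_seq id [seq encS A | A <- cs x]).
  by apply: ptime_ext Hc => x; rewrite enc_seq_map.
have Hlt : ptime a (fun x => enc_bool (i x < size (cs x))).
  apply: ptime_leq (ptime_size_seq Hc); exact: (ptime_pair (ptime_const a Leaf) Hi).
apply: ptime_ext (ptime_if Hlt (ptime_nth Hl Hi) (ptime_set0 HV)) => x.
by case: ltnP => Hx; [rewrite (nth_map set0) | rewrite nth_default].
 Qed.

Ltac pt_stage3 :=
  lazymatch goal with
  | |- ptime _ (fun s => encS (nth set0 _ _)) => apply: ptime_nthS; pt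
  | |- ptime _ (fun s => encn (nat_of_ord _)) => apply: ptime_ordn; pt
  | |- ptime _ (fun s => encS (mwis _ _)) => apply: ptime_mwis; pt
  | _ => pt_stage2
  end.
Ltac pt_user ::= pt_stage3.

Lemma ptime_blob_adj (E : Type) (a : E -> tree) (T : E -> finType) (e : forall x, rel (T x)) (cs : forall x, seq {set T x}) :
  ptime a (fun x => encG (@e x)) ->
  ptime a (fun x => enc_seq (@encv (T x)) (enum (T x))) ->
  ptime a (fun x => enc_seq (@encS (T x)) (cs x)) ->
  ptime a (fun x => encG (@blob_adj _ (@e x) (cs x))).
Proof.
move=> HG HV Hc; have Hi := ptime_iota (ptime_size_seq Hc).
apply: (ptime_ext (g := fun x => enc_seq (fun i => enc_seq (fun j => enc_bool ((i != j) &&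
  touch (@e x) (nth set0 (cs x) i) (nth set0 (cs x) j))) (iota 0 (size (cs x)))) (iota 0 (size (cs x))))).
  move=> x; rewrite -enc_ord; apply: eq_enc_seq => i _; rewrite -enc_ord.
  by apply: eq_enc_seq => j _; rewrite /blob_adj -(inj_eq val_inj).
apply: (ptime_map Hi); pt_under.
lazymatch goal with H : ptime _ (fun s => enc_seq encn (iota _ _)) |- _ => apply: (ptime_map H) end.
by pt_under; pt.
 Qed.

Lemma ptime_blob_wt (E : Type) (a : E -> tree) (T : E -> finType) (w : forall x, T x -> nat) (cs : forall x, seq {set T x}) :
  ptime a (fun x => enc_seq (@encv (T x)) (enum (T x))) ->
  ptime a (fun x => encW (@w x)) ->
  ptime a (fun x => enc_seq (@encS (T x)) (cs x)) ->
  ptime a (fun x => encW (@blob_wt _ (@w x) (cs x))).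
Proof.
move=> HV HW Hc; have Hi := ptime_iota (ptime_size_seq Hc).
apply: (ptime_ext (g := fun x => enc_seq (fun i => enc_nat (wt (@w x) (nth set0 (cs x) i)))
  (iota 0 (size (cs x))))); first by move=> x; rewrite -enc_ord.
by apply: (ptime_map Hi); pt_under; apply: ptime_wt; pt.
 Qed.

Lemma ptime_blob_union (E : Type) (a : E -> tree) (T : E -> finType) (e : forall x, rel (T x))
    (w : forall x, T x -> nat) (cs : forall x, seq {set T x}) :
  ptime a (fun x => encG (@e x)) ->
  ptime a (fun x => enc_seq (@encv (T x)) (enum (T x))) ->
  ptime a (fun x => encW (@w x)) ->
  ptime a (fun x => enc_seq (@encS (T x)) (cs x)) ->
  ptime a (fun x => encS (blob_union (@e x) (@w x) (cs x))).
Proof.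
move=> HG HV HW Hc; have HG' := ptime_blob_adj HG HV Hc; have HV' := ptime_enum HG'.
have HM := ptime_mwis HG' HV' (ptime_blob_wt HV HW Hc).
by rewrite /blob_union; pt.
 Qed.

Lemma ptime_act (E : Type) (a : E -> tree) (T : E -> finType) (L : forall x, seq {set T x}) :
  ptime a (fun x => enc_seq (@encv (T x)) (enum (T x))) ->
  ptime a (fun x => enc_seq (@encS (T x)) (L x)) ->
  ptime a (fun x => encS (act (L x))).
Proof. by move=> HV HL; rewrite /act; pt. Qed.

Lemma ptime_restr (E : Type) (a : E -> tree) (T : E -> finType) (L : forall x, seq {set T x}) (R : forall x, {set T x}) :
  ptime a (fun x => enc_seq (@encv (T x)) (enum (T x))) ->
  ptime a (fun x => enc_seq (@encS (T x)) (L x)) ->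
  ptime a (fun x => encS (R x)) ->
  ptime a (fun x => enc_seq (@encS (T x)) (restr (L x) (R x))).
Proof. by move=> HV HL HR; rewrite /restr; pt. Qed.

Lemma ptime_verts (E : Type) (a : E -> tree) (T : E -> finType) (s : forall x, seq (T x * nat)) :
  ptime a (fun x => enc_seq (@encv (T x)) (enum (T x))) ->
  ptime a (fun x => (enc_seq (enc_pair (@encv (T x)) encn)) (s x)) ->
  ptime a (fun x => encS (verts (s x))).
Proof. by move=> HV Hs; rewrite /verts; pt. Qed.

Lemma ptime_colset (E : Type) (a : E -> tree) (T : E -> finType) (s : forall x, seq (T x * nat)) (c : E -> nat) :
  ptime a (fun x => enc_seq (@encv (T x)) (enum (T x))) ->
  ptime a (fun x => (enc_seq (enc_pair (@encv (T x)) encn)) (s x)) ->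
  ptime a (fun x => encn (c x)) ->
  ptime a (fun x => encS (colset (s x) (c x))).
Proof. by move=> HV Hs Hc; rewrite /colset; pt. Qed.

Lemma ptime_trace (E : Type) (a : E -> tree) (T : E -> finType) (e : forall x, rel (T x)) (D : forall x, {set T x}) (v : forall x, T x) :
  ptime a (fun x => encG (@e x)) ->
  ptime a (fun x => enc_seq (@encv (T x)) (enum (T x))) ->
  ptime a (fun x => encS (D x)) ->
  ptime a (fun x => encv (v x)) ->
  ptime a (fun x => encS (trace (@e x) (D x) (v x))).
Proof. by move=> HG HV HD Hv; rewrite /trace; pt. Qed.

Lemma ptime_outside (E : Type) (a : E -> tree) (T : E -> finType) (e : forall x, rel (T x)) (D : forall x, {set T x}) :
  ptime a (fun x => encG (@e x)) ->
  ptime a (fun x => enc_seq (@encv (T x)) (enum (T x))) ->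
  ptime a (fun x => encS (D x)) ->
  ptime a (fun x => encS (outside (@e x) (D x))).
Proof. by move=> HG HV HD; rewrite /outside; pt. Qed.

Lemma ptime_connb (E : Type) (a : E -> tree) (T : E -> finType) (e : forall x, rel (T x)) (D : forall x, {set T x}) :
  ptime a (fun x => encG (@e x)) ->
  ptime a (fun x => enc_seq (@encv (T x)) (enum (T x))) ->
  ptime a (fun x => encS (D x)) ->
  ptime a (fun x => enc_bool (connb (@e x) (D x))).
Proof. by move=> HG HV HD; rewrite /connb; pt. Qed.

Lemma ptime_iotak (E : Type) (a : E -> tree) k : ptime a (fun=> enc_seq encn (iota 0 k)).
Proof. exact: ptime_const. Qed.

Ltac pt_stage4 :=
  lazymatch goal with
  | |- ptime _ (fun s => encS (act _)) => apply: ptime_act; pt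
  | |- ptime _ (fun s => enc_seq _ (restr _ _)) => apply: ptime_restr; pt
  | |- ptime _ (fun s => encS (verts _)) => apply: ptime_verts; pt
  | |- ptime _ (fun s => encS (colset _ _)) => apply: ptime_colset; pt
  | |- ptime _ (fun s => encS (trace _ _ _)) => apply: ptime_trace; pt
  | |- ptime _ (fun s => encS (outside _ _)) => apply: ptime_outside; pt
  | |- ptime _ (fun s => enc_bool (connb _ _)) => apply: ptime_connb; pt
  | |- ptime _ (fun s => enc_seq _ (iota 0 _)) => apply: ptime_iotak
  | |- ptime _ (fun s => encS (blob_union _ _ _)) => apply: ptime_blob_union; pt
  | _ => pt_stage3
  end.
Ltac pt_user ::= pt_stage4.

Lemma ptime_valid (E : Type) (a : E -> tree) (T : E -> finType) (e : forall x, rel (T x)) (L : forall x, seq {set T x}) (g : forall x, seq (T x * nat) * seq (T x * nat)) :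
  ptime a (fun x => encG (@e x)) ->
  ptime a (fun x => enc_seq (@encv (T x)) (enum (T x))) ->
  ptime a (fun x => enc_seq (@encS (T x)) (L x)) ->
  ptime a (fun x => (enc_pair (enc_seq (enc_pair (@encv (T x)) encn)) (enc_seq (enc_pair (@encv (T x)) encn))) (g x)) ->
  ptime a (fun x => enc_bool (valid (@e x) (L x) (g x))).
Proof. by move=> HG HV HL Hg; pt_split Hg; rewrite /valid; pt. Qed.

Lemma ptime_interior (E : Type) (a : E -> tree) (T : E -> finType) (e : forall x, rel (T x)) (L : forall x, seq {set T x}) (D : forall x, {set T x}) :
  ptime a (fun x => encG (@e x)) ->
  ptime a (fun x => enc_seq (@encv (T x)) (enum (T x))) ->
  ptime a (fun x => enc_seq (@encS (T x)) (L x)) ->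
  ptime a (fun x => encS (D x)) ->
  ptime a (fun x => encS (interior (@e x) (L x) (D x))).
Proof. by move=> HG HV HL HD; rewrite /interior; pt. Qed.

Lemma ptime_list1 (E : Type) (a : E -> tree) (T : E -> finType) (e : forall x, rel (T x)) r (L : forall x, seq {set T x}) (D0 : forall x, {set T x}) (s : forall x, seq (T x * nat)) (D : forall x, {set T x}) (c : E -> nat) :
  ptime a (fun x => encG (@e x)) ->
  ptime a (fun x => enc_seq (@encv (T x)) (enum (T x))) ->
  ptime a (fun x => enc_seq (@encS (T x)) (L x)) ->
  ptime a (fun x => encS (D0 x)) ->
  ptime a (fun x => (enc_seq (enc_pair (@encv (T x)) encn)) (s x)) ->
  ptime a (fun x => encS (D x)) ->
  ptime a (fun x => encn (c x)) ->
  ptime a (fun x => encS (list1 (@e x) r (L x) (D0 x) (colset (s x)) (D x) (c x))).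
Proof. by move=> HG HV HL HD0 Hs HD Hc; rewrite /list1 /present /large; pt. Qed.

Ltac pt_stage5 :=
  lazymatch goal with
  | |- ptime _ (fun s => encS (list1 _ _ _ _ _ _ _)) => apply: ptime_list1; pt
  | _ => pt_stage4
  end.
Ltac pt_user ::= pt_stage5.

Lemma ptime_list2 (E : Type) (a : E -> tree) (T : E -> finType) (e : forall x, rel (T x)) r (L : forall x, seq {set T x}) (D0 : forall x, {set T x}) (s : forall x, seq (T x * nat)) (D : forall x, {set T x}) (c : E -> nat) :
  ptime a (fun x => encG (@e x)) ->
  ptime a (fun x => enc_seq (@encv (T x)) (enum (T x))) ->
  ptime a (fun x => enc_seq (@encS (T x)) (L x)) ->
  ptime a (fun x => encS (D0 x)) ->
  ptime a (fun x => (enc_seq (enc_pair (@encv (T x)) encn)) (s x)) ->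
  ptime a (fun x => encS (D x)) ->
  ptime a (fun x => encn (c x)) ->
  ptime a (fun x => encS (list2 (@e x) r (L x) (D0 x) (colset (s x)) (D x) (c x))).
Proof. by move=> HG HV HL HD0 Hs HD Hc; rewrite /list2; pt. Qed.

Ltac pt_stage6 :=
  lazymatch goal with
  | |- ptime _ (fun s => encS (list2 _ _ _ _ _ _ _)) => apply: ptime_list2; pt
  | _ => pt_stage5
  end.
Ltac pt_user ::= pt_stage6.

Lemma ptime_sublists (E : Type) (a : E -> tree) (T : E -> finType) (e : forall x, rel (T x)) k r (L : forall x, seq {set T x}) (g : forall x, seq (T x * nat) * seq (T x * nat)) (A : forall x, {set T x}) :
  ptime a (fun x => encG (@e x)) ->
  ptime a (fun x => enc_seq (@encv (T x)) (enum (T x))) ->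
  ptime a (fun x => enc_seq (@encS (T x)) (L x)) ->
  ptime a (fun x => (enc_pair (enc_seq (enc_pair (@encv (T x)) encn)) (enc_seq (enc_pair (@encv (T x)) encn))) (g x)) ->
  ptime a (fun x => encS (A x)) ->
  ptime a (fun x => enc_seq (@encS (T x)) (sublists (@e x) k r (L x) (g x) (A x))).
Proof. by move=> HG HV HL Hg HA; pt_split Hg; rewrite /sublists /allowed; pt. Qed.

Lemma ptime_guesses (E : Type) (a : E -> tree) (T : E -> finType) k N1 N2 :
  ptime a (fun x => enc_seq (@encv (T x)) (enum (T x))) ->
  ptime a (fun x => enc_seq (enc_pair (enc_seq (enc_pair (@encv (T x)) encn)) (enc_seq (enc_pair (@encv (T x)) encn))) (guesses (T x) k N1 N2)).
Proof. by move=> HV; rewrite /guesses /pairs; pt. Qed.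

Ltac pt_stage7 :=
  lazymatch goal with
  | |- ptime _ (fun s => enc_bool (valid _ _ _)) => apply: ptime_valid; pt
  | |- ptime _ (fun s => encS (interior _ _ _)) => apply: ptime_interior; pt
  | |- ptime _ (fun s => enc_seq _ (sublists _ _ _ _ _ _)) => apply: ptime_sublists; pt
  | |- ptime _ (fun s => enc_seq _ (guesses _ _ _ _)) => apply: ptime_guesses; pt
  | _ => pt_stage6
  end.
Ltac pt_user ::= pt_stage7.

(** Quantified over all contexts, because [solve] calls itself below the binders of a guess and of a
    vertex. The depth [j] is fixed, so each level may raise the degree of the polynomial. *)
Definition ptime_solves k r N1 N2 j := forall (E : Type) (a : E -> tree) (T : E -> finType) (e : forall x, rel (T x))
    (w : forall x, T x -> nat) (L : forall x, seq {set T x}),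
  ptime a (fun x => encG (@e x)) ->
  ptime a (fun x => enc_seq (@encv (T x)) (enum (T x))) ->
  ptime a (fun x => encW (@w x)) ->
  ptime a (fun x => enc_seq (@encS (T x)) (L x)) ->
  ptime a (fun x => encS (solve (@e x) (@w x) k r N1 N2 j (L x))).

Ltac pt_solve :=
  lazymatch goal with
  | H : ptime_solves _ _ _ _ _ |- ptime _ (fun s => encS (solve _ _ _ _ _ _ _ _)) =>
    refine (H _ _ _ _ _ _ _ _ _ _); pt
  | _ => pt_stage7
  end.
Ltac pt_user ::= pt_solve.

Lemma ptime_dom (E : Type) (a : E -> tree) (T : E -> finType) (e : forall x, rel (T x))
    (w : forall x, T x -> nat) k r N1 N2 j (L : forall x, seq {set T x}) (g : forall x, seq (T x * nat) * seq (T x * nat)) :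
  ptime_solves k r N1 N2 j ->
  ptime a (fun x => encG (@e x)) ->
  ptime a (fun x => enc_seq (@encv (T x)) (enum (T x))) ->
  ptime a (fun x => encW (@w x)) ->
  ptime a (fun x => enc_seq (@encS (T x)) (L x)) ->
  ptime a (fun x => (enc_pair (enc_seq (enc_pair (@encv (T x)) encn)) (enc_seq (enc_pair (@encv (T x)) encn))) (g x)) ->
  ptime a (fun x => encS (dom (@e x) k r (solve (@e x) (@w x) k r N1 N2 j) (L x) (g x))).
Proof. by move=> Hj HG HV HW HL Hg; pt_split Hg; rewrite /dom; pt. Qed.

Ltac pt_dom :=
  lazymatch goal with
  | |- ptime _ (fun s => encS (dom _ _ _ _ _ _)) => apply: ptime_dom; [eassumption | pt ..]
  | _ => pt_solve
  end.
Ltac pt_user ::= pt_dom.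

Lemma ptime_pieces (E : Type) (a : E -> tree) (T : E -> finType) (e : forall x, rel (T x))
    (w : forall x, T x -> nat) k r N1 N2 j (L : forall x, seq {set T x}) :
  ptime_solves k r N1 N2 j ->
  ptime a (fun x => encG (@e x)) ->
  ptime a (fun x => enc_seq (@encv (T x)) (enum (T x))) ->
  ptime a (fun x => encW (@w x)) ->
  ptime a (fun x => enc_seq (@encS (T x)) (L x)) ->
  ptime a (fun x => enc_seq (@encS (T x)) (pieces (@e x) k r N1 N2 (solve (@e x) (@w x) k r N1 N2 j) (L x))).
Proof. by move=> Hj HG HV HW HL; rewrite /pieces; pt. Qed.

Ltac pt_pieces :=
  lazymatch goal with
  | |- ptime _ (fun s => enc_seq _ (pieces _ _ _ _ _ _ _)) => apply: ptime_pieces; [eassumption | pt ..]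
  | _ => pt_dom
  end.
Ltac pt_user ::= pt_pieces.

Lemma ptime_solve k r N1 N2 j : ptime_solves k r N1 N2 j.
Proof.
elim: j => [|j Hj] E a T e w L HG HV HW HL; first exact: ptime_set0.
apply: (ptime_ext (g := fun x => encS (best (@w x)
  ([seq dom (@e x) k r (solve (@e x) (@w x) k r N1 N2 j) (L x) g | g <- guesses (T x) k N1 N2] ++
   [seq [set v | (v \in dom (@e x) k r (solve (@e x) (@w x) k r N1 N2 j)
       (restr (L x) (interior (@e x) (L x) (verts g.1))) g) ||
     (v \in blob_union (@e x) (@w x) (pieces (@e x) k r N1 N2 (solve (@e x) (@w x) k r N1 N2 j)
       (restr (L x) (outside (@e x) (verts g.1)))))] | g <- guesses (T x) k N1 N2])))).
  by move=> x; rewrite solveS.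
by pt.
Qed.

(** * From the forbidden induced subgraph and colourings of the statement to the algorithm *)

Lemma path5_twin (i j : 'I_5) : (forall z, path_adj i z = path_adj j z) -> i = j.
Proof.
case: i j => [[|[|[|[|[|i]]]]] Hi] [[|[|[|[|[|j]]]]] Hj] // H; first [ by apply: val_inj | exfalso ];
  move: (H (@Ordinal 5 0 isT)) (H (@Ordinal 5 1 isT)) (H (@Ordinal 5 2 isT))
    (H (@Ordinal 5 3 isT)) (H (@Ordinal 5 4 isT)); by rewrite /path_adj.
Qed.

Lemma induced_copy (F G : sgraph) (f : F -> G) : injective f ->
  (forall x y, adj (f x) (f y) = adj x y) -> ~ induced_free F G.
Proof.
move=> f_inj f_adj /(_ [set f x | x : F]); apply.
have pre (y : {y : G | y \in [set f x | x : F]}) : exists x, f x = sval y.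
  by case: y => y /= /imsetP[x _ ->]; exists x.
have [g Hg] := fin_all_exists pre.
have fP x : f x \in [set f z | z : F] by apply: imset_f.
exists g => [|x y]; last by rewrite -f_adj !Hg.
exists (fun x => exist _ (f x) (fP x)) => [y|x]; first by apply: val_inj; rewrite /= Hg.
by apply: f_inj; rewrite Hg.
Qed.

(** A path in [far J] together with [J] is the forbidden graph. The map is injective because equal
    images have equal adjacencies: path vertices have pairwise different neighbourhoods, none of
    them empty, and [J] is enumerated injectively. *)
Lemma induced_free_p5r (G : sgraph) r :
  induced_free (dunion (path_graph 5) (edgeless_graph r)) G -> p5r_free (@adj G) r.
Proof.
move=> free J cJ indJ [a [b [c [d [f [/and5P[aF bF cF dF fF] P]]]]]].
have Ps : p5 (@adj G) a b c d f := P.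
move: P; rewrite /p5 => /and5P[ab bc cd df /and5P[ac ad af bd /andP[bf cf]]].
pose s := [:: a; b; c; d; f].
have sF i : i < 5 -> nth a s i \in far (@adj G) J by case: i => [|[|[|[|[|i]]]]].
have sadj (i j : 'I_5) : adj (nth a s i) (nth a s j) = path_adj i j.
  have sy := @adj_sym G; have ir := @adj_irr G.
  by case: i j => [[|[|[|[|[|i]]]]] Hi] [[|[|[|[|[|j]]]]] Hj] //; rewrite /path_adj /= ?ir //;
    first [ exact/idP | by apply/negbTE | by rewrite sy; first [exact/idP | by apply/negbTE] ].
pose g (j : 'I_r) : G := enum_val (cast_ord (Logic.eq_sym cJ) j).
have gJ j : g j \in J by apply: enum_valP.
pose h (x : dunion (path_graph 5) (edgeless_graph r)) : G :=
  match x with inl i => nth a s (i : 'I_5) | inr j => g j end.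
have hadj x y : adj (h x) (h y) = adj x y.
  case: x y => [i|i] [j|j] /=; first exact: sadj.
  - by rewrite adj_sym; apply/negbTE; have /farP/(_ _ (gJ j)) := sF _ (ltn_ord i).
  - by apply/negbTE; have /farP/(_ _ (gJ i)) := sF _ (ltn_ord j).
  - by apply/negbTE; apply: indJ.
apply: (induced_copy _ hadj free).
have nbr (i : 'I_5) : exists j : 'I_5, path_adj i j.
  by case: i => [[|[|[|[|[|i]]]]] Hi] //; [exists (@Ordinal 5 1 isT) | exists (@Ordinal 5 0 isT) |
    exists (@Ordinal 5 1 isT) | exists (@Ordinal 5 2 isT) | exists (@Ordinal 5 3 isT)].
have twin x y : h x = h y -> forall z, adj x z = adj y z by move=> E z; rewrite -!hadj E.
move=> [i|i] [j|j] E; have tw := twin _ _ E.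
- by congr inl; apply: path5_twin => z; apply: (tw (inl z)).
- by have [z iz] := nbr i; have := tw (inl z); rewrite /= iz.
- by have [z jz] := nbr j; have := tw (inl z); rewrite /= jz.
- by congr inr; apply: (@cast_ord_inj _ _ (Logic.eq_sym cJ)); apply: enum_val_inj.
Qed.

Lemma colourable_lcolourable k (G : sgraph) (S : {set G}) :
  colourable k (induced S) -> lcolourable (@adj G) (nseq k setT) S.
Proof.
move=> [c Hc].
pose col v := if insub v is Some y then nat_of_ord (c y) else 0.
have colE v (vS : v \in S) : col v = c (exist _ v vS) by rewrite /col insubT.
exists col; split=> [v vS|u v uS vS uv]; first by rewrite nth_nseq colE ltn_ord in_setT.
by rewrite !colE; apply: (Hc (exist _ u uS) (exist _ v vS)).
Qed.

Lemma lcolourable_colourable k (G : sgraph) (S : {set G}) :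
  lcolourable (@adj G) (nseq k setT) S -> colourable k (induced S).
Proof.
move=> [col lc]; have [Hk _] := lcol_kcol lc; rewrite size_nseq in Hk.
exists (fun y : {x : G | x \in S} => Ordinal (Hk (sval y) (svalP y))) => x y xy.
exact: (proj2 lc _ _ (svalP x) (svalP y) xy).
Qed.

Lemma ptime_full (E : Type) (a : E -> tree) (T : E -> finType) k :
  ptime a (fun x => enc_seq (@encv (T x)) (enum (T x))) ->
  ptime a (fun x => enc_seq (@encS (T x)) (nseq k setT)).
Proof.
move=> HV; elim: k => [|k IH]; first exact: (ptime_const a Leaf).
apply: (ptime_cons (enc := fun x => @encS (T x)) (u := fun=> setT)) IH.
apply: (ptime_ext (g := fun x => encS [set v : T x | true])).
  by move=> x; congr encS; apply/setP => v; rewrite !inE.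
by apply: ptime_set => //; apply: ptime_const.
Qed.

Lemma horner_succ d n : ((('X + 1%:P) ^+ d : {poly nat}).[n])%R = n.+1 ^ d.
Proof.
elim: d => [|d IH]; first by rewrite GRing.expr0 hornerC.
rewrite GRing.exprS hornerM IH hornerD hornerX hornerC expnS.
by change ((n + 1) * n.+1 ^ d = n.+1 * n.+1 ^ d); rewrite addn1.
Qed.

Theorem theorem1p1 (k r : nat) :
  exists (c : cmd) (p : {poly nat}),
    forall (G : sgraph) (w : G -> nat),
      induced_free (dunion (path_graph 5) (edgeless_graph r)) G ->
      exists S : {set G},
        max_weight_colourable k w S /\
        runs_within c (enc_instance w) (enc_set S)
          (p.[tree_size (enc_instance w)])%R.
Proof.
pose N1 := 5 + k * r + r * (1 + 2 * (k * k)) + r.+1 * (1 + 2 * (k * k) + k + k).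
pose N2 := dec_bound r k N1.
(* All instances together form the index type, so one program and one degree serve them all. *)
pose E := {G : sgraph & G -> nat}.
pose a (x : E) := enc_instance (tagged x).
have HG : ptime a (fun x => encG (@adj (tag x))) := ptime_hd (ptime_id a).
have HW : ptime a (fun x => encW (tagged x)) := ptime_tl (ptime_id a).
have HV := ptime_enum HG.
have [c [F [[d Hd] Hc]]] := ptime_solve k r N1 N2 k HG HV HW (ptime_full k HV).
(* At base register 0 the input and the output are both in variable 0; the polynomial (X + 1)^d is
   the form in which [pbound] states its bounds. *)
exists (c 0), (('X + 1%:P) ^+ d)%R => G w free.
pose L := nseq k (setT : {set G}).
exists (solve (@adj G) w k r N1 N2 k L).
have sy := @adj_sym G; have ir := @adj_irr G; split; last first.
  have [t [s [He Hs _ Ht]]] := Hc (existT _ G w) 0 (init_store (enc_instance w)) (update_same _ _ _).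
  by exists t, s; split=> //; rewrite horner_succ; apply: leq_trans Ht (Hd (existT _ G w)).
split; first by apply: lcolourable_colourable; apply: solve_sound.
move=> S' /colourable_lcolourable lS'.
have free' := induced_free_p5r free.
apply: (solve_ge (j := k) (k := k) (r := r) (N1 := N1) (N2 := N2) w sy ir free' _ _ _ _ _ _ lS').
- by rewrite /N1; lia.
- by rewrite /N1; lia.
- by rewrite /N1; lia.
- by [].
- exact: size_nseq.
- by apply: leq_trans (max_card _) _; rewrite card_ord.
Qed.
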